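(* Let $\sigma\in\{-1,0,1\}$ and suppose $\omega_L\vee\omega_R>0$. Then for all $\theta_L,\theta_R\in\Theta$ there exists a unique stationary measure $\mu_{\theta_L,\theta_R}$ for the boundary driven particle system $\{\eta_t:t\ge 0\}$. Moreover: (a) If $\sigma=0$, then $\mu_{\theta_L,\theta_R}$ is in product form and is given by $\mu_{\theta_L,\theta_R}=\mu_{\bar{\boldsymbol\theta}}:=\otimes_{x\in V}\nu_{x,\bar\theta_x}$. (b) If either $\sigma=-1$ or $\sigma=1$ and, additionally, $\omega_L,\omega_R>0$ and $\theta_L\neq\theta_R$, then there exist $x,y\in V$ with $x\neq y$ for which $$\mathbb E_{\mu_{\theta_L,\theta_R}}\left[\left(\frac{\eta(x)}{\alpha_x}-\bar\theta_x\right)\left(\frac{\eta(y)}{\alpha_y}-\bar\theta_y\right)\right]\neq 0 .$$ As a consequence, the unique non-equilibrium stationary measure $\mu_{\theta_L,\theta_R}$ is not in product form.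
   Context: Setting. $\mathbb N=\{1,2,\dots\}$, $\mathbb N_0=\mathbb N\cup\{0\}$. Let $N\in\mathbb N$, $V=\{1,\dots,N\}$. Symmetric conductances $\omega_{\{x,y\}}\in[0,\infty)$, $x,y\in V$, with $\omega_{\{x,x\}}=0$; write $x\sim y$ if $\omega_{\{x,y\}}\neq0$ and assume the graph $(V,\sim)$ is connected. Site parameters $\alpha_x\in\mathbb N$, $x\in V$. Boundary parameters $\omega_L,\omega_R\ge0$, $\alpha_L,\alpha_R>0$. $\Theta=[0,1]$ if $\sigma=-1$ and $\Theta=[0,\infty)$ if $\sigma\in\{0,1\}$; $\theta_L,\theta_R\in\Theta$. Boundary driven process. $\mathcal X=\prod_{x\in V}\{0,\dots,\alpha_x\}$ if $\sigma=-1$, $\mathcal X=\mathbb N_0^V$ otherwise. $\{\eta_t\}$ is the Markov process on $\mathcal X$ with generator $\mathcal L=\sum_{\{x,y\}:x\sim y}\omega_{\{x,y\}}\mathcal L_{\{x,y\}}+\omega_L\mathcal L_L+\omega_R\mathcal L_R$ (sum over unordered pairs), where $\mathcal L_{\{x,y\}}f(\eta)=\eta(x)(\alpha_y+\sigma\eta(y))(f(\eta-\delta_x+\delta_y)-f(\eta))+\eta(y)(\alpha_x+\sigma\eta(x))(f(\eta-\delta_y+\delta_x)-f(\eta))$, $\mathcal L_Lf(\eta)=\eta(1)\alpha_L(1+\sigma\theta_L)(f(\eta-\delta_1)-f(\eta))+\alpha_L\theta_L(\alpha_1+\sigma\eta(1))(f(\eta+\delta_1)-f(\eta))$, $\mathcal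 L_Rf(\eta)=\eta(N)\alpha_R(1+\sigma\theta_R)(f(\eta-\delta_N)-f(\eta))+\alpha_R\theta_R(\alpha_N+\sigma\eta(N))(f(\eta+\delta_N)-f(\eta))$. $\mathbb E_\mu[f(\eta_t)]$ is expectation for the process started from law $\mu$; $\mathbb E_\mu[f(\eta)]=\sum_\eta f(\eta)\mu(\eta)$. A probability measure $\mu$ on $\mathcal X$ is called the unique stationary measure if $\lim_{t\to\infty}\mathbb E_{\mu'}[f(\eta_t)]=\mathbb E_\mu[f(\eta)]$ for all bounded $f:\mathcal X\to\mathbb R$ and all probability measures $\mu'$ on $\mathcal X$. Marginals: $\nu_{x,\theta}$ is Binomial$(\alpha_x,\theta)$ if $\sigma=-1$, Poisson$(\alpha_x\theta)$ if $\sigma=0$, and Negative-Binomial$(\alpha_x,\frac{\theta}{1+\theta})$ if $\sigma=1$, i.e. $\nu_{x,\theta}(n)=\frac{\Gamma(\alpha_x+n)}{\Gamma(\alpha_x)\,n!}\left(\frac{\theta}{1+\theta}\right)^n(1+\theta)^{-\alpha_x}$. Profile: $\bar\theta_x:=\mathbb E_{\mu_{\theta_L,\theta_R}}[\eta(x)/\alpha_x]$, equivalently $\bar\theta_x=\theta_R+\widehat p_\infty(\delta_x,\delta_L)(\theta_L-\theta_R)$, where $\widehat p_\infty(\delta_x,\delta_L)$ is the probability that the continuous-time random walk on $V\cup\{L,R\}$ started at $x$, jumping from $y\in V$ to $z\in V$ at rate $\omega_{\{y,z\}}\alpha_z$, from $1$ to $L$ at rate $\omega_L\alpha_L$, from $N$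 to $R$ at rate $\omega_R\alpha_R$, and absorbed at $L$ and $R$, is eventually absorbed at $L$.
   Formalization: Part (b) is stated for N ≥ 2 only: for N = 1 the set V has a single site, so no x ≠ y exist and every measure is trivially of product form, which makes (b) false there. *)

(* Defs.v *)
From HB Require Import structures.
From mathcomp Require Import all_boot all_order all_algebra.
From mathcomp Require Import all_classical all_reals all_analysis.

Set Implicit Arguments.
Unset Strict Implicit.
Unset Printing Implicit Defensive.

Import Order.TTheory GRing.Theory Num.Theory.
Import numFieldNormedType.Exports.

Local Open Scope classical_set_scope.
Local Open Scope ring_scope.

(** The sites 1, ..., N are encoded as ['I_n.+1] with N = n.+1, so that site 1 is
    [ord0] and site N is [ord_max]. *)

Definition in_Theta (R : realType) (sigma : int) (theta : R) : Prop :=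
  0 <= theta /\ (sigma = -1 -> theta <= 1).

Definition adj (R : realType) (n : nat) (omega : 'I_n.+1 -> 'I_n.+1 -> R) :
  rel 'I_n.+1 := fun x y => omega x y != 0.

Definition connected_graph (R : realType) (n : nat)
    (omega : 'I_n.+1 -> 'I_n.+1 -> R) : Prop :=
  forall x y, connect (adj omega) x y.

Definition admissible (n : nat) (sigma : int) (alpha : 'I_n.+1 -> nat) :
  pred {ffun 'I_n.+1 -> nat} :=
  fun eta => (sigma == -1) ==> [forall x, eta x <= alpha x]%N.

Record config (n : nat) (sigma : int) (alpha : 'I_n.+1 -> nat) := Config {
  occupation :> {ffun 'I_n.+1 -> nat};
  occupationP : admissible sigma alpha occupation }.

Lemma admissible0 (n : nat) (sigma : int) (alpha : 'I_n.+1 -> nat) :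
  admissible sigma alpha [ffun=> 0%N].
Proof. by apply/implyP => _; apply/forallP => x; rewrite ffunE. Qed.

HB.instance Definition _ n sigma alpha :=
  [isSub for @occupation n sigma alpha].
HB.instance Definition _ n sigma alpha :=
  [Countable of @config n sigma alpha by <:].
HB.instance Definition _ n sigma alpha :=
  isPointed.Build (@config n sigma alpha) (Config (admissible0 sigma alpha)).
HB.instance Definition _ n sigma alpha :=
  @isMeasurable.Build default_measure_display (@config n sigma alpha)
    discrete_measurable discrete_measurable0
    discrete_measurableC discrete_measurableU.

Section Generator.
Context (R : realType) (n : nat) (sigma : int) (alpha : 'I_n.+1 -> nat).

Local Notation X := (config sigma alpha).
Local Notation "a %:S" := (a%:~R : R) (at level 2, format "a %:S").

(** [insubd eta] leaves [eta] unchanged when the move would exit the state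
    space; such moves, as well as those removing a particle from an empty site,
    have rate 0 in the generator below. *)
Definition hop (x y : 'I_n.+1) (eta : X) : X :=
  insubd eta [ffun z => (eta z - (z == x) + (z == y))%N].
Definition remove_particle (x : 'I_n.+1) (eta : X) : X :=
  insubd eta [ffun z => (eta z - (z == x))%N].
Definition add_particle (x : 'I_n.+1) (eta : X) : X :=
  insubd eta [ffun z => (eta z + (z == x))%N].

Definition bond_generator (x y : 'I_n.+1) (f : X -> R) (eta : X) : R :=
  (eta x)%:R * ((alpha y)%:R + sigma%:S * (eta y)%:R) *
    (f (hop x y eta) - f eta) +
  (eta y)%:R * ((alpha x)%:R + sigma%:S * (eta x)%:R) *
    (f (hop y x eta) - f eta).

(** [L_L] is the case [z := ord0] and [L_R] the case [z := ord_max]. *)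
Definition reservoir_generator (z : 'I_n.+1) (a theta : R)
    (f : X -> R) (eta : X) : R :=
  (eta z)%:R * (a * (1 + sigma%:S * theta)) * (f (remove_particle z eta) - f eta) +
  a * theta * ((alpha z)%:R + sigma%:S * (eta z)%:R) * (f (add_particle z eta) - f eta).

Definition generator (omega : 'I_n.+1 -> 'I_n.+1 -> R)
    (omegaL omegaR alphaL alphaR thetaL thetaR : R)
    (f : X -> R) (eta : X) : R :=
  \sum_(x : 'I_n.+1) \sum_(y : 'I_n.+1 | (x < y)%N && adj omega x y)
    omega x y * bond_generator x y f eta +
  omegaL * reservoir_generator ord0 alphaL thetaL f eta +
  omegaR * reservoir_generator ord_max alphaR thetaR f eta.

End Generator.

Definition bounded_function (T : Type) (R : realType) (f : T -> R) : Prop :=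
  exists M : R, forall x, `|f x| <= M.

Section Process.
Context (d : measure_display) (X : measurableType d) (R : realType).

(** A Markov process is given by its transition kernels: [P t eta] is the law at
    time [t >= 0] of the process started from [eta]. On a countable state space
    from each point of which only finitely many jumps are possible, [L f] makes
    sense for every [f], and being the generator means that the pointwise
    derivative at time 0 of the semigroup is [L f] for bounded [f]. *)
Record markov_process_with_generator (P : R -> R.-pker X ~> X)
    (L : (X -> R) -> X -> R) : Prop := {
  process_init : forall eta A, measurable A -> P 0 eta A = \d_eta A;
  process_semigroup : forall s t eta A, 0 <= s -> 0 <= t -> measurable A ->
    P (s + t) eta A = (\int[P s eta]_zeta P t zeta A)%E;
  process_generator : forall (f : X -> R) eta,
    measurable_fun setT f -> bounded_function f ->
    h^-1 * (\int[P h eta]_(zeta in setT) f zeta - f eta) @[h --> 0^'+]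
      --> L f eta }.

(** E_mu[f(eta_t)] *)
Definition expectation_at (P : R -> R.-pker X ~> X) (mu : probability X R)
    (f : X -> R) (t : R) : R :=
  \int[mu]_(eta in setT) \int[P t eta]_(zeta in setT) f zeta.

Definition is_unique_stationary (P : R -> R.-pker X ~> X)
    (mu : probability X R) : Prop :=
  forall (f : X -> R) (mu' : probability X R),
    measurable_fun setT f -> bounded_function f ->
    expectation_at P mu' f t @[t --> +oo] --> \int[mu]_(eta in setT) f eta.

End Process.

Section Stationary.
Context (R : realType) (n : nat) (sigma : int) (alpha : 'I_n.+1 -> nat).

Local Notation X := (config sigma alpha).

Definition profile (mu : probability X R) (x : 'I_n.+1) : R :=
  \int[mu]_(eta in setT) ((eta x)%:R / (alpha x)%:R).

Definition covariance2 (mu : probability X R) (x y : 'I_n.+1) : R :=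
  \int[mu]_(eta in setT)
    (((eta x)%:R / (alpha x)%:R - profile mu x) *
     ((eta y)%:R / (alpha y)%:R - profile mu y)).

Definition is_product_of (mu : probability X R)
    (m : 'I_n.+1 -> probability nat R) : Prop :=
  forall A : 'I_n.+1 -> set nat,
    mu [set eta : X | forall x, A x (eta x)] = (\prod_x m x (A x))%E.

Definition product_form (mu : probability X R) : Prop :=
  exists m : 'I_n.+1 -> probability nat R, is_product_of mu m.

End Stationary.

(** The marginal for sigma = 0. The last argument of [poisson_prob] is a dummy;
    at rate 0 the library sets it to the Dirac mass at 0. *)
Definition nu_poisson (R : realType) (a : nat) (theta : R) :
  probability nat R := poisson_prob (a%:R * theta) 0%N.

(* Main.v *)
Require Import Defs.
From HB Require Import structures.
From mathcomp Require Import all_boot all_order all_algebra.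
From mathcomp Require Import all_classical all_reals all_analysis.
From mathcomp Require Import ring lra zify.

Set Implicit Arguments.
Unset Strict Implicit.
Unset Printing Implicit Defensive.

Import Order.TTheory GRing.Theory Num.Theory.
Import numFieldNormedType.Exports.

Local Open Scope classical_set_scope.
Local Open Scope ring_scope.

(* Let [h0] be the expected absorption time of one particle and [V] the sum of the
   [(1 + e h0 x) eta x].  For small [e] the function [W = V ^ 2] satisfies
   [L W <= C - c W], even for [sigma = 1] where the rates are quadratic.  The orbits
   [P_t f] solve the backward equation, so a comparison principle turns this into bounds
   on [P_t W]; since moreover one configuration is reachable from all the others, Harris'
   theorem gives [P_t f --> mu f], where [mu] has second moments and [mu (L f) = 0] for
   all [f] of at most quadratic growth such that [L f] also is.

   For [sigma = 0], the profile [T] of [mu] is harmonic, and Mecke's formula shows that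
   the product of the Poisson laws of means [alpha x * T x] is invariant, hence is [mu].

   For [sigma = 1] or [-1], suppose that all covariances vanish and let [v x] be the
   variance of [eta x].  Stationarity of [eta x ^ 2] gives
   [v x = alpha x T x (1 + sigma T x)], and that of [eta x eta y], for [x ~ y], gives
   [v x / alpha x + v y / alpha y = T x + T y + 2 sigma T x T y].  Hence
   [sigma (T x - T y) ^ 2 = 0]: [T] is constant, and harmonicity at the two boundary
   sites forces [thetaL = thetaR]. *)

(** * Integration on discrete spaces *)

(** The kernels [P] are known only through the right derivative at time 0 of [P_t f], for bounded
    [f] and one starting point at a time; no construction of the paths, no stopping times and no
    forward equation are at hand. Hence the unbounded [W] is never put under the semigroup: it is
    the penalty that makes the comparison principle work on an infinite space, and afterwards a
    majorant of bounded functions.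

    The number of particles alone has no downward drift when no particle is next to a reservoir.
    Adding [e] times the expected remaining time to absorption gives every particle a drift [- e]
    wherever it stands; the hops then change [V] by multiples of [e] only, so their noise, quadratic
    in the number of particles for [sigma = 1], is of smaller order in [e].

    In the last step the off-diagonal second moments are prescribed, so that one variance per site
    is left, while there is an equation for each site and one for each bond: the system is
    overdetermined, and its compatibility is what excludes a non-constant profile. *)

Section BoundedFunctions.
Context {X : Type} {R : realType}.
Implicit Types f g : X -> R.

Lemma bounded_cst (a : R) : bounded_function (fun _ : X => a).
Proof. by exists `|a|. Qed.

Lemma boundedD f g : bounded_function f -> bounded_function g ->
  bounded_function (fun x => f x + g x).
Proof.
move=> [M fM] [N gN]; exists (M + N) => x.
by rewrite (le_trans (ler_normD _ _))// lerD.
Qed.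

Lemma boundedM f g : bounded_function f -> bounded_function g ->
  bounded_function (fun x => f x * g x).
Proof.
move=> [M fM] [N gN]; exists (M * N) => x.
by rewrite normrM ler_pM.
Qed.

Lemma boundedN f : bounded_function f -> bounded_function (fun x => - f x).
Proof. by move=> [M fM]; exists M => x; rewrite normrN. Qed.

Lemma boundedB f g : bounded_function f -> bounded_function g ->
  bounded_function (fun x => f x - g x).
Proof. by move=> bf bg; apply: boundedD => //; apply: boundedN. Qed.

Lemma indic_ge0_le1 (A : set X) x : 0 <= (\1_A x : R) <= 1.
Proof. by rewrite indicE ler0n lern1 leq_b1. Qed.

Lemma indic_set1 (x : X) : \1_[set x] x = 1 :> R.
Proof. by rewrite indicE mem_set. Qed.

Lemma indic_set1_neq (x y : X) : y <> x -> \1_[set x] y = 0 :> R.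
Proof. by move=> yx; rewrite indicE memNset. Qed.

Lemma bounded_indic (A : set X) : bounded_function (\1_A : X -> R).
Proof.
exists 1 => x; rewrite indicE.
by case: (x \in A); rewrite ?normr1 ?normr0.
Qed.

Lemma bounded_gt0 f : bounded_function f ->
  exists2 M : R, 0 < M & forall x, `|f x| <= M.
Proof.
move=> [M fM]; exists (`|M| + 1); first by rewrite ltr_wpDl.
by move=> x; rewrite (le_trans (fM x))// (le_trans (ler_norm M))// lerDl.
Qed.

Lemma finite_support_bounded f (A : set X) : finite_set A ->
  (forall x, ~ A x -> f x = 0) -> bounded_function f.
Proof.
move=> finA f0.
have /finite_seqP[s As] := finA : finite_set (A : set {classic X}).
exists (\sum_(y <- s) `|f y|) => x.
have [Ax|/f0 ->] := pselect (A x); last by rewrite normr0 sumr_ge0.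
rewrite As in Ax; rewrite (big_rem (x : {classic X}))//= lerDl.
by apply: sumr_ge0 => y _; apply: normr_ge0.
Qed.

End BoundedFunctions.

Section DiscreteMeasure.
Context d (X : measurableType d) (R : realType).
Context (discX : forall A : set X, measurable A).
Implicit Types (f g : X -> R) (m : {measure set X -> \bar R}).

(** Total mass one is assumed as an equation, so that the lemmas on means serve both for the kernels
    [P t x] and for [probability]. *)
Lemma bounded_integrable m f : m setT = 1%E -> bounded_function f ->
  m.-integrable setT (EFin \o f).
Proof.
move=> m1 [M fM]; apply: measurable_bounded_integrable => //.
- by rewrite m1 ltry.
exists M; split; first exact: num_real.
by move=> y My x _ /=; rewrite (le_trans (fM x))// ltW.
Qed.

Lemma dominated_integrable_real m f g : m.-integrable setT (EFin \o g) ->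
  (forall x, `|f x| <= g x) -> m.-integrable setT (EFin \o f).
Proof.
move=> ig fg; apply: le_integrable ig => //.
by move=> x _ /=; rewrite lee_fin (le_trans (fg x))// ler_norm.
Qed.

Lemma integrable_scale m (a : R) f : m.-integrable setT (EFin \o f) ->
  m.-integrable setT (EFin \o (fun x => a * f x)).
Proof. by move=> fi; apply: (integrableZl measurableT a fi). Qed.

Lemma integrable_add m f g : m.-integrable setT (EFin \o f) ->
  m.-integrable setT (EFin \o g) -> m.-integrable setT (EFin \o (fun x => f x + g x)).
Proof. by move=> fi gi; apply: (integrableD measurableT fi gi). Qed.

Lemma Rintegral_sum m (K : finType) (F : K -> X -> R) :
  (forall i, m.-integrable setT (EFin \o F i)) ->
  m.-integrable setT (EFin \o (fun x => \sum_i F i x)) /\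
  Rintegral m setT (fun x => \sum_i F i x) = \sum_i Rintegral m setT (F i).
Proof.
move=> Fi; suff H (s : seq K) : m.-integrable setT (EFin \o (fun x => \sum_(i <- s) F i x)) /\
    Rintegral m setT (fun x => \sum_(i <- s) F i x) = \sum_(i <- s) Rintegral m setT (F i).
  exact: (H (index_enum K)).
elim: s => [|i s [gs Es]].
  have E0 : (fun x => \sum_(i <- [::]) F i x) = fun=> 0.
    by apply/funext => x; rewrite big_nil.
  rewrite E0 big_nil; split; first exact: integrable0.
  by rewrite Rintegral_cst// mul0r.
have E1 : (fun x => \sum_(j <- i :: s) F j x) = fun x => F i x + \sum_(j <- s) F j x.
  by apply/funext => x; rewrite big_cons.
by rewrite E1; split; [exact: integrable_add|rewrite RintegralD// big_cons Es].
Qed.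

Section Probability.
Context (m : {measure set X -> \bar R}) (m1 : m setT = 1%E).
Local Notation E f := (Rintegral m setT f).

Lemma mean_cst (a : R) : E (fun=> a) = a.
Proof. by rewrite Rintegral_cst//= m1 mulr1. Qed.

Lemma mean_le f g : bounded_function f -> bounded_function g ->
  (forall x, f x <= g x) -> E f <= E g.
Proof. by move=> bf bg fg; apply: le_Rintegral => //; apply: bounded_integrable. Qed.

Lemma meanD f g : bounded_function f -> bounded_function g ->
  E (fun x => f x + g x) = E f + E g.
Proof. by move=> bf bg; apply: RintegralD => //; apply: bounded_integrable. Qed.

Lemma meanB f g : bounded_function f -> bounded_function g ->
  E (fun x => f x - g x) = E f - E g.
Proof. by move=> bf bg; apply: RintegralB => //; apply: bounded_integrable. Qed.

Lemma meanZ a f : bounded_function f -> E (fun x => a * f x) = a * E f.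
Proof. by move=> bf; apply: RintegralZl => //; apply: bounded_integrable. Qed.

Lemma mean_norm_le f (M : R) : (forall x, `|f x| <= M) -> `|E f| <= M.
Proof.
move=> fM; have bf : bounded_function f by exists M.
rewrite ler_norml; apply/andP; split.
  rewrite -[X in X <= _]mean_cst; apply: mean_le => //; first exact: bounded_cst.
  by move=> x; have := fM x; rewrite ler_norml => /andP[].
rewrite -[X in _ <= X]mean_cst; apply: mean_le => //; first exact: bounded_cst.
by move=> x; have := fM x; rewrite ler_norml => /andP[].
Qed.

Lemma mean_bounded_le f (M : R) : bounded_function f -> (forall x, f x <= M) -> E f <= M.
Proof.
move=> bf fM; rewrite -[X in _ <= X]mean_cst.
by apply: mean_le => //; apply: bounded_cst.
Qed.

End Probability.

Lemma mean_indic m A : Rintegral m setT \1_A = fine (m A).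
Proof. by rewrite /Rintegral integral_indic// setIT. Qed.

Lemma mean_dominated_cvg m (f_ : nat -> X -> R) f g :
  m.-integrable setT (EFin \o g) ->
  (forall k x, `|f_ k x| <= g x) ->
  (forall x, f_ ^~ x @ \oo --> f x) ->
  Rintegral m setT (f_ k) @[k --> \oo] --> Rintegral m setT f.
Proof.
move=> ig fg f_f.
have h := @dominated_cvg _ X R m setT measurableT (fun k => EFin \o f_ k) (EFin \o f)
  (EFin \o g).
have {}h : (\int[m]_x (f_ n x)%:E @[n --> \oo] --> \int[m]_x (f x)%:E)%E.
  apply: h => //.
  - by move=> k _ A _; apply: discX.
  - by move=> x _; apply/cvg_EFin; [near=> k|exact: f_f].
  - by move=> k x _ /=; rewrite lee_fin.
have fx x : `|f x| <= g x.
  by apply: (cvgr_to_le (cvg_norm (f_f x))); near=> k; apply: fg.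
apply: fine_cvg; rewrite fineK//.
apply: integrable_fin_num => //; apply: dominated_integrable_real fx => //.
Unshelve. all: by end_near. Qed.

End DiscreteMeasure.

(** * Markov semigroups *)
Section RealLine.
Context {R : realType}.

(** The infimum of the times where [Q] fails is not itself a failure, by the second hypothesis, nor
    a limit of failures from the right, by the third. This replaces mean value arguments, since only
    right derivatives of the orbits are known. *)
Lemma real_induction (Q : R -> Prop) : Q 0 ->
  (forall t, 0 < t -> (forall s, 0 <= s < t -> Q s) -> Q t) ->
  (forall t, 0 <= t -> (forall s, 0 <= s <= t -> Q s) ->
     exists2 e : R, 0 < e & forall s, t < s < t + e -> Q s) ->
  forall t, 0 <= t -> Q t.
Proof.
move=> Q0 Qcl Qop t1 t1_ge0; apply: contrapT => nQt1.
pose S := [set t | 0 <= t /\ ~ Q t].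
have lbS : lbound S 0 by move=> t [].
have St1 : S t1 by [].
have infS : has_inf S by split; [exists t1|exists 0].
have i0 : 0 <= inf S by apply: lb_le_inf => //; exists t1.
have Qlt s : 0 <= s < inf S -> Q s.
  move=> /andP[s0 si]; apply: contrapT => nQs.
  by have := ge_inf infS.2 (conj s0 nQs : S s); rewrite leNgt si.
have Qi : Q (inf S).
  by have [<- //|i_gt0] := eqVneq 0 (inf S); apply: Qcl; rewrite // lt_neqAle i_gt0.
have Qle s : 0 <= s <= inf S -> Q s.
  rewrite [s <= _]le_eqVlt => /andP[s0 /orP[/eqP -> //|si]].
  by apply: Qlt; rewrite s0.
have [e e0 Qe] := Qop _ i0 Qle.
have : inf S + e <= inf S.
  apply: lb_le_inf; first by exists t1.
  move=> t [t0 nQt]; rewrite leNgt; apply/negP => te; apply: nQt.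
  by have [ti|ti] := leP t (inf S); [apply: Qle; rewrite t0|apply: Qe; rewrite ti].
by rewrite gerDl leNgt e0.
Qed.

(** The explicit radius and linear error match [semigroup_right_expansion], so that the two
    expansions can be subtracted in [comparison]. *)
Lemma is_derive_right (f : R -> R) (t df e : R) : is_derive t 1 f df -> 0 < e ->
  exists2 k : R, 0 < k & forall h, 0 < h < k -> `|f (t + h) - f t - h * df| <= e * h.
Proof.
move=> [fd <-] e0; move: fd; rewrite /derivable => /cvg_ex[l fl].
have -> : 'D_1 f t = l by apply: cvg_lim.
move/cvgrPdist_lt : fl => /(_ _ e0); rewrite near_withinE => -[k/= k0 fk].
exists k => // h /andP[h0 hk].
have := fk h; rewrite /= sub0r normrN gtr0_norm// => /(_ hk (lt0r_neq0 h0)).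
rewrite /shift/= /GRing.scale/= mulr1 (addrC h) => /ltW.
rewrite -(ler_pM2r h0) -[X in _ * X <= _ -> _](gtr0_norm h0) -normrM mulrBl distrC.
rewrite mulrAC mulVf ?gt_eqF// mul1r.
by rewrite [l * _]mulrC.
Qed.

Lemma is_derive_left_cts (f : R -> R) (t df e : R) : is_derive t 1 f df -> 0 < e ->
  exists2 k : R, 0 < k & forall s, t - k < s <= t -> `|f t - f s| <= e.
Proof.
move=> [fd _] e0.
have := differentiable_continuous (iffLR (derivable1_diffP _ _) fd).
move/cvgrPdist_le => /(_ _ e0)[k/= k0 fk]; exists k => // s /andP[ks st].
by apply: fk; rewrite /= ger0_norm ?subr_ge0// ltrBlDr -ltrBlDl.
Qed.

End RealLine.

Section Semigroup.
Context d (X : measurableType d) (R : realType).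
Context (discX : forall A : set X, measurable A).
Context (P : R -> R.-pker X ~> X) (L : (X -> R) -> X -> R).
Context (HP : markov_process_with_generator P L).
Implicit Types (f g : X -> R) (s t h e M a : R) (x y : X).

Definition semigroup t f x : R := Rintegral (P t x) setT f.
Local Notation S := semigroup.

Lemma kernel_mass t x : P t x setT = 1%E.
Proof. exact: prob_kernel. Qed.

Lemma semigroup_norm_le t f (M : R) x : (forall y, `|f y| <= M) -> `|S t f x| <= M.
Proof. exact/mean_norm_le/kernel_mass. Qed.

Lemma semigroup_bounded t f : bounded_function f -> bounded_function (S t f).
Proof. by move=> [M fM]; exists M => x; apply: semigroup_norm_le. Qed.

Lemma semigroup_le t f g x : bounded_function f -> bounded_function g ->
  (forall y, f y <= g y) -> S t f x <= S t g x.
Proof. by move=> *; apply: mean_le => //; apply: kernel_mass. Qed.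

Lemma semigroupB t f g x : bounded_function f -> bounded_function g ->
  S t (fun y => f y - g y) x = S t f x - S t g x.
Proof. by move=> *; apply: meanB => //; apply: kernel_mass. Qed.

Lemma semigroupD t f g x : bounded_function f -> bounded_function g ->
  S t (fun y => f y + g y) x = S t f x + S t g x.
Proof. by move=> *; apply: meanD => //; apply: kernel_mass. Qed.

Lemma semigroupZ t a f x : bounded_function f ->
  S t (fun y => a * f y) x = a * S t f x.
Proof. by move=> *; apply: meanZ => //; apply: kernel_mass. Qed.

Lemma semigroup_cst t a x : S t (fun=> a) x = a.
Proof. exact/mean_cst/kernel_mass. Qed.

Lemma semigroup0 f x : S 0 f x = f x.
Proof.
rewrite /S /semigroup /Rintegral (eq_measure_integral (\d_x)).
  by rewrite integral_dirac// ?diracT ?mul1e.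
by move=> A mA _; apply: (process_init HP).
Qed.

(** Chapman-Kolmogorov is given on sets; the integral formula for a composed kernel extends it to
    nonnegative functions. [semigroup_comp] removes the sign condition by adding a bound of [f]. *)
Let semigroup_comp_ge0 s t f x : 0 <= s -> 0 <= t -> bounded_function f ->
  (forall y, 0 <= f y) -> S (s + t) f x = S s (S t f) x.
Proof.
move=> s0 t0 bf f0; rewrite /semigroup /Rintegral; congr fine.
rewrite (eq_measure_integral (mkcomp (P s) (kernel.kernel_snd (T0 := X) (P t)) x)).
  rewrite (@integral_kcomp _ _ _ _ _ _ _ (P s) (kernel.kernel_snd (T0 := X) (P t)) x).
  - apply: eq_integral => y _ /=.
    rewrite fineK//; apply: integrable_fin_num => //.
    exact: bounded_integrable (kernel_mass _ _) bf.
  - by move=> y; rewrite lee_fin.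
  - by move=> _ A _; apply: discX.
by move=> A mA _; rewrite (process_semigroup HP).
Qed.

Lemma semigroup_comp s t f x : 0 <= s -> 0 <= t -> bounded_function f ->
  S (s + t) f x = S s (S t f) x.
Proof.
move=> s0 t0 bf; have [M M0 fM] := bounded_gt0 bf.
have bM := @bounded_cst X R M.
have bfM : bounded_function (fun y => f y + M) by apply: boundedD.
have := @semigroup_comp_ge0 s t _ x s0 t0 bfM.
rewrite semigroupD// (_ : S t _ = fun y => S t f y + M); last first.
  by apply/funext => y; rewrite semigroupD// semigroup_cst.
rewrite semigroupD//; last exact: semigroup_bounded.
rewrite !semigroup_cst => /(_ _)/addIr; apply => y.
by have := fM y; rewrite ler_norml => /andP[]; lra.
Qed.

(** The backward equation, one-sided in time: the generator property at time 0 is applied to the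
    bounded function [S t f]. *)
Lemma semigroup_right_expansion f x t e : bounded_function f -> 0 <= t -> 0 < e ->
  exists2 k : R, 0 < k & forall h, 0 < h < k ->
    `|S (t + h) f x - S t f x - h * L (S t f) x| <= e * h.
Proof.
move=> bf t0 e0.
have bt := semigroup_bounded t bf.
have mt : measurable_fun setT (S t f) by move=> _ A _; apply: discX.
have := @process_generator _ _ _ _ _ HP _ x mt bt.
move/cvgrPdist_le => /(_ _ e0); rewrite near_withinE => -[k/= k0 fk].
exists k => // h /andP[h0 hk].
have := fk h; rewrite /= sub0r normrN gtr0_norm// => /(_ hk h0).
rewrite -(ler_pM2r h0) -[X in _ * X <= _ -> _](gtr0_norm h0) -normrM mulrBl distrC.
rewrite mulrAC mulVf ?gt_eqF// mul1r.
by rewrite [t + h]addrC semigroup_comp ?(ltW h0)// [h * _]mulrC.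
Qed.

(* [1 - P_h(x, {x})] bounds the variation of every orbit of the semigroup at once. *)
Lemma semigroup_equicontinuous x e : 0 < e ->
  exists2 k : R, 0 < k & forall s t, 0 <= s -> s <= t < s + k ->
    forall f M, 0 <= M -> (forall y, `|f y| <= M) -> `|S t f x - S s f x| <= e * M.
Proof.
move=> e0.
have b1 : bounded_function (\1_[set x] : X -> R) by exact: bounded_indic.
have [k k0 xk] := semigroup_right_expansion x b1 (lexx 0) (@ltr01 R).
set l := L _ _ in xk.
have l0 : 0 < 2 * (`|l| + 1) by rewrite mulr_gt0// ltr_wpDl.
(* The expansion at time 0 with error [h] bounds [1 - S h \1_[set x] x] by [h * (|l| + 1)]. Away
   from [x] the values of [S s f] differ from that at [x] by at most [2 * M], hence the factor 2. *)
exists (Num.min k (e / (2 * (`|l| + 1)))).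
  by rewrite lt_min k0 divr_gt0.
move=> s t s0 /andP[st tk] f M M0 fM.
have [->|nst] := eqVneq s t; first by rewrite subrr normr0 mulr_ge0// ltW.
have h0 : 0 < t - s by rewrite subr_gt0 lt_neqAle nst.
move: tk; rewrite -ltrBlDl lt_min => /andP[hk hke].
have tE : t = (t - s) + s by rewrite subrK.
rewrite [in S t]tE; move: (t - s) h0 hk hke => h h0 hk hke {tE}.
have bf : bounded_function f by exists M.
have bs := semigroup_bounded s bf.
rewrite semigroup_comp// ?(ltW h0)//.
have := xk h; rewrite h0 hk => /(_ isT).
rewrite add0r !semigroup0 indic_set1 => hS.
have hS' : 1 - S h \1_[set x] x <= h * (`|l| + 1).
  move: hS; rewrite ler_norml => /andP[+ _].
  have : h * - `|l| <= h * l by rewrite ler_pM2l// lerNl ler_normr lexx orbT.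
  by rewrite mulrN; lra.
have fsM y : `|S s f y| <= M by apply: semigroup_norm_le.
have bd : bounded_function (fun y => S s f y - S s f x).
  by apply: boundedB => //; exact: bounded_cst.
have bi : bounded_function (fun y => 1 - \1_[set x] y : R).
  by apply: boundedB => //; exact: bounded_cst.
have b2 : bounded_function (fun y => (2 * M) * (1 - \1_[set x] y) : R).
  by apply: boundedM => //; exact: bounded_cst.
have key y : `|S s f y - S s f x| <= (2 * M) * (1 - \1_[set x] y).
  case: (pselect (y = x)) => [->|yx].
    by rewrite indic_set1 !subrr normr0 mulr0.
  rewrite indic_set1_neq// subr0 mulr1 (le_trans (ler_normB _ _))//.
  by have := fsM x; have := fsM y; lra.
have E2 : 2 * M * (1 - S h \1_[set x] x) = S h (fun y => (2 * M) * (1 - \1_[set x] y)) x.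
  rewrite semigroupZ// semigroupB//; last exact: bounded_cst.
  by rewrite semigroup_cst.
have up : S h (fun y => S s f y - S s f x) x <= 2 * M * (1 - S h \1_[set x] x).
  rewrite E2; apply: semigroup_le => // y.
  by apply: le_trans (key y); exact: ler_norm.
have lo : - (2 * M * (1 - S h \1_[set x] x)) <= S h (fun y => S s f y - S s f x) x.
  rewrite lerNl -mulN1r -semigroupZ// E2; apply: semigroup_le => //.
    by apply: boundedM => //; exact: bounded_cst.
  by move=> y; apply: le_trans (key y); rewrite mulN1r ler_normr lexx orbT.
have sM : 2 * M * (1 - S h \1_[set x] x) <= e * M.
  rewrite mulrAC ler_wpM2r//.
  move: hke; rewrite ltr_pdivlMr// => hke; lra.
rewrite semigroupB// ?semigroup_cst in up lo; try exact: bounded_cst.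
by rewrite ler_norml; apply/andP; split; lra.
Qed.

End Semigroup.

(** * Jump generators and the comparison principle *)
Section JumpGenerator.
Context {X : Type} {R : realType} {J : finType} (r : J -> X -> R) (T : J -> X -> X).
Context (r_ge0 : forall j x, 0 <= r j x).
Implicit Types (f g : X -> R) (a : R) (x : X).

Definition jump_generator f x : R := \sum_j r j x * (f (T j x) - f x).
Local Notation L := jump_generator.

Lemma jump_generatorD f g x : L (fun y => f y + g y) x = L f x + L g x.
Proof. by rewrite /L -big_split/=; apply: eq_bigr => j _; ring. Qed.

Lemma jump_generatorZ a f x : L (fun y => a * f y) x = a * L f x.
Proof. by rewrite /L mulr_sumr; apply: eq_bigr => j _; ring. Qed.

Lemma jump_generator_cst a x : L (fun=> a) x = 0.
Proof. by rewrite /L big1// => j _; rewrite subrr mulr0. Qed.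

(** The last sum is the carre du champ of [f] and [g]. *)
Lemma jump_generatorM f g x : L (fun y => f y * g y) x = f x * L g x + g x * L f x +
  \sum_j r j x * ((f (T j x) - f x) * (g (T j x) - g x)).
Proof. by rewrite /L !mulr_sumr -!big_split/=; apply: eq_bigr => j _; ring. Qed.

Lemma jump_generator_sum (K : finType) (F : K -> X -> R) x :
  L (fun y => \sum_k F k y) x = \sum_k L (F k) x.
Proof.
rewrite /L exchange_big; apply: eq_bigr => j _ /=.
by rewrite -mulr_sumr sumrB.
Qed.

Lemma jump_generator_max_le0 f x : (forall y, f y <= f x) -> L f x <= 0.
Proof.
move=> fx; rewrite /L sumr_le0// => j _.
by rewrite mulr_ge0_le0// subr_le0.
Qed.

End JumpGenerator.

Section Comparison.
Context d (X : measurableType d) (R : realType).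
Context (discX : forall A : set X, measurable A).
Context (J : finType) (r : J -> X -> R) (T : J -> X -> X).
Context (r_ge0 : forall j x, 0 <= r j x).
Local Notation L := (jump_generator r T).
Context (P : R -> R.-pker X ~> X) (HP : markov_process_with_generator P L).
Context (W : X -> R) (C : R) (W_ge0 : forall x, 0 <= W x) (C_ge0 : 0 <= C).
Context (W_finite : forall B, finite_set [set x | W x <= B]) (LW : forall x, L W x <= C).
Implicit Types (f g : X -> R) (s t h e M a : R) (x y : X).
Local Notation S := (semigroup P).

(** The minimum of finitely many radii works because [p x] passes to smaller ones. It is applied to
    time steps, to lower bounds of probabilities and to inverses of indices. *)
Lemma common_radius (p : X -> R -> Prop) (A : set X) : finite_set A ->
  (forall x k k', p x k -> k' <= k -> p x k') ->
  (forall x, A x -> exists2 k : R, 0 < k & p x k) ->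
  exists2 k : R, 0 < k & forall x, A x -> p x k.
Proof.
move=> finA pmon pA.
have /finite_seqP[s As] := finA : finite_set (A : set {classic X}).
have {}pA (x : {classic X}) : x \in s -> exists2 k : R, 0 < k & p x k.
  by move=> xs; apply: pA; rewrite As.
suff [k k0 pk] : exists2 k : R, 0 < k & forall x : {classic X}, x \in s -> p x k.
  by exists k => // x; rewrite As => xs; exact: pk.
elim: s {As} pA => [|y s IH] pA; first by exists 1.
have [k k0 pk] : exists2 k : R, 0 < k & forall x : {classic X}, x \in s -> p x k.
  by apply: IH => x xs; apply: pA; rewrite inE xs orbT.
have [k' k'0 pk'] := pA y (mem_head _ _).
exists (Num.min k k'); first by rewrite lt_min k0.
move=> x; rewrite inE => /orP[/eqP ->|xs].
  by apply: pmon pk' _; rewrite ge_min lexx orbT.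
by apply: pmon (pk _ xs) _; rewrite ge_min lexx.
Qed.

(* The penalty [e * (W + (C + 1) t + 1)] confines a first violation to a finite
   set and makes the supersolution strict there. *)
Lemma comparison f (w w' : R -> X -> R) m : bounded_function f ->
  (forall t x, 0 <= t -> m <= w t x) ->
  (forall t x, is_derive t 1 (w ^~ x) (w' t x)) ->
  (forall t x, 0 <= t -> L (w t) x <= w' t x) ->
  (forall x, f x <= w 0 x) ->
  forall t x, 0 <= t -> S t f x <= w t x.
Proof.
move=> bf wm dw Lw fw t x t0.
have [M M0 fM] := bounded_gt0 bf.
suff main e : 0 < e -> forall t, 0 <= t -> forall x,
    S t f x - w t x - e * (W x + (C + 1) * t + 1) <= 0.
  apply/ler_addgt0Pl => e e0.
  have Z0 : 0 < W x + (C + 1) * t + 1 by rewrite ltr_wpDl// addr_ge0// mulr_ge0// addr_ge0.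
  have := main (e / (W x + (C + 1) * t + 1)) (divr_gt0 e0 Z0) _ t0 x.
  by rewrite divfK ?gt_eqF//; lra.
move=> e0 {t x t0}.
pose v t x := S t f x - w t x - e * (W x + (C + 1) * t + 1).
pose Q t := forall x, v t x <= 0.
apply: (real_induction (Q := Q)) => [x|t t0 Qs x|t t0 Qs].
- rewrite /v (semigroup0 discX HP) mulr0 addr0.
  by have := fw x; have := mulr_ge0 (ltW e0) (addr_ge0 (W_ge0 x) ler01); lra.
- rewrite leNgt; apply/negP => vt0.
  (* Going back to [t - k / 2] costs at most [q] in the orbit and [q] in [w], and it lowers the
     penalty; [v] would still be at least [2 * q] there. *)
  pose q := v t x / 4.
  have q0 : 0 < q by rewrite divr_gt0.
  have Mq0 : 0 < q / M by rewrite divr_gt0.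
  have [k1 k10 h1] := semigroup_equicontinuous discX HP x Mq0.
  have [k2 k20 h2] := is_derive_left_cts (dw t x) q0.
  pose k := Num.min t (Num.min k1 k2).
  have k0 : 0 < k by rewrite !lt_min t0 k10.
  have kt : k <= t by rewrite ge_min lexx.
  have kk1 : k <= k1 by rewrite !ge_min lexx orbT.
  have kk2 : k <= k2 by rewrite !ge_min lexx !orbT.
  have s0 : 0 <= t - k / 2 by lra.
  have st : t - k / 2 < t by lra.
  have := Qs (t - k / 2); rewrite s0 st => /(_ isT x).
  have := h1 _ t s0; rewrite (ltW st) => /(_ _ f M (ltW M0) fM).
  have -> : t < t - k / 2 + k1 by lra.
  rewrite divfK ?gt_eqF// => /(_ isT).
  have := h2 (t - k / 2); rewrite (ltW st) andbT => /(_ _).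
  have -> : t - k2 < t - k / 2 by lra.
  move=> /(_ isT).
  have : 0 <= e * (C + 1) * (k / 2) by rewrite !mulr_ge0 ?(ltW e0)// ?addr_ge0// ltW.
  have : v t x = 4 * q by rewrite /q; lra.
  rewrite /v !ler_norml => vq ek /andP[a1 a2] /andP[a3 a4] a5.
  lra.
- pose F := [set x | W x <= (M - m) / e].
  have vout s x : 0 <= s -> ~ F x -> v s x <= 0.
    move=> s0 /negP; rewrite -ltNge ltr_pdivrMr// => Fx.
    have := wm s x s0; have := semigroup_norm_le discX P s x fM.
    rewrite ler_norml => /andP[_ h1] h2.
    have : 0 <= e * ((C + 1) * s + 1).
      by rewrite mulr_ge0 ?(ltW e0)// addr_ge0// mulr_ge0// addr_ge0.
    rewrite /v; lra.
  have [k k0 Fk] : exists2 k : R, 0 < k & forall x, F x -> forall s, t < s < t + k -> v s x <= 0.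
    apply: (common_radius (p := fun x k => forall s, t < s < t + k -> v s x <= 0) (W_finite _)).
    + move=> x k k' pk kk' s /andP[ts sk]; apply: pk; rewrite ts/=.
      by rewrite (lt_le_trans sk)// lerD2l.
    move=> x _.
    have vt0 : v t x <= 0 by apply: Qs; rewrite t0 lexx.
    pose D := L (S t f) x - w' t x - e * (C + 1).
    have e4 : 0 < e / 4 by rewrite divr_gt0.
    have [k1 k10 h1] := semigroup_right_expansion discX HP x bf t0 e4.
    have [k2 k20 h2] := is_derive_right (dw t x) e4.
    have vexp h : 0 < h -> h < k1 -> h < k2 -> v (t + h) x <= v t x + h * (D + e / 2).
      move=> h0 hk1 hk2; have := h1 h; have := h2 h; rewrite h0 hk1 hk2 => /(_ isT) + /(_ isT).
      rewrite !ler_norml => /andP[a1 a2] /andP[a3 a4]; rewrite /v /D; lra.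
    have [vt_lt0|vt_eq0] : v t x < 0 \/ v t x = 0.
      by move: vt0; rewrite le_eqVlt => /orP[/eqP|]; [right|left].
    + have D0 : 0 < `|D + e / 2| + 1 by rewrite ltr_wpDl.
      exists (Num.min (Num.min k1 k2) (- v t x / (`|D + e / 2| + 1))).
        by rewrite !lt_min k10 k20 divr_gt0// oppr_gt0.
      move=> s /andP[ts]; rewrite -ltrBlDl !lt_min => /andP[/andP[s1 s2]].
      rewrite ltr_pdivlMr// => s3.
      have s0 : 0 < s - t by rewrite subr_gt0.
      have := vexp _ s0 s1 s2; rewrite addrC subrK.
      have : (s - t) * (D + e / 2) <= (s - t) * `|D + e / 2| by rewrite ler_pM2l// ler_norm.
      lra.
    (* At a zero of [v t], [x] is a maximum, so [L (v t) x <= 0]; with [LW] this gives [D <= - e],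
       and the errors of the two expansions consume only [e / 2]. *)
    + exists (Num.min k1 k2); first by rewrite lt_min k10.
      move=> s /andP[ts]; rewrite -ltrBlDl lt_min => /andP[s1 s2].
      have s0 : 0 < s - t by rewrite subr_gt0.
      have := vexp _ s0 s1 s2; rewrite addrC subrK vt_eq0 add0r => /le_trans; apply.
      rewrite pmulr_rle0//.
      have Lv : L (v t) x <= 0.
        by apply: jump_generator_max_le0 => // y; rewrite vt_eq0; apply: Qs; rewrite t0 lexx.
      have Lvw : L (S t f) x = L (v t) x + (L (w t) x + e * L W x).
        rewrite -jump_generatorZ -!jump_generatorD; apply: eq_bigr => j _; rewrite /v.
        by ring.
      have := ler_wpM2l (ltW e0) (LW x); have := Lw t x t0; rewrite /D Lvw; lra.
  exists k => // s /andP[ts sk] x.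
  have [Fx|nFx] := pselect (F x); first by apply: Fk => //; rewrite ts.
  by apply: vout => //; rewrite (le_trans t0)// ltW.
Qed.

End Comparison.

(** * Lyapunov functions and Harris' theorem *)
Section Lyapunov.
Context d (X : measurableType d) (R : realType).
Context (discX : forall A : set X, measurable A).
Context (J : finType) (r : J -> X -> R) (T : J -> X -> X).
Context (r_ge0 : forall j x, 0 <= r j x).
Local Notation L := (jump_generator r T).
Context (P : R -> R.-pker X ~> X) (HP : markov_process_with_generator P L).
Context (W : X -> R) (C c : R) (W_ge0 : forall x, 0 <= W x) (C_ge0 : 0 <= C) (c_gt0 : 0 < c).
Context (W_finite : forall B, finite_set [set x | W x <= B]).
Context (LW : forall x, L W x <= C - c * W x).
Implicit Types (f g : X -> R) (s t h e M a b : R) (x y : X).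
Local Notation S := (semigroup P).

Let LW_le x : L W x <= C.
Proof. by rewrite (le_trans (LW x))// gerBl mulr_ge0// ltW. Qed.

(** The function [E s * (W - K) + K], with [E s] the exponential of [- c * s] and [K = C / c], has
    time derivative [E s * (C - c * W)], which dominates its image under [L]: it is a supersolution,
    nonnegative and equal to [W] at time 0. *)
Lemma semigroup_lyapunov g a b t x : bounded_function g -> 0 <= a ->
  (forall y, g y <= a * W y + b) -> 0 <= t ->
  S t g x <= a * (expR (- (c * t)) * W x + C / c) + b.
Proof.
move=> bg a0 ga t0.
pose K := C / c.
have K0 : 0 <= K by rewrite divr_ge0// ltW.
have cK : c * K = C by rewrite /K mulrCA divff ?mulr1// gt_eqF.
pose E s := expR (- (c * s)).
have E0 s : 0 <= E s by apply: expR_ge0.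
pose w s y := a * (E s * (W y - K) + K) + b.
pose w' s y := a * (- c * E s * (W y - K)).
apply: (@le_trans _ _ (w t x)).
  apply: (comparison discX r_ge0 HP W_ge0 C_ge0 W_finite LW_le (w := w) (w' := w') (m := b)) => //.
  - move=> s y s0; rewrite lerDr mulr_ge0//.
    have E1 : E s <= 1 by rewrite -expR0 ler_expR oppr_le0 mulr_ge0// ltW.
    have := mulr_ge0 (E0 s) (W_ge0 y); have := ler_wpM2r K0 E1; lra.
  - move=> s y; rewrite /w /w' /E.
    apply: is_derive_eq; rewrite /GRing.scale/=; ring.
  - move=> s y s0; rewrite /w.
    rewrite jump_generatorD jump_generator_cst addr0 jump_generatorZ /w'.
    rewrite jump_generatorD jump_generator_cst addr0 jump_generatorZ.
    rewrite jump_generatorD jump_generator_cst addr0.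
    rewrite ler_wpM2l// [leRHS](_ : _ = E s * (C - c * W y)); last by rewrite -cK; ring.
    by rewrite ler_wpM2l.
  - by move=> y; rewrite /w /E mulr0 oppr0 expR0 mul1r subrK.
rewrite lerD2r ler_wpM2l// mulrBr -/(E t).
have := mulr_ge0 (E0 t) K0; rewrite -/K; lra.
Qed.

Lemma semigroup_le_linear f B t x : bounded_function f -> 0 <= B -> 0 <= t ->
  (forall y, L f y <= B) -> S t f x <= f x + B * t.
Proof.
move=> bf B0 t0 LB; have [M M0 fM] := bounded_gt0 bf.
apply: (comparison discX r_ge0 HP W_ge0 C_ge0 W_finite LW_le
  (w := fun t x => f x + B * t) (w' := fun _ _ => B) (m := - M)) => //.
- move=> s y s0; have := mulr_ge0 B0 s0; have := fM y.
  by rewrite ler_norml => /andP[]; lra.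
- move=> s y; apply: is_derive_eq; rewrite /GRing.scale/=; ring.
- by move=> s y s0; rewrite jump_generatorD jump_generator_cst addr0.
- by move=> y; rewrite mulr0 addr0.
Qed.

Lemma semigroup_dist_le f B t x : bounded_function f -> 0 <= B -> 0 <= t ->
  (forall y, `|L f y| <= B) -> `|S t f x - f x| <= B * t.
Proof.
move=> bf B0 t0 LB.
have bN : bounded_function (fun y => -1 * f y).
  by apply: boundedM => //; exact: bounded_cst.
have lo : -1 * S t f x <= -1 * f x + B * t.
  rewrite -semigroupZ//; apply: semigroup_le_linear => // y.
  by rewrite jump_generatorZ mulN1r (le_trans _ (LB y))// ler_normr lexx orbT.
have up : S t f x <= f x + B * t.
  by apply: semigroup_le_linear => // y; rewrite (le_trans (ler_norm _)).
by rewrite ler_norml; apply/andP; split; lra.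
Qed.

Definition exit_rate x : R := \sum_j r j x.

Lemma exit_rate_ge0 x : 0 <= exit_rate x.
Proof. by rewrite sumr_ge0. Qed.

(** The generator of [- \1_[set x]] is at most [exit_rate x] at [x] and at most 0 elsewhere, so the
    chance of being away from [x] at time [t] is at most [exit_rate x * t]. No bound on [L f]
    enters, and the estimate can be integrated over [x]. *)
Lemma semigroup_dist_le_exit_rate f M t x : (forall y, `|f y| <= M) -> 0 <= t ->
  `|S t f x - f x| <= 2 * M * exit_rate x * t.
Proof.
move=> fM t0.
have M0 : 0 <= M by apply: le_trans (fM x).
have bf : bounded_function f by exists M.
have b1 : bounded_function (\1_[set x] : X -> R) by exact: bounded_indic.
have bN : bounded_function (fun y => -1 * \1_[set x] y : R).
  by apply: boundedM => //; exact: bounded_cst.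
have stay : 1 - S t \1_[set x] x <= exit_rate x * t.
  have := @semigroup_le_linear _ (exit_rate x) t x bN (exit_rate_ge0 x) t0.
  rewrite semigroupZ// => h.
  have : -1 * S t \1_[set x] x <= -1 * \1_[set x] x + exit_rate x * t.
    apply: h => y; have [->|yx] := pselect (y = x).
      rewrite /jump_generator; apply: ler_sum => j _.
      rewrite -[leRHS]mulr1; apply: ler_wpM2l; first by [].
      rewrite indic_set1.
      by have /andP[] := indic_ge0_le1 (R := R) [set x] (T j x); lra.
    rewrite (le_trans _ (exit_rate_ge0 x))// sumr_le0// => j _.
    rewrite mulr_ge0_le0// (indic_set1_neq yx).
    by have /andP[] := indic_ge0_le1 (R := R) [set x] (T j y); lra.
  by rewrite indic_set1; lra.
have bd : bounded_function (fun y => f y - f x).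
  by apply: boundedB => //; exact: bounded_cst.
have b2 : bounded_function (fun y => (2 * M) * (1 - \1_[set x] y) : R).
  by apply: boundedM; [exact: bounded_cst|apply: boundedB => //; exact: bounded_cst].
have key y : `|f y - f x| <= (2 * M) * (1 - \1_[set x] y).
  case: (pselect (y = x)) => [->|yx].
    by rewrite indic_set1 !subrr normr0 mulr0.
  rewrite indic_set1_neq// subr0 mulr1 (le_trans (ler_normB _ _))//.
  by have := fM x; have := fM y; lra.
have E2 : S t (fun y => (2 * M) * (1 - \1_[set x] y)) x = 2 * M * (1 - S t \1_[set x] x).
  rewrite semigroupZ//; last by apply: boundedB => //; exact: bounded_cst.
  by rewrite semigroupB// ?semigroup_cst//; exact: bounded_cst.
have lez : 2 * M * (1 - S t \1_[set x] x) <= 2 * M * exit_rate x * t.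
  by rewrite -[leRHS]mulrA ler_wpM2l// mulr_ge0.
have Ed : S t (fun y => f y - f x) x = S t f x - f x.
  by rewrite semigroupB// ?semigroup_cst//; exact: bounded_cst.
rewrite -Ed; apply: (le_trans _ lez); rewrite -E2.
rewrite ler_norml; apply/andP; split.
  rewrite lerNl -mulN1r -semigroupZ//; apply: semigroup_le => //.
    by apply: boundedM => //; exact: bounded_cst.
  by move=> y; apply: le_trans (key y); rewrite mulN1r ler_normr lexx orbT.
by apply: semigroup_le => // y; apply: le_trans (key y); exact: ler_norm.
Qed.

Section Harris.
Context (o : X) (o_gt0 : forall x, 0 < S 1 \1_[set o] x).

(* Far from the sublevel set of [W] the Lyapunov bound contracts the weighted seminorm;
   inside it, all laws [P 1 x] share a multiple of the Dirac mass at [o]. *)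
Lemma harris_contraction : exists rho beta : R, [/\ 0 <= rho < 1, 0 < beta &
  forall f A, bounded_function f -> 0 <= A ->
    (forall x y, f x - f y <= A * (2 + beta * (W x + W y))) ->
    forall x y, S 1 f x - S 1 f y <= rho * A * (2 + beta * (W x + W y))].
Proof.
pose g := expR (- (c * 1)); pose K := C / c + 1.
have K0 : 0 < K by rewrite ltr_wpDl// divr_ge0// ltW.
have g0 : 0 < g by apply: expR_gt0.
have g1 : g < 1 by rewrite expR_lt1 mulr1 oppr_lt0.
have lyap f a b x : bounded_function f -> 0 <= a -> (forall y, f y <= a * W y + b) ->
    S 1 f x <= a * (g * W x + K) + b.
  move=> bf a0 fab; have := semigroup_lyapunov x bf a0 fab ler01.
  rewrite -/g => /le_trans; apply; rewrite lerD2r ler_wpM2l// /K; lra.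
(* [B] is such that [g * s + 2 * K <= g' * s] for [s >= B]: the excess [g' - g] is half of
   [1 - g]. *)
pose g' := (1 + g) / 2; pose B := 4 * K / (1 - g).
have B0 : 0 < B by rewrite divr_gt0 ?subr_gt0// mulr_gt0.
have B1 : (1 - g) * B = 4 * K by rewrite /B mulrCA divff ?mulr1// subr_eq0 gt_eqF.
have [ep ep0 epP] : exists2 ep : R, 0 < ep & forall x, W x <= B -> ep <= S 1 \1_[set o] x.
  apply: (common_radius (p := fun x k => k <= S 1 \1_[set o] x) (W_finite B)).
    by move=> x k k' kx k'k; apply: le_trans kx.
  by move=> x _; exists (S 1 \1_[set o] x).
pose e := Num.min ep 1.
have e0 : 0 < e by rewrite lt_min ep0 ltr01.
have e1 : e <= 1 by rewrite ge_min lexx orbT.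
have eP x : W x <= B -> e <= S 1 \1_[set o] x.
  by move=> /epP; apply: le_trans; rewrite ge_min lexx.
(* With this weight the additive constants of the two Lyapunov bounds cost [2 * beta * K = e], while
   the common mass at [o] will gain [2 * e]. *)
pose beta := e / (2 * K).
have beta0 : 0 < beta by rewrite divr_gt0// mulr_gt0.
have betaK : 2 * (beta * K) = e.
  by rewrite /beta; field; rewrite gt_eqF.
pose rho1 := (2 + beta * g' * B) / (2 + beta * B).
have bB : 0 < beta * B by rewrite mulr_gt0.
have D0 : 0 < 2 + beta * B by rewrite addr_gt0.
have g'1 : g' < 1 by rewrite /g'; lra.
have g'0 : 0 < g' by rewrite /g'; lra.
have rho1_1 : rho1 < 1.
  by rewrite /rho1 ltr_pdivrMr// mul1r ltrD2l mulrAC gtr_pMr.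
(* [rho1] serves when [W x + W y >= B]; otherwise [1 - e / 2] contracts the constant part and [g]
   the part in [W]. *)
pose rho := Num.max rho1 (Num.max (1 - e / 2) g).
have rho1P : rho1 <= rho by rewrite le_max lexx.
have rho2P : 1 - e / 2 <= rho by rewrite !le_max lexx orbT.
have rho3P : g <= rho by rewrite !le_max lexx !orbT.
exists rho, beta; split => //.
  by rewrite (le_trans (ltW g0) rho3P) /rho !gt_max rho1_1 g1 andbT/=; lra.
move=> f A bf A0 fA x y.
(* A bound on differences is a weighted sup bound around a suitable constant [c0]: every lower
   barrier [f z' - A * (1 + beta * W z')] lies below every upper one, and [c0] is the supremum of
   the lower barriers. *)
have [c0 fc0 c0f] : exists2 c0 : R, (forall z, f z <= c0 + A * (1 + beta * W z)) &
    (forall z, c0 - A * (1 + beta * W z) <= f z).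
  pose Z := [set f z - A * (1 + beta * W z) | z in [set: X]].
  have ubZ z : ubound Z (f z + A * (1 + beta * W z)).
    by move=> _ [z' _ <-]; have := fA z' z; lra.
  exists (sup Z) => z.
    rewrite -lerBlDr; apply: ub_le_sup; last by exists z.
    by exists (f x + A * (1 + beta * W x)).
  rewrite lerBlDr; apply: ge_sup => //.
  by exists (f z - A * (1 + beta * W z)), z.
have bNf : bounded_function (fun z => -1 * f z).
  by apply: boundedM => //; exact: bounded_cst.
have Ab0 : 0 <= A * beta by rewrite mulr_ge0// ltW.
have Wxy0 : 0 <= W x + W y by rewrite addr_ge0.
have [Wxy|Wxy] := leP B (W x + W y).
  have up : S 1 f x <= A * beta * (g * W x + K) + (c0 + A).
    by apply: lyap => // z; have := fc0 z; lra.
  have lo : -1 * S 1 f y <= A * beta * (g * W y + K) + (A - c0).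
    by rewrite -semigroupZ//; apply: lyap => // z; have := c0f z; lra.
  apply: (@le_trans _ _ (A * (2 + beta * g' * (W x + W y)))).
    have h : (1 - g) * B <= (1 - g) * (W x + W y) by rewrite ler_pM2l// subr_gt0.
    have := ler_wpM2l Ab0 h; rewrite B1 /g'; lra.
  rewrite (mulrC rho) -[leRHS]mulrA ler_wpM2l//.
  have S0 : 0 <= 2 + beta * (W x + W y) by rewrite addr_ge0// mulr_ge0// ltW.
  apply: (@le_trans _ _ (rho1 * (2 + beta * (W x + W y)))); last by rewrite ler_wpM2r.
  rewrite /rho1 [leRHS]mulrAC ler_pdivlMr//.
  have := mulr_ge0 (ltW beta0) (mulr_ge0 (ltW (_ : 0 < 1 - g')) (_ : 0 <= W x + W y - B)).
  rewrite !subr_gt0 !subr_ge0 => /(_ g'1 Wxy); nra.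
have Wx : W x <= B by have := W_ge0 y; lra.
have Wy : W y <= B by have := W_ge0 x; lra.
(* Raising [f] at [o] up to its upper barrier [c0 + a'], and [- f] up to [a' - c0], leaves the
   Lyapunov bounds valid. The two raises add up to [2 * a' >= 2 * A], and both are weighted by at
   least [e]. *)
pose a' := A * (1 + beta * W o).
have a'A : A <= a' by rewrite /a' ler_peMr// lerDl mulr_ge0// ltW.
have b1 a : bounded_function (fun z => a * \1_[set o] z : R).
  by apply: boundedM; [exact: bounded_cst|exact: bounded_indic].
have up : S 1 f x + (c0 + a' - f o) * S 1 \1_[set o] x <= A * beta * (g * W x + K) + (c0 + A).
  rewrite -semigroupZ//; last exact: bounded_indic.
  rewrite -semigroupD//; apply: lyap => //; first exact: boundedD.
  move=> z; have [->|zo] := pselect (z = o).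
    by rewrite indic_set1 /a'; lra.
  by rewrite indic_set1_neq//; have := fc0 z; lra.
have lo : -1 * S 1 f y + (a' - c0 + f o) * S 1 \1_[set o] y <= A * beta * (g * W y + K) + (A - c0).
  rewrite -!semigroupZ//; last exact: bounded_indic.
  rewrite -semigroupD//; apply: lyap => //; first exact: boundedD.
  move=> z; have [->|zo] := pselect (z = o).
    by rewrite indic_set1 /a'; lra.
  by rewrite indic_set1_neq//; have := c0f z; lra.
have fo1 : 0 <= c0 + a' - f o by have := fc0 o; rewrite /a'; lra.
have fo2 : 0 <= a' - c0 + f o by have := c0f o; rewrite /a'; lra.
have h1 := ler_wpM2l fo1 (eP _ Wx); have h2 := ler_wpM2l fo2 (eP _ Wy).
have h3 := ler_wpM2l (ltW e0) a'A.
apply: (@le_trans _ _ (A * (2 - e + g * (beta * (W x + W y))))).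
  rewrite (_ : A * (2 - e + g * (beta * (W x + W y))) =
    A * beta * (g * W x + K) + (c0 + A) + (A * beta * (g * W y + K) + (A - c0))
    - 2 * e * A); last first.
    by rewrite -betaK; ring.
  lra.
rewrite (mulrC rho) -[leRHS]mulrA ler_wpM2l//.
have := ler_wpM2r (mulr_ge0 (ltW beta0) Wxy0) rho3P; lra.
Qed.

End Harris.

End Lyapunov.

(** * Measures from tight positive functionals *)
Section DiscreteRiesz.
Context d (X : measurableType d) (R : realType).
Context (discX : forall A : set X, measurable A).
Implicit Types (f g : X -> R) (a e M : R).

Lemma finite_support_ind (Q : (X -> R) -> Prop) : Q (fun=> 0) ->
  (forall f a y, Q f -> Q (fun x => f x + a * \1_[set y] x)) ->
  forall f A, finite_set A -> (forall x, ~ A x -> f x = 0) -> Q f.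
Proof.
move=> Q0 Qs f A finA fA.
have /finite_seqP[s As] := finA : finite_set (A : set {classic X}).
have fs (x : {classic X}) : x \notin s -> f x = 0.
  by move=> xs; apply: fA; rewrite As /=; apply/negP.
elim: s f fs {A finA As fA} => [|y s IH] f fs.
  by rewrite (_ : f = fun=> 0) //; apply/funext => x; apply: (fs x).
rewrite (_ : f = fun x => (f x - f y * \1_[set y : X] x) + f y * \1_[set y : X] x); last first.
  by apply/funext => x; rewrite subrK.
apply: Qs; apply: IH => x xs.
have [->|xy] := pselect (x = y); first by rewrite indic_set1 mulr1 subrr.
rewrite indic_set1_neq// mulr0 subr0 fs// inE negb_or xs andbT.
exact/eqP.
Qed.

Lemma probability_of_measure (nu : set X -> \bar R) :
  nu set0 = 0%E -> (forall A, 0 <= nu A)%E -> semi_sigma_additive nu ->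
  nu setT = 1%E -> exists mu : probability X R, forall A, mu A = nu A.
Proof.
move=> nu0 nu_ge0 nuS nuT.
pose M : isMeasure d X R nu := isMeasure.Build d X R nu nu0 nu_ge0 nuS.
pose m : {measure set X -> \bar R} := HB.pack nu M.
pose N := Measure_isProbability.Build d X R m nuT.
pose p : probability X R := HB.pack nu m N.
by exists p.
Qed.

Context (Phi : (X -> R) -> R).
Context (PhiD : forall f g, bounded_function f -> bounded_function g ->
  Phi (fun x => f x + g x) = Phi f + Phi g).
Context (PhiZ : forall a f, bounded_function f -> Phi (fun x => a * f x) = a * Phi f).
Context (Phi_le : forall f g, bounded_function f -> bounded_function g ->
  (forall x, f x <= g x) -> Phi f <= Phi g).
Context (Phi1 : Phi (fun=> 1) = 1).
Context (Phi_tight : forall e, 0 < e ->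
  exists2 A : set X, finite_set A & Phi \1_(~` A) <= e).

Let Phi0 : Phi (fun=> 0) = 0.
Proof.
rewrite -[RHS](mul0r (Phi (fun=> 1))) -PhiZ; last exact: bounded_cst.
by congr (Phi _); apply/funext => x; rewrite mul0r.
Qed.

Let PhiB f g : bounded_function f -> bounded_function g ->
  Phi (fun x => f x - g x) = Phi f - Phi g.
Proof.
move=> bf bg; rewrite -mulN1r -PhiZ// -PhiD//; last first.
  by apply: boundedM => //; exact: bounded_cst.
by congr (Phi _); apply/funext => x; rewrite mulN1r.
Qed.

Let Phi_ge0 f : bounded_function f -> (forall x, 0 <= f x) -> 0 <= Phi f.
Proof. by move=> bf f0; rewrite -Phi0; apply: Phi_le => //; exact: bounded_cst. Qed.

Let bounded_sum_indic (F : (set X)^nat) n :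
  bounded_function (fun x => \sum_(i < n) \1_(F i) x : R).
Proof.
elim: n => [|n IH].
  by exists 0 => x; rewrite big_ord0 normr0.
under [fun x => _]funext do rewrite big_ord_recr/=.
by apply: boundedD => //; exact: bounded_indic.
Qed.

Let Phi_sum (F : (set X)^nat) n :
  Phi (fun x => \sum_(i < n) \1_(F i) x) = \sum_(i < n) Phi \1_(F i).
Proof.
elim: n => [|n IH].
  by rewrite big_ord0 -[RHS]Phi0; congr (Phi _); apply/funext => x; rewrite big_ord0.
under [fun x => _]funext do rewrite big_ord_recr/=.
by rewrite PhiD; [rewrite IH big_ord_recr|exact: bounded_sum_indic|exact: bounded_indic].
Qed.

Let sum_indic_trivIset (F : (set X)^nat) n x : trivIset setT F ->
  (\sum_(i < n) \1_(F i) x : R) = (`[< exists2 i, (i < n)%N & F i x >])%:R.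
Proof.
move=> tF; case: asboolP => [[i0 i0n Fi0]|nF].
  rewrite (bigD1 (Ordinal i0n))//= indicE mem_set//= big1 ?addr0// => j ji.
  rewrite indicE memNset// => Fj; move/eqP: ji; apply; apply/val_inj => /=.
  by apply: (tF _ _ I I); exists x.
rewrite big1// => j _; rewrite indicE memNset// => Fj; apply: nF.
by exists j.
Qed.

(** Up to [e] everything happens on a finite set [A]. Finitely many of the [F i] exhaust the part of
    [A] in the union, and the remainder is dominated by the indicator of the complement of [A]. *)
Let Phi_sigma_additive : semi_sigma_additive (fun A => (Phi \1_A)%:E).
Proof.
move=> F _ tF _.
under eq_fun do rewrite sumEFin.
apply/cvg_EFin; first by near=> n.
apply/cvgrPdist_le => e e0.
have [A finA PhiA] := Phi_tight e0.
have [N NP] : exists N : nat, forall x, A x -> (exists i, F i x) -> exists2 i, (i < N)%N & F i x.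
  (* A threshold index is encoded as a positive radius [k]: every natural number [m >= 1 / k] is
     large enough for [x], a condition that passes to smaller [k]. *)
  have [||k k0 kP] := common_radius (p := fun x (k : R) => forall m : nat,
     k * m%:R >= 1 -> (exists i, F i x) -> exists2 i, (i < m)%N & F i x) finA.
  - move=> x k k' pk k'k m m1; apply: pk; rewrite (le_trans m1)// ler_wpM2r//.
  - move=> x Ax; have [[i Fi]|nF] := pselect (exists i, F i x).
      exists (i.+1%:R^-1); first by rewrite invr_gt0.
      by move=> m; rewrite mulrC ler_pdivlMr// mul1r ler_nat => im _; exists i.
    by exists 1 => // m _ /nF.
  exists (Num.truncn k^-1).+1 => x Ax; apply: kP => //.
  by rewrite mulrC -ler_pdivrMr// div1r ltW// truncnS_gt.
near=> n.
have nN : (N <= n)%N by near: n; exists N.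
rewrite /= big_mkord -Phi_sum -PhiB; [|exact: bounded_indic|exact: bounded_sum_indic].
pose D (x : X) : R := \1_(\bigcup_i F i) x - \sum_(i < n) \1_(F i) x.
have bD : bounded_function D.
  by apply: boundedB; [exact: bounded_indic|exact: bounded_sum_indic].
have [D0 DA] : (forall x, 0 <= D x) /\ (forall x, D x <= \1_(~` A) x).
  apply/all_and2 => x; rewrite /D sum_indic_trivIset//.
  have /andP[A0 A1] := indic_ge0_le1 (R := R) (~` A) x.
  have [[i _ Fi]|nU] := pselect ((\bigcup_i F i) x).
    have -> : \1_(\bigcup_i F i) x = 1 :> R by rewrite indicE mem_set//; exists i.
    case: asboolP => [_|nF]; first by rewrite subrr.
    rewrite subr0 ler01; split => //; rewrite [leRHS]indicE mem_set// => Ax; apply: nF.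
    have [|j jN Fj] := NP x Ax; first by exists i.
    by exists j => //; exact: leq_trans nN.
  have -> : \1_(\bigcup_i F i) x = 0 :> R by rewrite indicE memNset.
  case: asboolP => [[i _ Fi]|_]; first by case: nU; exists i.
  by rewrite subr0.
rewrite -/(D _) ger0_norm; last exact: Phi_ge0.
apply: le_trans PhiA; apply: Phi_le => //; exact: bounded_indic.
Unshelve. all: by end_near. Qed.

(** Integral and functional agree on indicators, hence on finitely supported functions; cutting a
    bounded [f] off outside a large finite set changes both by at most [e / 2]. *)
Lemma discrete_riesz : exists mu : probability X R,
  forall f, bounded_function f -> Rintegral mu setT f = Phi f.
Proof.
have indic0 : \1_set0 = (fun=> 0) :> (X -> R).
  by apply/funext => x; rewrite indicE in_set0.
have indicT : \1_setT = (fun=> 1) :> (X -> R).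
  by apply/funext => x; rewrite indicE in_setT.
have [||||mu muP] := @probability_of_measure (fun A => (Phi \1_A)%:E).
- by rewrite indic0 Phi0.
- move=> A; rewrite lee_fin; apply: Phi_ge0; first exact: bounded_indic.
  by move=> x; case/andP: (indic_ge0_le1 (R := R) A x).
- exact: Phi_sigma_additive.
- by rewrite indicT Phi1.
exists mu => f bf.
have mu1 : mu setT = 1%E := probability_setT mu.
have mu_indic A : Rintegral mu setT \1_A = Phi \1_A.
  by rewrite mean_indic//; exact: (congr1 fine (muP A)).
have fs g A : finite_set A -> (forall x, ~ A x -> g x = 0) ->
    bounded_function g /\ Rintegral mu setT g = Phi g.
  apply: (finite_support_ind (Q := fun g => bounded_function g /\ Rintegral mu setT g = Phi g)).
    by split; [exact: bounded_cst|rewrite mean_cst// Phi0].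
  move=> {}g a y [bg gE].
  have b1 : bounded_function (fun x => a * \1_[set y] x : R).
    by apply: boundedM; [exact: bounded_cst|exact: bounded_indic].
  split; first exact: boundedD.
  rewrite meanD// PhiD// meanZ; [|by []..|exact: bounded_indic].
  by rewrite PhiZ ?mu_indic ?gE//; exact: bounded_indic.
have [M M0 fM] := bounded_gt0 bf.
apply/eqP; rewrite -subr_eq0 -normr_le0; apply/ler_addgt0Pl => e e0; rewrite addr0.
have e2 : 0 < e / (2 * M) by rewrite divr_gt0// mulr_gt0.
have [A finA PhiA] := Phi_tight e2.
have [bg gE] : bounded_function (fun x => \1_A x * f x) /\
    Rintegral mu setT (fun x => \1_A x * f x) = Phi (fun x => \1_A x * f x).
  by apply: (fs _ A) => // x nA; rewrite indicE memNset// mul0r.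
have b1 : bounded_function (fun x => M * \1_(~` A) x : R).
  by apply: boundedM; [exact: bounded_cst|exact: bounded_indic].
have key x : `|f x - \1_A x * f x| <= M * \1_(~` A) x.
  rewrite !indicE in_setC; case: (x \in A) => /=.
    by rewrite mul1r subrr normr0 mulr0.
  by rewrite mul0r subr0 mulr1.
have PhiM : M * Phi \1_(~` A) <= e / 2.
  rewrite (le_trans (ler_wpM2l (ltW M0) PhiA))//.
  by rewrite (_ : M * _ = e / 2)//; field; rewrite gt_eqF.
have bfg := boundedB bf bg.
have h1 : `|Rintegral mu setT (fun x => f x - \1_A x * f x)| <= e / 2.
  apply: le_trans PhiM; rewrite -mu_indic -(meanZ discX mu1); last exact: bounded_indic.
  rewrite ler_norml; apply/andP; split.
    rewrite lerNl -mulN1r -(meanZ discX mu1)//; apply: mean_le => //.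
      by apply: boundedM => //; exact: bounded_cst.
    by move=> x; apply: le_trans (key x); rewrite mulN1r ler_normr lexx orbT.
  by apply: mean_le => // x; apply: le_trans (key x); exact: ler_norm.
have h2 : `|Phi (fun x => f x - \1_A x * f x)| <= e / 2.
  apply: le_trans PhiM; rewrite -PhiZ; last exact: bounded_indic.
  rewrite ler_norml; apply/andP; split.
    rewrite lerNl -mulN1r -PhiZ//; apply: Phi_le => //.
      by apply: boundedM => //; exact: bounded_cst.
    by move=> x; apply: le_trans (key x); rewrite mulN1r ler_normr lexx orbT.
  by apply: Phi_le => // x; apply: le_trans (key x); exact: ler_norm.
rewrite meanB// gE in h1; rewrite PhiB// in h2.
rewrite (_ : _ - _ = (Rintegral mu setT f - Phi (fun x => \1_A x * f x)) -
  (Phi f - Phi (fun x => \1_A x * f x))); last by ring.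
by rewrite (le_trans (ler_normB _ _))//; lra.
Qed.

End DiscreteRiesz.

(** * Convergence to equilibrium *)

Section Ergodic.
Context d (X : measurableType d) (R : realType).
Context (discX : forall A : set X, measurable A).
Implicit Types (f g : X -> R) (s t h e M a b : R) (x y : X).

Lemma monotone_limit_integrable (m : probability X R) (g : nat -> X -> R) (W : X -> R) (B : R) :
  (forall k x, 0 <= g k x) -> (forall x, {homo g ^~ x : i j / (i <= j)%N >-> i <= j}) ->
  (forall x, \forall k \near \oo, g k x = W x) -> (forall k, bounded_function (g k)) ->
  (forall k, Rintegral m setT (g k) <= B) -> m.-integrable setT (EFin \o W).
Proof.
move=> g0 g_nd gW bg gB.
have m1 : m setT = 1%E := probability_setT m.
have W0 x : 0 <= W x.
  by have [k _ kW] := gW x; rewrite -(kW k (leqnn k)).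
have := @monotone_convergence _ X R m setT measurableT (fun k x => (g k x)%:E).
have -> : (fun x => limn ((fun k => (g k x)%:E))) = EFin \o W.
  apply/funext => x; apply/cvg_lim => //; apply: cvg_near_cst.
  by apply: filterS (gW x) => k ->.
move=> /(_ _ _ _) mono; apply/integrableP; split; first by move=> _ A _; apply: discX.
under eq_integral => x _ do rewrite /= ger0_norm//.
rewrite [X in (X < _)%E]mono.
- apply: (@le_lt_trans _ _ B%:E); last exact: ltry.
  apply: lime_le.
    apply: ereal_nondecreasing_is_cvgn => i j ij; apply: ge0_le_integral => //.
      by move=> x _; rewrite lee_fin.
    by move=> x _; rewrite lee_fin; apply: g_nd.
  near=> k; have := gB k; rewrite -lee_fin /Rintegral fineK//.
  by apply: integrable_fin_num => //; apply: bounded_integrable.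
- by move=> k _ A _; apply: discX.
- by move=> k x _; rewrite lee_fin.
- by move=> x _ i j ij; rewrite lee_fin; apply: g_nd.
Unshelve. all: by end_near. Qed.

Context (J : finType) (r : J -> X -> R) (T : J -> X -> X).
Context (r_ge0 : forall j x, 0 <= r j x).
Local Notation L := (jump_generator r T).
Context (P : R -> R.-pker X ~> X) (HP : markov_process_with_generator P L).
Context (W : X -> R) (C c : R) (W_ge0 : forall x, 0 <= W x) (C_ge0 : 0 <= C) (c_gt0 : 0 < c).
Context (W_finite : forall B, finite_set [set x | W x <= B]).
Context (LW : forall x, L W x <= C - c * W x).
Context (o : X) (o_gt0 : forall x, 0 < semigroup P 1 \1_[set o] x).
Local Notation S := (semigroup P).

(** Integer times iterate [harris_contraction]. Over the remaining time [t - k] the function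
    [S k%:R f] lies below a multiple of [W] plus a constant, so [semigroup_lyapunov] adds only the
    term [C / c]. All [t >= k] are compared with the same value, which is what the Cauchy criterion
    asks for. *)
Lemma semigroup_mixing : exists rho beta : R, [/\ 0 <= rho < 1, 0 < beta &
  forall f M (k : nat) t x y, (forall z, `|f z| <= M) -> k%:R <= t ->
    `|S t f x - S k%:R f y| <= rho ^+ k * M * (2 + beta * (W x + C / c + W y))].
Proof.
have [rho [beta [/andP[rho0 rho1] beta0 contr]]] :=
  harris_contraction discX r_ge0 HP W_ge0 C_ge0 c_gt0 W_finite LW o_gt0.
exists rho, beta; split => //; first by rewrite rho0.
have Cc0 : 0 <= C / c by rewrite divr_ge0// ltW.
have iter f M (k : nat) : (forall z, `|f z| <= M) ->
    forall x y, S k%:R f x - S k%:R f y <= rho ^+ k * M * (2 + beta * (W x + W y)).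
  move=> fM; have bf : bounded_function f by exists M.
  elim: k => [|k IH] x y.
    rewrite !(semigroup0 discX HP) expr0 mul1r.
    have M0 : 0 <= M by apply: le_trans (fM x).
    have := mulr_ge0 M0 (mulr_ge0 (ltW beta0) (addr_ge0 (W_ge0 x) (W_ge0 y))).
    have := fM x; have := fM y; rewrite !ler_norml => /andP[a1 a2] /andP[a3 a4]; lra.
  have M0 : 0 <= M by apply: le_trans (fM x).
  rewrite -nat1r !(semigroup_comp discX HP)// exprS -(mulrA rho).
  apply: contr => //.
    exact: semigroup_bounded.
  by rewrite mulr_ge0// exprn_ge0.
have one_side f M (k : nat) t x y : (forall z, `|f z| <= M) -> k%:R <= t ->
    S t f x - S k%:R f y <= rho ^+ k * M * (2 + beta * (W x + C / c + W y)).
  move=> fM kt; have bf : bounded_function f by exists M.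
  have M0 : 0 <= M by apply: le_trans (fM x).
  have tk0 : 0 <= t - k%:R by rewrite subr_ge0.
  have -> : S t f x = S (t - k%:R) (S k%:R f) x by rewrite -(semigroup_comp discX HP)// subrK.
  set A := rho ^+ k * M.
  have A0 : 0 <= A by rewrite mulr_ge0// exprn_ge0.
  have bS := semigroup_bounded discX P k%:R bf.
  have := semigroup_lyapunov discX r_ge0 HP W_ge0 C_ge0 c_gt0 W_finite LW
    (a := A * beta) (b := S k%:R f y + A * (2 + beta * W y)) x bS _ _ tk0.
  move=> /(_ (mulr_ge0 A0 (ltW beta0))) h.
  have {}h := h _; have E1 : expR (- (c * (t - k%:R))) * W x <= W x.
    by rewrite ler_piMl// expR_le1 oppr_le0 mulr_ge0// ltW.
  have := ler_wpM2l (mulr_ge0 A0 (ltW beta0)) E1.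
  have : S (t - k%:R) (S k%:R f) x <= A * beta * (expR (- (c * (t - k%:R))) * W x + C / c) +
      (S k%:R f y + A * (2 + beta * W y)).
    by apply: h => z; have := iter f M k fM z y; rewrite -/A; lra.
  lra.
move=> f M k t x y fM kt; have bf : bounded_function f by exists M.
rewrite ler_norml one_side// andbT.
have fNM z : `|-1 * f z| <= M by rewrite mulN1r normrN.
have := one_side _ M k t x y fNM kt; rewrite !semigroupZ//; lra.
Qed.

Lemma semigroup_cvg f : bounded_function f ->
  exists l : R, forall x, S t f x @[t --> +oo] --> l.
Proof.
move=> bf; have [M M0 fM] := bounded_gt0 bf.
have [rho [beta [/andP[rho0 rho1] beta0 mix]]] := semigroup_mixing.
have Cc0 : 0 <= C / c by rewrite divr_ge0// ltW.
have small x y e : 0 < e -> exists k : nat, forall k', (k <= k')%N ->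
    rho ^+ k' * M * (2 + beta * (W x + C / c + W y)) < e.
  move=> e0; set D := 2 + _.
  have D0 : 0 < D by rewrite ltr_wpDr// mulr_ge0 ?(ltW beta0)// !addr_ge0.
  have rho_lt1 : `|rho| < 1 by rewrite ger0_norm.
  have MD0 : 0 < e / (M * D) by rewrite divr_gt0// mulr_gt0.
  have /cvgrPdist_lt /(_ _ MD0)[k _ hk] := cvg_expr rho_lt1.
  exists k => k' kk'; have := hk _ kk'.
  rewrite /= sub0r normrN ger0_norm ?exprn_ge0// ltr_pdivlMr ?mulr_gt0//.
  by rewrite mulrA.
have /cauchy_cvg/cvg_ex[l cl] : cauchy (S t f o @[t --> +oo]).
  apply: cauchy_exP => e e0; have [k ke] := small o o e e0.
  exists (S k%:R f o).
  exists k%:R; split; first exact: num_real.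
  move=> t /ltW kt; rewrite /ball/= distrC.
  by apply: le_lt_trans (ke k (leqnn k)); apply: mix.
exists l => x; apply/cvgrPdist_lt => e e0.
have e4 : 0 < e / 4 by rewrite divr_gt0.
have [k1 k1e] := small x o _ e4; have [k2 k2e] := small o o _ e4.
pose k := maxn k1 k2.
move/cvgrPdist_lt : cl => /(_ _ e4) cl; near=> t.
have kt : k%:R <= t by near: t; apply: nbhs_pinfty_ge; exact: num_real.
have h1 : `|l - S t f o| < e / 4 by near: t.
have h2 : `|S t f x - S k%:R f o| < e / 4.
  by apply: le_lt_trans (k1e k (leq_maxl _ _)); apply: mix.
have h3 : `|S t f o - S k%:R f o| < e / 4.
  by apply: le_lt_trans (k2e k (leq_maxr _ _)); apply: mix.
move: h1 h2 h3; rewrite !ltr_norml => /andP[? ?] /andP[? ?] /andP[? ?].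
by apply/andP; split; lra.
Unshelve. all: by end_near. Qed.

(* The limit functional is tight because [S t \1_[set x | B < W x] o] is at most
   [(W o + C / c) / B] at all times. *)
Lemma ergodic_limit : exists mu : probability X R,
  [/\ forall f x, bounded_function f -> S t f x @[t --> +oo] --> Rintegral mu setT f,
     forall f s, bounded_function f -> 0 <= s ->
       Rintegral mu setT (S s f) = Rintegral mu setT f,
     mu.-integrable setT (EFin \o W) & is_unique_stationary P mu].
Proof.
have Cc0 : 0 <= C / c by rewrite divr_ge0// ltW.
pose Phi f : R := lim (S t f o @[t --> +oo]).
have PhiP f x : bounded_function f -> S t f x @[t --> +oo] --> Phi f.
  by move=> /semigroup_cvg[l cl]; rewrite (_ : Phi f = l)//; apply/cvg_lim.
have PhiE f l : S t f o @[t --> +oo] --> l -> Phi f = l by move=> /cvg_lim; exact.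
have Phi_le_cst f b : bounded_function f ->
    (forall t, 0 <= t -> S t f o <= b) -> Phi f <= b.
  move=> bf fb; apply: (cvgr_to_le (PhiP f o bf)); near=> t; apply: fb.
  by near: t; apply: nbhs_pinfty_ge; exact: num_real.
have lyap f a b t : bounded_function f -> 0 <= a -> (forall y, f y <= a * W y + b) ->
    0 <= t -> S t f o <= a * (W o + C / c) + b.
  move=> bf a0 fab t0.
  have := semigroup_lyapunov discX r_ge0 HP W_ge0 C_ge0 c_gt0 W_finite LW o bf a0 fab t0.
  move=> /le_trans; apply; rewrite lerD2r ler_wpM2l// lerD2r ler_piMl//.
  by rewrite expR_le1 oppr_le0 mulr_ge0// ltW.
have [|||||mu muP] := @discrete_riesz _ X R discX Phi.
- by move=> f g bf bg; apply: PhiE; under eq_cvg do rewrite semigroupD//; apply: cvgD; exact: PhiP.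
- by move=> a f bf; apply: PhiE; under eq_cvg do rewrite semigroupZ//; apply: cvgMr; exact: PhiP.
- move=> f g bf bg fg; apply: (ler_cvg_to (PhiP f o bf) (PhiP g o bg)).
  by near=> t; apply: semigroup_le.
- by apply: PhiE; under eq_cvg do rewrite semigroup_cst//; exact: cvg_cst.
- move=> e e0; pose B := (W o + C / c + 1) / e.
  have D0 : 0 < W o + C / c + 1 by rewrite ltr_wpDl// addr_ge0.
  have B0 : 0 < B by rewrite divr_gt0.
  exists [set x | W x <= B]; first exact: W_finite.
  apply: Phi_le_cst; first exact: bounded_indic.
  move=> t t0; have := lyap \1_(~` [set x | W x <= B]) B^-1 0 t (bounded_indic _).
  rewrite addr0 invr_ge0 (ltW B0) => /(_ isT) h; apply: le_trans (h _ t0) _.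
    move=> y; rewrite addr0 indicE; have [yB|yB] := pselect (W y <= B).
      by rewrite memNset ?mulr_ge0 ?invr_ge0 ?(ltW B0)//=; exact.
    rewrite mem_set//= mulrC ler_pdivlMr// mul1r ltW//.
    by rewrite ltNge; apply/negP.
  by rewrite mulrC ler_pdivrMr// /B mulrCA divff ?gt_eqF// mulr1 lerDl.
have mu1 : mu setT = 1%E := probability_setT mu.
exists mu; split.
- by move=> f x bf; rewrite muP//; exact: PhiP.
- move=> f s bf s0; rewrite !muP//; last exact: semigroup_bounded.
  apply: PhiE; apply/cvgrPdist_lt => e e0.
  have /cvgrPdist_lt/(_ _ e0)[K [_ KP]] := PhiP f o bf.
  near=> t; have t0 : 0 <= t by near: t; apply: nbhs_pinfty_ge; exact: num_real.
  rewrite -(semigroup_comp discX HP)//; apply: KP.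
  rewrite ltr_wpDr//; near: t; apply: nbhs_pinfty_gt; exact: num_real.
- have bW k : bounded_function (fun x => Num.min (W x) k%:R).
    exists k%:R => x; rewrite ger0_norm ?ge_min ?lexx ?orbT//.
    by rewrite le_min W_ge0 ler0n.
  apply: (monotone_limit_integrable (g := fun k x => Num.min (W x) k%:R)
    (B := 1 * (W o + C / c) + 0)) => // [k x|x i j ij|x|k].
  + by rewrite le_min W_ge0 ler0n.
  + by apply: le_min2 => //; rewrite ler_nat.
  + by near=> k; apply: min_idPl; near: k; exact: nbhs_infty_ger.
  + rewrite muP//; apply: Phi_le_cst => // t t0; apply: lyap => // y.
    by rewrite mul1r addr0 ge_min lexx.
- move=> f mu' _ bf; rewrite /expectation_at.
  have [M M0 fM] := bounded_gt0 bf.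
  have mu'1 : mu' setT = 1%E := probability_setT mu'.
  apply/cvg_pinftyP => u uoo.
  rewrite -(mean_cst discX mu'1 (Rintegral mu setT f)).
  apply: (mean_dominated_cvg discX (g := fun=> M)).
  + by apply: bounded_integrable => //; exact: bounded_cst.
  + by move=> k x; apply: semigroup_norm_le.
  + move=> x; rewrite muP//; have /cvg_pinftyP := PhiP f x bf; exact.
Unshelve. all: by end_near. Qed.

End Ergodic.

(** * Stationarity and the generator *)
Section Stationarity.
Context d (X : measurableType d) (R : realType).
Context (discX : forall A : set X, measurable A).
Implicit Types (f g : X -> R) (s t h e M a b : R) (x y z : X).
Context (J : finType) (r : J -> X -> R) (T : J -> X -> X).
Context (r_ge0 : forall j x, 0 <= r j x).
Local Notation L := (jump_generator r T).
Context (P : R -> R.-pker X ~> X) (HP : markov_process_with_generator P L).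
Context (W : X -> R) (C c : R) (W_ge0 : forall x, 0 <= W x) (C_ge0 : 0 <= C) (c_gt0 : 0 < c).
Context (W_finite : forall B, finite_set [set x | W x <= B]).
Context (LW : forall x, L W x <= C - c * W x).
Local Notation S := (semigroup P).
Local Notation q := (exit_rate r).

Lemma semigroup_indic_ge0 t x y : 0 <= S t \1_[set y] x.
Proof.
rewrite -(semigroup_cst discX P t 0 x); apply: semigroup_le => //.
- exact: bounded_cst.
- exact: bounded_indic.
Qed.

Lemma semigroup_indic_chain s t x y z : 0 <= s -> 0 <= t ->
  S s \1_[set y] x * S t \1_[set z] y <= S (s + t) \1_[set z] x.
Proof.
move=> s0 t0; have bi A : bounded_function (\1_A : X -> R) := bounded_indic A.
rewrite (semigroup_comp discX HP)// mulrC -semigroupZ//.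
have bS := semigroup_bounded discX P t (bi [set z]).
apply: (semigroup_le discX) => //; first by apply: boundedM => //; exact: bounded_cst.
move=> u; have [->|uy] := pselect (u = y); first by rewrite indic_set1 mulr1.
by rewrite indic_set1_neq// mulr0 semigroup_indic_ge0.
Qed.

(** The exit-rate estimate is conclusive for short times only; a long time is cut into [n] equal
    short ones. *)
Lemma semigroup_stay_gt0 t x : 0 <= t -> 0 < S t \1_[set x] x.
Proof.
move=> t0; have q0 : 0 < 2 * q x + 1.
  by rewrite ltr_wpDl// mulr_ge0// exit_rate_ge0.
have small s : 0 <= s -> s * (2 * q x + 1) < 1 -> 0 < S s \1_[set x] x.
  move=> s0 s1; have := semigroup_dist_le_exit_rate discX r_ge0 HP W_ge0 C_ge0 c_gt0 W_finite LW
    (f := \1_[set x]) (M := 1) x _ s0.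
  have b1 y : `|\1_[set x] y : R| <= 1.
    by have /andP[i0 i1] := indic_ge0_le1 (R := R) [set x] y; rewrite ger0_norm.
  move=> /(_ b1); rewrite indic_set1 ler_norml => /andP[+ _]; lra.
pose n := (Num.truncn (t * (2 * q x + 1))).+1.
have n0 : 0 < n%:R :> R by rewrite ltr0n.
have tn0 : 0 <= t / n%:R by rewrite divr_ge0.
have tn : 0 < S (t / n%:R) \1_[set x] x.
  by apply: small => //; rewrite mulrAC ltr_pdivrMr// mul1r truncnS_gt.
have -> : t = n%:R * (t / n%:R) by rewrite mulrC divfK ?gt_eqF.
elim: n (t / n%:R) tn0 tn {n0} => [|n IH] u u0 pu.
  by rewrite mul0r (semigroup0 discX HP) indic_set1.
rewrite -nat1r mulrDl mul1r; have nu0 : 0 <= n%:R * u by rewrite mulr_ge0.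
apply: lt_le_trans (semigroup_indic_chain x x x u0 nu0).
by rewrite mulr_gt0// IH.
Qed.

(** Positivity is required at all positive times, so that transitivity can halve the time, and time
    1 is available at the end whatever the number of jumps. *)
Definition accessible x y := forall t, 0 < t -> 0 < S t \1_[set y] x.

Lemma accessible_refl x : accessible x x.
Proof. by move=> t t0; apply/semigroup_stay_gt0/ltW. Qed.

Lemma accessible_trans y x z : accessible x y -> accessible y z -> accessible x z.
Proof.
move=> xy yz t t0; have t2 : 0 < t / 2 by rewrite divr_gt0.
rewrite (_ : t = t / 2 + t / 2); last by lra.
apply: lt_le_trans (semigroup_indic_chain x y z (ltW t2) (ltW t2)).
by rewrite mulr_gt0 ?xy ?yz.
Qed.

(** The indicator of the target [y] has at [x] a derivative of at least [r j x] at time 0, so [y] is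
    charged at some time [h < t]; staying there during [t - h] has positive probability. *)
Lemma accessible_jump j x : 0 < r j x -> accessible x (T j x).
Proof.
move=> rj t t0; set y := T j x.
have [<-|xy] := pselect (x = y); first exact: accessible_refl.
have bi : bounded_function (\1_[set y] : X -> R) by exact: bounded_indic.
have e0 : 0 < r j x / 2 by rewrite divr_gt0.
have [k k0 kP] := semigroup_right_expansion discX HP x bi (lexx 0) e0.
pose h := Num.min k t / 2.
have m0 : 0 < Num.min k t by rewrite lt_min k0.
have h0 : 0 < h by rewrite divr_gt0.
have mk : Num.min k t <= k by rewrite ge_min lexx.
have mt : Num.min k t <= t by rewrite ge_min lexx orbT.
have hk : h < k by rewrite /h; lra.
have ht : 0 <= t - h by rewrite /h; lra.
have := kP h; rewrite h0 hk => /(_ isT).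
have -> : S 0 \1_[set y] = \1_[set y] by apply/funext => z; rewrite (semigroup0 discX HP).
rewrite add0r indic_set1_neq// subr0 => hS.
have Ly : r j x <= L \1_[set y] x.
  rewrite /jump_generator (bigD1 j)//= -/y indic_set1 indic_set1_neq// subr0 mulr1.
  by rewrite lerDl sumr_ge0// => i _; rewrite subr0 mulr_ge0.
have Sh : 0 < S h \1_[set y] x.
  move: hS; rewrite ler_norml => /andP[+ _].
  have := ler_wpM2l (ltW h0) Ly; have := mulr_gt0 h0 rj; lra.
have -> : t = h + (t - h) by rewrite addrC subrK.
apply: lt_le_trans (semigroup_indic_chain x y y (ltW h0) ht).
by rewrite mulr_gt0// semigroup_stay_gt0.
Qed.

(** Each difference quotient at time 0 has mean 0 by invariance, and [B] dominates them all. *)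
Lemma mean_generator0 (mu : probability X R) f B :
  (forall g s, bounded_function g -> 0 <= s ->
     Rintegral mu setT (S s g) = Rintegral mu setT g) ->
  bounded_function f -> (forall x, `|L f x| <= B) -> Rintegral mu setT (L f) = 0.
Proof.
move=> inv bf LB; have mu1 : mu setT = 1%E := probability_setT mu.
pose u k x : R := (k.+1%:R^-1)^-1 * (S k.+1%:R^-1 f x - f x).
have k0 k : 0 < k.+1%:R^-1 :> R by rewrite invr_gt0.
have u0 k : Rintegral mu setT (u k) = 0.
  have bS := semigroup_bounded discX P k.+1%:R^-1 bf.
  rewrite meanZ//; last exact: boundedB.
  by rewrite meanB// inv ?subrr ?mulr0// ltW.
have mf : measurable_fun setT f by move=> _ A _; apply: discX.
have cv : Rintegral mu setT (u k) @[k --> \oo] --> Rintegral mu setT (L f).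
  apply: (mean_dominated_cvg discX (g := fun=> B)).
  - by apply: bounded_integrable => //; exact: bounded_cst.
  - move=> k x; rewrite normrM gtr0_norm ?invr_gt0//.
    rewrite mulrC ler_pdivrMr//.
    apply: (semigroup_dist_le discX r_ge0 HP W_ge0 C_ge0 c_gt0 W_finite LW) => //.
      by apply: le_trans (LB x).
  - move=> x; have /cvg_at_rightP := @process_generator _ _ _ _ _ HP f x mf bf; apply.
    by split => //; exact: cvg_harmonic.
by rewrite -(cvg_lim (@Rhausdorff R) cv) (_ : (fun k => _) = fun=> 0) ?lim_cst//; apply/funext.
Qed.

(** Integrability of the exit rate makes the mean of [S t f] Lipschitz in [t] and dominates its
    difference quotients. The right derivative at [s] is then the mean of [L (S s f)], that is 0,
    and real induction gives constancy. *)
Lemma invariant_of_generator (m : probability X R) f t :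
  m.-integrable setT (EFin \o q) ->
  (forall g, bounded_function g -> Rintegral m setT (L g) = 0) ->
  bounded_function f -> 0 <= t -> Rintegral m setT (S t f) = Rintegral m setT f.
Proof.
move=> iq Lm bf t0; have m1 : m setT = 1%E := probability_setT m.
have [M M0 fM] := bounded_gt0 bf.
pose F t := Rintegral m setT (S t f).
have bS t' := semigroup_bounded discX P t' bf.
have SM t' x : `|S t' f x| <= M by apply: semigroup_norm_le.
pose K := Rintegral m setT (fun x => 2 * M * q x).
have iK : m.-integrable setT (EFin \o (fun x => 2 * M * q x)).
  exact: integrable_scale.
have K0 : 0 <= K.
  by apply: Rintegral_ge0 => x _; rewrite mulr_ge0 ?mulr_ge0 ?(ltW M0)// exit_rate_ge0.
have Sdist s h x : 0 <= s -> 0 <= h -> `|S (s + h) f x - S s f x| <= h * (2 * M * q x).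
  move=> s0 h0; rewrite (addrC s) (semigroup_comp discX HP)// [leRHS]mulrC.
  exact: (semigroup_dist_le_exit_rate discX r_ge0 HP W_ge0 C_ge0 c_gt0 W_finite LW).
have Flip s h : 0 <= s -> 0 <= h -> `|F (s + h) - F s| <= h * K.
  move=> s0 h0; rewrite /F -meanB// -RintegralZl//.
  apply: le_trans (le_normr_Rintegral _ _) _ => //.
    by apply: bounded_integrable => //; exact: boundedB.
  apply: le_Rintegral => //.
  - apply: bounded_integrable => //; have [N N0 NP] := bounded_gt0 (boundedB (bS (s + h)) (bS s)).
    by exists N => x; rewrite normr_id.
  - exact: integrable_scale.
  - by move=> x _; apply: Sdist.
have Fder s : 0 <= s -> h^-1 * (F (s + h) - F s) @[h --> 0^'+] --> 0.
  move=> s0; apply/cvg_at_rightP => u [u0 uc].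
  rewrite -(Lm _ (bS s)).
  have -> : (fun k => (u k)^-1 * (F (s + u k) - F s)) =
      (fun k => Rintegral m setT (fun x => (u k)^-1 * (S (s + u k) f x - S s f x))).
    by apply/funext => k; rewrite meanZ ?meanB//; exact: boundedB.
  apply: (mean_dominated_cvg discX iK) => [k x|x].
    rewrite normrM gtr0_norm ?invr_gt0// mulrC ler_pdivrMr// [leRHS]mulrC.
    by apply: Sdist => //; exact: ltW.
  have ms : measurable_fun setT (S s f) by move=> _ A _; apply: discX.
  have /cvg_at_rightP := @process_generator _ _ _ _ _ HP _ x ms (bS s).
  move=> /(_ u (conj u0 uc)).
  rewrite (_ : (fun k => _) = fun k => (u k)^-1 * (S (s + u k) f x - S s f x))//.
  by apply/funext => k; rewrite (addrC s) (semigroup_comp discX HP)// ltW.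
have F0 : F 0 = Rintegral m setT f.
  by congr (Rintegral _ _ _); apply/funext => x; rewrite (semigroup0 discX HP).
rewrite -F0; apply/eqP; rewrite -subr_eq0 -normr_le0; apply/ler_addgt0Pl => e e0; rewrite addr0.
suff main : forall s, 0 <= s -> `|F s - F 0| <= e / (t + 1) * s.
  apply: le_trans (main t t0) _; rewrite mulrAC ler_pdivrMr ?ltr_wpDl//.
  by rewrite ler_wpM2l ?lerDl// ltW.
have e'0 : 0 < e / (t + 1) by rewrite divr_gt0// ltr_wpDl.
move: (e / (t + 1)) e'0 => {e0}e e0.
apply: real_induction => [|s s0 IH|s s0 IH].
- by rewrite subrr normr0 mulr0.
- apply/ler_addgt0Pl => e' e'0.
  pose h := Num.min s (e' / (K + 1)).
  have K1 : 0 < K + 1 by rewrite ltr_wpDl.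
  have h0 : 0 < h by rewrite lt_min s0 divr_gt0.
  have hs : h <= s by rewrite ge_min lexx.
  have hK : h * (K + 1) <= e' by rewrite -ler_pdivlMr// ge_min lexx orbT.
  have sh : 0 <= s - h by rewrite subr_ge0.
  have IHs := IH (s - h); rewrite sh ltrBlDr ltrDl h0 in IHs.
  have Fs := Flip _ _ sh (ltW h0); rewrite subrK in Fs.
  apply: le_trans (ler_distD (F (s - h)) _ _) _.
  apply: lerD; last by apply: le_trans (IHs isT) _; rewrite ler_pM2l// gerBl ltW.
  by apply: le_trans Fs _; apply: le_trans hK; rewrite ler_pM2l// lerDl.
- have := Fder s s0; move/cvgrPdist_le => /(_ _ e0); rewrite near_withinE => -[k/= k0 fk].
  exists k => // u /andP[su uk].
  have := fk (u - s); rewrite /= sub0r normrN gtr0_norm ?subr_gt0//.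
  rewrite ltrBlDl => /(_ uk su); rewrite sub0r normrN (addrC s) subrK.
  rewrite normrM gtr0_norm ?invr_gt0 ?subr_gt0// mulrC ler_pdivrMr ?subr_gt0//.
  have IHs := IH s; rewrite s0 lexx in IHs.
  move=> Fu; apply: le_trans (ler_distD (F s) _ _) _.
  rewrite (_ : e * u = e * (u - s) + e * s); last by rewrite -mulrDr subrK.
  by apply: lerD => //; exact: IHs.
Qed.

(** Started from [m] the expectations are constant in time, while by unique stationarity they tend
    to those of [mu]. *)
Lemma unique_stationary_invariant (mu m : probability X R) f :
  is_unique_stationary P mu ->
  (forall t, 0 <= t -> Rintegral m setT (S t f) = Rintegral m setT f) ->
  bounded_function f -> Rintegral mu setT f = Rintegral m setT f.
Proof.
move=> ust inv bf.
have mf : measurable_fun setT f by move=> _ A _; apply: discX.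
have h := ust f m mf bf; apply: (cvg_unique (@Rhausdorff R) h).
apply: cvg_near_cst; near=> t; apply: inv.
by near: t; apply: nbhs_pinfty_ge; exact: num_real.
Unshelve. all: by end_near. Qed.

End Stationarity.

(** * Product laws on configurations *)
Section ProductLaw.
Context (R : realType) (n : nat) (sigma : int) (alpha : 'I_n.+1 -> nat).
Local Notation X := (config sigma alpha).
Context (adm : forall eta, admissible sigma alpha eta).
Context (m : 'I_n.+1 -> probability nat R).

Definition set_site (x : 'I_n.+1) (p : X * nat) : X :=
  Config (adm [ffun z => if z == x then p.2 else p.1 z]).

(** The domain carries the product sigma-algebra; a preimage is a countable union of rectangles, one
    for each value of the new occupation number. *)
Lemma measurable_set_site x : measurable_fun setT (set_site x).
Proof.
move=> _ A _; rewrite setTI.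
rewrite (_ : _ @^-1` A = \bigcup_k ([set eta : X | A (set_site x (eta, k))] `*` [set k])).
  by apply: bigcup_measurable => k _; apply: measurableX.
apply/seteqP; split => -[eta k] /=; first by move=> Ak; exists k.
by move=> [j _ [/= Aj ->]].
Qed.

(** The sites of [s] are drawn one at a time: the new law is the image under [set_site x] of the
    product of the old one with [m x]. As [s] has no repetition, a site already drawn is never
    overwritten. *)
Lemma product_law_seq (s : seq 'I_n.+1) : uniq s -> exists pi : probability X R,
  forall A : 'I_n.+1 -> set nat,
    pi [set eta : X | forall x, x \in s -> A x (eta x)] = (\prod_(x <- s) m x (A x))%E.
Proof.
elim: s => [_|x s IH /= /andP[xs us]].
  exists \d_(point : X) => A; rewrite big_nil.
  rewrite -[RHS](diracT R (point : X)); congr (dirac _ _).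
  by apply/seteqP; split.
have [pi piP] := IH us.
pose nu : set X -> \bar R := pushforward (pi \x m x)%E (set_site x).
have nuT : nu setT = 1%E.
  rewrite /nu /pushforward preimage_setT -setXTT product_measure1E//.
  by rewrite -[RHS]mule1; congr (_ * _)%E; exact: probability_setT.
have mg := measurable_set_site x.
have [||||mu muE] := @probability_of_measure _ X R nu.
- by rewrite /nu /pushforward preimage_set0 measure0.
- by move=> A; rewrite /nu /pushforward.
- exact: (@measure_semi_sigma_additive _ _ _
    [the measure _ _ of pushforward (pi \x m x)%E (set_site x : _ -> X)]).
- exact: nuT.
exists mu => A; rewrite muE big_cons /nu /pushforward.
transitivity ((pi \x m x)%E ([set eta : X | forall y, y \in s -> A y (eta y)] `*` A x)); last first.
  by rewrite product_measure1E// muleC; congr (_ * _)%E; exact: piP.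
congr (product_measure1 _ _ _).
apply/seteqP; split => -[eta k] /= h.
  split; last by have := h x (mem_head _ _); rewrite /= ffunE eqxx.
  move=> y ys; have := h y; rewrite inE ys orbT => /(_ isT).
  by rewrite /= ffunE; case: eqP => // yx; move: xs; rewrite -yx ys.
move=> y; rewrite inE ffunE; case: eqP => [-> _|_ /= ys]; first by case: h.
by case: h => + _; exact.
Qed.

Lemma product_law : exists pi : probability X R, is_product_of pi m.
Proof.
have [pi piP] := product_law_seq (enum_uniq 'I_n.+1).
exists pi => A; have := piP A; rewrite big_enum/= => <-; congr (pi _).
by apply/seteqP; split => eta /= h x //; apply: h; rewrite mem_enum.
Qed.

End ProductLaw.

(** * The boundary driven process *)
Section BoundaryDriven.
Context (R : realType) (n : nat) (sigma : int) (alpha : 'I_n.+1 -> nat)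
  (omega : 'I_n.+1 -> 'I_n.+1 -> R) (omegaL omegaR alphaL alphaR thetaL thetaR : R).
Context (sigmaE : [\/ sigma = -1, sigma = 0 | sigma = 1])
  (alpha_gt0 : forall x, (0 < alpha x)%N)
  (omega_ge0 : forall x y, 0 <= omega x y)
  (omega_sym : forall x y, omega x y = omega y x)
  (omega_diag : forall x, omega x x = 0)
  (omega_conn : connected_graph omega)
  (omegaL_ge0 : 0 <= omegaL) (omegaR_ge0 : 0 <= omegaR)
  (alphaL_gt0 : 0 < alphaL) (alphaR_gt0 : 0 < alphaR)
  (omegaLR_gt0 : 0 < Num.max omegaL omegaR)
  (thetaL_in : in_Theta sigma thetaL) (thetaR_in : in_Theta sigma thetaR).

Local Notation I := 'I_n.+1.
Local Notation X := (config sigma alpha).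
Local Notation sg := (sigma%:~R : R).
Local Notation al x := ((alpha x)%:R : R).
Implicit Types (f g : X -> R) (eta : X) (x y z u v : I) (b : bool).

(* The reservoirs are indexed by [bool], [true] standing for the left one. *)
Definition res_site b : I := if b then ord0 else ord_max.
Definition res_rate b : R := if b then omegaL * alphaL else omegaR * alphaR.
Definition res_theta b : R := if b then thetaL else thetaR.

Local Notation bs := res_site.
Local Notation bk := res_rate.
Local Notation bt := res_theta.

Definition particles eta x : R := (eta x)%:R.
Local Notation N := particles.

Definition hop_rate x y eta : R := omega x y * (N eta x * (al y + sg * N eta y)).
Definition out_rate b eta : R := bk b * (1 + sg * bt b) * N eta (bs b).
Definition in_rate b eta : R := bk b * bt b * (al (bs b) + sg * N eta (bs b)).

(** Ordered pairs, so that each bond splits into its two hops; pairs that are not bonds have rate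
    0. *)
Definition move := ((I * I) + (bool * bool))%type.
Definition move_rate (j : move) eta : R := match j with
  | inl (x, y) => hop_rate x y eta
  | inr (b, true) => out_rate b eta
  | inr (b, false) => in_rate b eta end.
Definition move_target (j : move) eta : X := match j with
  | inl (x, y) => hop x y eta
  | inr (b, true) => remove_particle (bs b) eta
  | inr (b, false) => add_particle (bs b) eta end.

Local Notation L := (jump_generator move_rate move_target).

Lemma sum_moves (F : move -> R) : \sum_j F j =
  \sum_x \sum_y F (inl (x, y)) + \sum_b (F (inr (b, true)) + F (inr (b, false))).
Proof.
rewrite big_sumType/=; congr (_ + _); first by rewrite pair_bigA/=; apply: eq_bigr => -[].
transitivity (\sum_b \sum_c F (inr (b, c))); last by apply: eq_bigr => b _; rewrite big_bool.
by rewrite pair_bigA/=; apply: eq_bigr => -[].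
Qed.

Lemma generatorE : generator omega omegaL omegaR alphaL alphaR thetaL thetaR = L
  :> ((X -> R) -> X -> R).
Proof.
apply/funext => f; apply/funext => eta.
rewrite /generator /jump_generator sum_moves -addrA; congr (_ + _); last first.
  rewrite big_bool/= /reservoir_generator /out_rate /in_rate /= /N; congr (_ + _); ring.
pose G x y := hop_rate x y eta * (f (hop x y eta) - f eta).
have G0 x y : omega x y = 0 -> G x y = 0 by rewrite /G /hop_rate => ->; rewrite !mul0r.
transitivity (\sum_(x : I) \sum_(y : I | (x < y)%N) (G x y + G y x)).
  apply: eq_bigr => x _; rewrite [RHS](bigID (adj omega x))/= [X in _ = _ + X]big1 ?addr0.
    apply: eq_bigr => y _; rewrite /bond_generator /G /hop_rate (omega_sym y x) /N; ring.
  move=> y /andP[_]; rewrite /adj negbK => /eqP xy.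
  by rewrite !G0 ?addr0// omega_sym.
under eq_bigr do rewrite big_split/=.
rewrite big_split/= [X in _ + X](exchange_big_dep predT)//= -big_split/=.
apply: eq_bigr => x _; rewrite [RHS](bigD1 x)//= -/(G x x) G0// add0r.
rewrite [RHS](bigID (fun y => (x < y)%N))/=; congr (_ + _); apply: eq_bigl => y.
  by rewrite andbC; case: (ltnP x y) => //= xy; rewrite -val_eqE/= gtn_eqF.
by rewrite -leqNgt ltn_neqAle -val_eqE.
Qed.

Lemma theta_in b : in_Theta sigma (bt b).
Proof. by case: b. Qed.

Lemma bk_ge0 b : 0 <= bk b.
Proof. by case: b; rewrite mulr_ge0// ltW. Qed.

Lemma N_ge0 eta x : 0 <= N eta x.
Proof. exact: ler0n. Qed.

Lemma sigma_cases : [\/ sigma = -1 /\ sg = -1, sg = 0 | sg = 1].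
Proof.
case: sigmaE => s1; [constructor 1|constructor 2|constructor 3].
- by split => //; rewrite s1 mulrN1z.
- by rewrite s1 mulr0z.
- by rewrite s1 mulr1z.
Qed.

Lemma exclusion eta x : sigma = -1 -> (eta x <= alpha x)%N.
Proof.
by move=> s1; have /implyP/(_ (introT eqP s1))/forallP := occupationP eta.
Qed.

Lemma vacancy_ge0 eta x : 0 <= al x + sg * N eta x.
Proof.
case: sigma_cases => [[s1 ->]|->|->].
- by rewrite mulN1r subr_ge0 ler_nat exclusion.
- by rewrite mul0r addr0.
- by rewrite mul1r addr_ge0// ler0n.
Qed.

Lemma out_factor_ge0 b : 0 <= 1 + sg * bt b.
Proof.
have [t0 t1] := theta_in b.
case: sigma_cases => [[s1 ->]|->|->].
- by rewrite mulN1r subr_ge0 t1.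
- by rewrite mul0r addr0.
- by rewrite mul1r addr_ge0.
Qed.

Lemma move_rate_ge0 j eta : 0 <= move_rate j eta.
Proof.
have tb b : 0 <= bt b by case: (theta_in b).
case: j => [[x y]|[b []]]/=; rewrite !mulr_ge0 ?bk_ge0 ?N_ge0 ?vacancy_ge0 ?tb//.
exact: out_factor_ge0.
Qed.

Lemma admissible_val (eta : {ffun I -> nat}) (e0 : X) :
  (sigma = -1 -> forall x, (eta x <= alpha x)%N) ->
  insubd e0 eta = eta :> {ffun I -> nat}.
Proof.
move=> ad; have A : admissible sigma alpha eta.
  by apply/implyP => /eqP s1; apply/forallP => x; exact: ad.
exact: (insubdK e0 A).
Qed.

Lemma hopP x y eta : x != y -> (0 < eta x)%N -> (sigma = -1 -> (eta y < alpha y)%N) ->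
  forall z, N (hop x y eta) z = N eta z - (z == x)%:R + (z == y)%:R.
Proof.
move=> xy x0 ya z; rewrite /N /hop admissible_val ?ffunE.
  rewrite natrD natrB//; case: eqP => // ->; exact: x0.
move=> s1 u; rewrite ffunE; have := exclusion eta u s1.
by case: (eqVneq u y) => [->|_]; have := ya s1; case: (eqVneq u x); lia.
Qed.

Lemma removeP x eta : (0 < eta x)%N ->
  forall z, N (remove_particle x eta) z = N eta z - (z == x)%:R.
Proof.
move=> x0 z; rewrite /N /remove_particle admissible_val ?ffunE.
  rewrite natrB//; case: eqP => // ->; exact: x0.
by move=> s1 u; rewrite ffunE; have := exclusion eta u s1; lia.
Qed.

Lemma addP x eta : (sigma = -1 -> (eta x < alpha x)%N) ->
  forall z, N (add_particle x eta) z = N eta z + (z == x)%:R.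
Proof.
move=> xa z; rewrite /N /add_particle admissible_val ?ffunE ?natrD//.
move=> s1 u; rewrite ffunE; have := exclusion eta u s1.
by case: (eqVneq u x) => [->|_]; have := xa s1; lia.
Qed.

Lemma vacancy_gt0 eta x : al x + sg * N eta x != 0 -> (sigma = -1 -> (eta x < alpha x)%N).
Proof.
move=> + s1; have -> : sg = -1 by rewrite s1 mulrN1z.
by rewrite mulN1r subr_eq0 eqr_nat ltn_neqAle exclusion// andbT eq_sym.
Qed.

Definition increment (j : move) z : R := match j with
  | inl (x, y) => (z == y)%:R - (z == x)%:R
  | inr (b, true) => - (z == bs b)%:R
  | inr (b, false) => (z == bs b)%:R end.

(** Truncated subtraction and the default value of [insubd] can matter only when the rate vanishes,
    hence the alternative. *)
Lemma move_incrementP j eta : move_rate j eta = 0 \/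
  forall z, N (move_target j eta) z = N eta z + increment j z.
Proof.
have [->|r0] := eqVneq (move_rate j eta) 0; [by left|right].
case: j r0 => [[x y]|[b []]]/=.
- rewrite !mulf_eq0 !negb_or => /and3P[xy x0 ya] z.
  have {}xy : x != y by apply: contraNneq xy => ->; rewrite omega_diag.
  rewrite hopP//; [by ring|by rewrite lt0n -(eqr_nat R)|exact: vacancy_gt0].
- rewrite mulf_eq0 negb_or => /andP[_ x0] z.
  by rewrite removeP// lt0n -(eqr_nat R).
- by rewrite mulf_eq0 negb_or => /andP[_ x0] z; rewrite addP//; exact: vacancy_gt0.
Qed.

Lemma rate_increment j eta (F : (I -> R) -> R) :
  move_rate j eta * F (N (move_target j eta)) =
  move_rate j eta * F (fun z => N eta z + increment j z).
Proof.
have [->|NE] := move_incrementP j eta; first by rewrite !mul0r.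
by congr (_ * F _); apply/funext.
Qed.

Lemma sum_delta (F : I -> R) u : \sum_y (u == y)%:R * F y = F u.
Proof.
rewrite (bigD1 u)//= eqxx mul1r big1 ?addr0// => y yu.
by rewrite eq_sym (negbTE yu) mul0r.
Qed.

Lemma sum_increment (G : I -> I -> R) u :
  \sum_x \sum_y G x y * ((u == y)%:R - (u == x)%:R) = \sum_x G x u - \sum_y G u y.
Proof.
transitivity (\sum_x (G x u - (u == x)%:R * \sum_y G x y)).
  apply: eq_bigr => x _; rewrite mulr_sumr -(sum_delta (G x) u) -sumrB.
  by apply: eq_bigr => y _; ring.
by rewrite sumrB sum_delta.
Qed.

Lemma sum_increment2 (G : I -> I -> R) u v :
  \sum_x \sum_y G x y *
    (((u == y)%:R - (u == x)%:R) * ((v == y)%:R - (v == x)%:R)) =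
  (u == v)%:R * \sum_x (G x u + G u x) - (G u v + G v u).
Proof.
have -> : \sum_x \sum_y G x y *
    (((u == y)%:R - (u == x)%:R) * ((v == y)%:R - (v == x)%:R)) =
  \sum_x \sum_y ((v == y)%:R * G x y) * ((u == y)%:R - (u == x)%:R)
  - \sum_x \sum_y ((v == x)%:R * G x y) * ((u == y)%:R - (u == x)%:R).
  rewrite -sumrB; apply: eq_bigr => x _; rewrite -sumrB; apply: eq_bigr => y _; ring.
rewrite !sum_increment sum_delta -mulr_sumr.
have -> : \sum_x (v == x)%:R * G x u = G v u by rewrite sum_delta.
by rewrite -mulr_sumr big_split/= (eq_sym v u); ring.
Qed.

(** The total rate of the hops across the bond, both directions together; here the terms in [sg] add
    up. *)
Definition interaction u v eta : R :=
  omega u v * (al v * N eta u + al u * N eta v + 2 * sg * N eta u * N eta v).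
(** The carre du champ of [N ^~ u] and [N ^~ v]. *)
Definition gamma u v eta : R := (u == v)%:R * \sum_x interaction x u eta - interaction u v eta
  + \sum_b (u == bs b)%:R * (v == bs b)%:R * (out_rate b eta + in_rate b eta).

Lemma interactionE u v eta : hop_rate u v eta + hop_rate v u eta = interaction u v eta.
Proof. by rewrite /hop_rate /interaction (omega_sym v u); ring. Qed.

Lemma gammaE u v eta :
  \sum_j move_rate j eta * (increment j u * increment j v) = gamma u v eta.
Proof.
rewrite sum_moves/= sum_increment2 /gamma interactionE; congr (_ * _ - _ + _).
  by apply: eq_bigr => x _; rewrite interactionE.
by apply: eq_bigr => b _; ring.
Qed.

Definition drift u eta : R :=
  \sum_x omega x u * (al u * N eta x - al x * N eta u) +
  \sum_b (u == bs b)%:R * (bk b * (bt b * al u - N eta u)).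

(** The terms in [sg] of opposite hops cancel, and so do those of removal and injection. The drift
    is therefore linear for every [sigma], and the equations of first and second moments close. *)
Lemma generator_particles u eta : L (N ^~ u) eta = drift u eta.
Proof.
transitivity (\sum_j move_rate j eta * increment j u).
  apply: eq_bigr => j _; rewrite (rate_increment j eta (fun e => e u - N eta u)).
  by rewrite addrAC subrr add0r.
rewrite sum_moves/= sum_increment /drift; congr (_ + _).
  by rewrite -sumrB; apply: eq_bigr => x _; rewrite /hop_rate (omega_sym u x); ring.
apply: eq_bigr => b _; rewrite /out_rate /in_rate.
by have [->|_] := eqVneq u (bs b); rewrite /= ?mulr0n ?mulr1n; ring.
Qed.

Lemma generator_particles2 u v eta : L (fun e => N e u * N e v) eta =
  N eta u * drift v eta + N eta v * drift u eta + gamma u v eta.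
Proof.
rewrite jump_generatorM !generator_particles -gammaE; congr (_ + _).
apply: eq_bigr => j _.
rewrite (rate_increment j eta (fun e => (e u - N eta u) * (e v - N eta v))).
by congr (_ * (_ * _)); rewrite addrAC subrr add0r.
Qed.

(** * The one-particle walk and a Lyapunov function *)

Definition killing x : R := \sum_b (x == bs b)%:R * bk b.
(** The generator of the one-particle walk, which jumps from [x] to [y] at rate [omega x y * al y]
    and is killed when it enters a reservoir. *)
Definition laplacian (h : I -> R) x : R :=
  \sum_y omega x y * al y * (h y - h x) - killing x * h x.

Lemma killing_ge0 x : 0 <= killing x.
Proof. by rewrite sumr_ge0// => b _; rewrite mulr_ge0 ?ler0n ?bk_ge0. Qed.

Lemma bk_gt0 : exists b, 0 < bk b.
Proof.
move: omegaLR_gt0; rewrite lt_max => /orP[l0|l0].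
  by exists true; rewrite /res_rate mulr_gt0.
by exists false; rewrite /res_rate mulr_gt0.
Qed.

Lemma killing_gt0 b : 0 < bk b -> 0 < killing (bs b).
Proof.
move=> b0; rewrite /killing (bigD1 b)//= eqxx mul1r ltr_wpDr//.
by rewrite sumr_ge0// => c _; rewrite mulr_ge0 ?ler0n ?bk_ge0.
Qed.

Lemma adj_closed_all (a : pred I) x : a x ->
  (forall y z, adj omega y z -> a y -> a z) -> forall y, a y.
Proof.
move=> ax acl y; have /connectP[p pxp ->] := omega_conn x y.
by elim: p x ax pxp => //= z p IH x ax /andP[xz zp]; apply: IH zp; exact: acl xz ax.
Qed.

(** At a negative minimum all terms of [laplacian] are nonnegative, hence zero. The minimum then
    spreads along the edges to the whole graph and reaches a site with positive killing, where the
    killing term would not vanish. *)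
Lemma minimum_principle h : (forall x, laplacian h x <= 0) -> forall x, 0 <= h x.
Proof.
move=> Lh x; rewrite leNgt; apply/negP => hx0.
have [m hm] : exists m, forall y, h m <= h y.
  exists [arg min_(i < x) h i]%O => y.
  by case: arg_minP => // i _; apply.
have hm0 : h m < 0 by rewrite (le_lt_trans (hm x)).
have tight y : h y = h m -> killing y = 0 /\ forall z, omega y z * al z * (h z - h y) = 0.
  move=> hy; have := Lh y; rewrite /laplacian => le0.
  have p1 z : 0 <= omega y z * al z * (h z - h y).
    by rewrite !mulr_ge0 ?ler0n// subr_ge0 hy.
  have p2 : 0 <= - (killing y * h y).
    by rewrite -mulrN mulr_ge0 ?killing_ge0// oppr_ge0 hy ltW.
  have p3 : 0 <= \sum_z omega y z * al z * (h z - h y) by rewrite sumr_ge0.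
  have k0 : killing y * h y = 0 by lra.
  split.
    by move/eqP: k0; rewrite mulf_eq0 hy (lt_eqF hm0) orbF => /eqP.
  have : \sum_z omega y z * al z * (h z - h y) = 0 by lra.
  by move/eqP; rewrite psumr_eq0// => /allP s0 z; apply/eqP/s0; rewrite mem_index_enum.
have all_m : forall y, h y == h m.
  apply: (adj_closed_all (a := fun y => h y == h m) (x := m)) => // y z yz /eqP hy.
  have [_ /(_ z)/eqP] := tight y hy.
  rewrite !mulf_eq0 (negbTE yz) pnatr_eq0 eqn0Ngt alpha_gt0/= subr_eq0 hy => /eqP ->.
  exact: eqxx.
have [b b0] := bk_gt0; have := killing_gt0 b0.
by have [-> _] := tight _ (eqP (all_m (bs b))); rewrite ltxx.
Qed.

Lemma laplacian_unique h : (forall x, laplacian h x = 0) -> forall x, h x = 0.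
Proof.
move=> h0 x; apply/eqP; rewrite eq_le; apply/andP; split; last first.
  by apply: minimum_principle => y; rewrite h0.
rewrite -oppr_ge0; apply: (minimum_principle (h := fun y => - h y)) => y.
have -> : laplacian (fun y => - h y) y = - laplacian h y.
  rewrite /laplacian [RHS]opprD -sumrN mulrN; congr (_ - _).
  by apply: eq_bigr => z _; ring.
by rewrite h0 oppr0.
Qed.

(** Uniqueness makes the square matrix of [laplacian] injective, hence invertible; the transposes
    below pass from its left kernel to its right kernel. *)
Lemma exit_time_exists : exists2 h, (forall x, 0 <= h x) & forall x, laplacian h x = -1.
Proof.
pose M : 'M[R]_n.+1 := \matrix_(x, y)
  (omega x y * al y - (x == y)%:R * (\sum_z omega x z * al z + killing x)).
have ME (v : 'cV[R]_n.+1) x : (M *m v) x ord0 = laplacian (fun y => v y ord0) x.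
  rewrite mxE /laplacian.
  transitivity (\sum_y (omega x y * al y * v y ord0) -
     \sum_y (x == y)%:R * ((\sum_z omega x z * al z + killing x) * v y ord0)).
    by rewrite -sumrB; apply: eq_bigr => y _; rewrite mxE; ring.
  rewrite sum_delta mulrDl mulr_suml opprD addrA; congr (_ - _).
  by rewrite -sumrB; apply: eq_bigr => y _; ring.
have Minj (v : 'cV[R]_n.+1) : M *m v = 0 -> v = 0.
  move=> Mv; apply/colP => x; rewrite mxE.
  by apply: (laplacian_unique (h := fun y => v y ord0)) => y; rewrite -ME Mv mxE.
have Munit : M \in unitmx.
  rewrite -unitmx_tr -row_free_unit -kermx_eq0; apply/eqP/row_matrixP => i.
  rewrite row0; apply: trmx_inj; rewrite trmx0; apply: Minj.
  by apply: trmx_inj; rewrite trmx_mul trmxK trmx0 -row_mul mulmx_ker row0.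
pose v := invmx M *m (const_mx (-1) : 'cV_n.+1).
have Lv x : laplacian (fun y => v y ord0) x = -1.
  by rewrite -ME /v mulKVmx// mxE.
by exists (fun y => v y ord0) => //; apply: minimum_principle => x; rewrite Lv lerN10.
Qed.

(** Duality with one particle: by the symmetry of [omega], summation by parts moves the drift onto
    the coefficients [h]; injection leaves a constant source. *)
Lemma generator_linear (h : I -> R) eta :
  L (fun e => \sum_u h u * N e u) eta =
  \sum_u N eta u * laplacian h u + \sum_b bk b * bt b * al (bs b) * h (bs b).
Proof.
rewrite jump_generator_sum.
under eq_bigr do rewrite jump_generatorZ generator_particles /drift mulrDr.
rewrite big_split/=.
have E1 : \sum_u h u * (\sum_x omega x u * (al u * N eta x - al x * N eta u)) =
    \sum_u N eta u * \sum_y omega u y * al y * (h y - h u).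
  transitivity (\sum_u \sum_x omega x u * al u * h u * N eta x -
     \sum_u \sum_x omega x u * al x * h u * N eta u).
    rewrite -sumrB; apply: eq_bigr => u _; rewrite mulr_sumr -sumrB; apply: eq_bigr => x _; ring.
  rewrite [X in X - _]exchange_big/= -sumrB; apply: eq_bigr => u _.
  rewrite mulr_sumr -sumrB; apply: eq_bigr => x _; rewrite (omega_sym u x); ring.
have E2 : \sum_u h u * (\sum_b (u == bs b)%:R * (bk b * (bt b * al u - N eta u))) =
    \sum_b bk b * bt b * al (bs b) * h (bs b) - \sum_u N eta u * (killing u * h u).
  transitivity (\sum_u \sum_b (bs b == u)%:R * (bk b * bt b * al u * h u) -
     \sum_u N eta u * (killing u * h u)).
    rewrite -sumrB; apply: eq_bigr => u _; rewrite /killing mulr_suml !mulr_sumr -sumrB.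
    by apply: eq_bigr => b _; rewrite (eq_sym (bs b)); ring.
  by rewrite exchange_big/=; congr (_ - _); apply: eq_bigr => b _; rewrite sum_delta.
rewrite E1 E2 /laplacian.
under [in RHS]eq_bigr do rewrite mulrBr.
by rewrite sumrB; ring.
Qed.

Lemma generator_linear_sq (h : I -> R) eta (V := fun e => \sum_u h u * N e u) :
  L (fun e => V e * V e) eta = 2 * V eta * L V eta +
  (\sum_x \sum_y hop_rate x y eta * (h y - h x) ^+ 2 +
   \sum_b h (bs b) ^+ 2 * (out_rate b eta + in_rate b eta)).
Proof.
rewrite jump_generatorM -/V; congr (_ + _); first by ring.
have hd u : \sum_z h z * (z == u)%:R = h u.
  by rewrite -[RHS](sum_delta h u); apply: eq_bigr => z _; rewrite mulrC eq_sym.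
transitivity (\sum_j move_rate j eta * (\sum_u h u * increment j u) ^+ 2).
  apply: eq_bigr => j _.
  rewrite (rate_increment j eta (fun e => (\sum_u h u * e u - V eta) * (\sum_u h u * e u - V eta))).
  rewrite -expr2; congr (_ * _ ^+ 2); rewrite /V -sumrB; apply: eq_bigr => u _; ring.
rewrite sum_moves; congr (_ + _).
  apply: eq_bigr => x _; apply: eq_bigr => y _ /=; congr (_ * _ ^+ 2).
  by under eq_bigr do rewrite mulrBr; rewrite sumrB !hd.
apply: eq_bigr => b _ /=; under eq_bigr do rewrite mulrN.
by rewrite sumrN !hd; ring.
Qed.

Definition total eta : R := \sum_x N eta x.

Lemma total_ge0 eta : 0 <= total eta.
Proof. by rewrite sumr_ge0// => x _; exact: N_ge0. Qed.

Lemma N_le_total eta x : N eta x <= total eta.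
Proof. by rewrite /total (bigD1 x)//= lerDl sumr_ge0// => y _; exact: N_ge0. Qed.

Lemma total_sq_finite (B : R) : finite_set [set eta : X | total eta ^+ 2 <= B].
Proof.
(* Each occupation number is at most its square, hence at most [B]; no square root is taken. *)
pose K := Num.truncn `|B|.
apply: (@sub_finite_set _ _ [set (insubd (point : X) [ffun x => g x : nat] : X) |
    g in [set: {ffun I -> 'I_K.+1}]]); last by apply: finite_image; exact: finite_finset.
move=> eta /= etaB.
have etaK x : (eta x < K.+1)%N.
  rewrite ltnS truncn_ge_nat// (le_trans _ (ler_norm _))// (le_trans _ etaB)//.
  have := N_le_total eta x; rewrite /N => xt.
  apply: (@le_trans _ _ ((eta x)%:R ^+ 2)).
    by rewrite -natrX ler_nat; case: (eta x : nat) => // k; rewrite leq_pmulr.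
  by rewrite ler_sqr ?nnegrE ?ler0n ?total_ge0.
exists [ffun x => Ordinal (etaK x)] => //.
apply/val_inj; rewrite /= admissible_val; first by apply/ffunP => x; rewrite !ffunE.
by move=> s1 x; rewrite !ffunE exclusion.
Qed.

(* With [h := 1 + e * h0] the drift of [V] decreases it at rate of order [e], while the
   quadratic part of the hopping noise in [L (V ^ 2)] carries the factor [e ^ 2]. *)
Lemma lyapunov_exists : exists (W : X -> R) (C c : R), [/\ 0 <= C, 0 < c,
  forall eta, total eta ^+ 2 <= W eta & forall eta, L W eta <= C - c * W eta].
Proof.
have [h0 h0_ge0 Lh0] := exit_time_exists.
pose H := \sum_x h0 x; pose O := \sum_x \sum_y omega x y.
pose a := \sum_x al x; pose D := \sum_b bk b * (1 + bt b).
have tb b : 0 <= bt b by case: (theta_in b).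
have H_ge0 : 0 <= H by rewrite sumr_ge0.
have O_ge0 : 0 <= O by rewrite sumr_ge0// => x _; rewrite sumr_ge0.
have a_ge0 : 0 <= a by rewrite sumr_ge0.
have D_ge0 : 0 <= D by rewrite sumr_ge0// => b _; rewrite mulr_ge0 ?bk_ge0// addr_ge0.
have h0H x : h0 x <= H by rewrite /H (bigD1 x)//= lerDl sumr_ge0.
have ala x : al x <= a by rewrite /a (bigD1 x)//= lerDl sumr_ge0.
have HO_ge0 : 0 <= H ^+ 2 * O by rewrite mulr_ge0// exprn_ge0.
(* This makes [e * (H ^+ 2 * O) <= 1]: the quadratic hopping noise uses at most half of the decrease
   [2 * e * total * V] due to the drift. *)
pose e := (1 + H ^+ 2 * O)^-1.
have e0 : 0 < e by rewrite invr_gt0 ltr_wpDr.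
have e1 : e <= 1 by rewrite invf_le1 ?lerDl// ltr_wpDr.
have eHO : e * (H ^+ 2 * O) <= 1.
  by rewrite mulrC ler_pdivrMr ?ltr_wpDr// mul1r lerDr.
pose h x := 1 + e * h0 x; pose V eta := \sum_u h u * N eta u.
have h_ge1 x : 1 <= h x by rewrite lerDl mulr_ge0// ltW.
have hH x : h x <= 1 + H.
  by rewrite lerD2l (le_trans _ (h0H x))// ler_piMl.
have H1 : 0 < 1 + H by rewrite ltr_wpDr.
have Lh x : laplacian h x <= - e.
  have -> : laplacian h x = - killing x - e.
    rewrite -[e in RHS]mulr1 -mulrN -(Lh0 x) /laplacian /h mulrBr mulr_sumr.
    rewrite (eq_bigr (fun y => e * (omega x y * al y * (h0 y - h0 x)))); last by move=> y _; ring.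
    by ring.
  by rewrite gerDr oppr_le0 killing_ge0.
have VS eta : total eta <= V eta.
  by rewrite ler_sum// => x _; rewrite ler_peMl// N_ge0.
have VS' eta : V eta <= (1 + H) * total eta.
  by rewrite mulr_sumr ler_sum// => x _; rewrite ler_wpM2r// N_ge0.
pose C0 := \sum_b bk b * bt b * al (bs b) * h (bs b).
have C0_ge0 : 0 <= C0.
  by rewrite sumr_ge0// => b _; rewrite !mulr_ge0 ?bk_ge0 ?ler0n// (le_trans ler01).
have LV eta : L V eta <= C0 - e * total eta.
  rewrite generator_linear addrC lerD2l -mulNr [leRHS]mulrC mulr_suml ler_sum// => x _.
  by rewrite ler_wpM2l ?N_ge0.
have vac eta x : al x + sg * N eta x <= a + total eta.
  have := ala x; have := N_le_total eta x; have := N_ge0 eta x.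
  by case: sigma_cases => [[_ ->]|->|->]; lra.
have hop_le x y eta : hop_rate x y eta <= omega x y * (total eta * (a + total eta)).
  by rewrite ler_wpM2l// ler_pM// ?N_ge0 ?vacancy_ge0 ?N_le_total.
have Ghop eta : \sum_x \sum_y hop_rate x y eta * (h y - h x) ^+ 2 <=
    e ^+ 2 * (H ^+ 2 * O) * (total eta * (a + total eta)).
  have -> : e ^+ 2 * (H ^+ 2 * O) * (total eta * (a + total eta)) =
      \sum_x \sum_y omega x y * (total eta * (a + total eta)) * (e ^+ 2 * H ^+ 2).
    rewrite /O (mulrA (e ^+ 2)) mulrAC mulrC mulr_suml; apply: eq_bigr => x _.
    by rewrite mulr_suml; apply: eq_bigr => y _; ring.
  apply: ler_sum => x _; apply: ler_sum => y _.
  apply: ler_pM; [by rewrite !mulr_ge0 ?N_ge0 ?vacancy_ge0|exact: sqr_ge0|exact: hop_le|].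
  rewrite -exprMn -[leLHS]real_normK ?num_real// ler_sqr ?nnegrE ?normr_ge0 ?mulr_ge0 ?(ltW e0)//.
  have -> : h y - h x = e * (h0 y - h0 x) by rewrite /h; ring.
  rewrite normrM gtr0_norm// ler_pM2l// ler_norml.
  have := h0_ge0 x; have := h0_ge0 y; have := h0H x; have := h0H y.
  by move=> *; apply/andP; split; lra.
have Gres eta : \sum_b h (bs b) ^+ 2 * (out_rate b eta + in_rate b eta) <=
    (1 + H) ^+ 2 * (D * (2 * total eta + a)).
  rewrite /D mulr_suml mulr_sumr; apply: ler_sum => b _.
  have out0 : 0 <= out_rate b eta := move_rate_ge0 (inr (b, true)) eta.
  have in0 : 0 <= in_rate b eta := move_rate_ge0 (inr (b, false)) eta.
  apply: ler_pM; rewrite ?sqr_ge0 ?addr_ge0//.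
    by rewrite ler_sqr ?nnegrE ?(ltW H1)// (le_trans ler01).
  have NT := N_le_total eta (bs b); have N0 := N_ge0 eta (bs b).
  have t0 := tb b; have S0 := total_ge0 eta.
  have o1 : out_rate b eta <= bk b * (1 + bt b) * total eta.
    rewrite /out_rate ler_pM ?mulr_ge0 ?bk_ge0 ?out_factor_ge0// ler_wpM2l ?bk_ge0//.
    by case: sigma_cases => [[_ ->]|->|->]; lra.
  have i1 : in_rate b eta <= bk b * (1 + bt b) * (a + total eta).
    rewrite /in_rate ler_pM ?mulr_ge0 ?bk_ge0 ?vacancy_ge0// ler_wpM2l ?bk_ge0//.
    by rewrite lerDr.
  by lra.
pose C3 := 2 * C0 + H ^+ 2 * O * a + 2 * ((1 + H) ^+ 2 * D).
pose C2 := (1 + H) ^+ 2 * D * a.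
(* Since [V <= (1 + H) * total], the remaining decrease [e * total * V] is at least [2 * c * V ^ 2].
   One half of it absorbs the linear terms [C3 * V] by completing the square, at the price
   [C3 ^+ 2 / (4 * c)]. *)
pose c := e / (2 * (1 + H)).
have c0 : 0 < c by rewrite divr_gt0// mulr_gt0.
have C2_ge0 : 0 <= C2 by rewrite !mulr_ge0// ?exprn_ge0// ltW.
have cE : 2 * c * (1 + H) = e by rewrite /c; field; rewrite gt_eqF.
exists (fun eta => V eta * V eta), (C2 + C3 ^+ 2 / (4 * c)), c; split => //.
- by rewrite addr_ge0// divr_ge0 ?sqr_ge0// mulr_ge0// ltW.
- move=> eta; rewrite expr2 ler_pM ?total_ge0//.
- move=> eta.
  have -> : L (fun eta => V eta * V eta) eta = 2 * V eta * L V eta +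
    (\sum_x \sum_y hop_rate x y eta * (h y - h x) ^+ 2 +
     \sum_b h (bs b) ^+ 2 * (out_rate b eta + in_rate b eta)).
    exact: generator_linear_sq.
  have S0 := total_ge0 eta; have SV := VS eta; have VS1 := VS' eta.
  have V0 : 0 <= V eta by apply: le_trans SV.
  have b1 := ler_wpM2l V0 (LV eta).
  have b2 := Ghop eta; have b3 := Gres eta.
  have b4 : e ^+ 2 * (H ^+ 2 * O) * (total eta * (a + total eta)) <=
      e * total eta * V eta + H ^+ 2 * O * a * V eta.
    have -> : e ^+ 2 * (H ^+ 2 * O) * (total eta * (a + total eta)) =
      e * (H ^+ 2 * O) * (e * total eta * total eta) +
      e ^+ 2 * (H ^+ 2 * O * a * total eta) by ring.
    apply: lerD.
      apply: (@le_trans _ _ (e * total eta * total eta)).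
        by rewrite ler_piMl// !mulr_ge0// ltW.
      by rewrite ler_wpM2l// mulr_ge0// ltW.
    apply: (@le_trans _ _ (H ^+ 2 * O * a * total eta)).
      by rewrite ler_piMl ?exprn_ile1 ?(ltW e0)// !mulr_ge0// exprn_ge0.
    by rewrite ler_wpM2l// !mulr_ge0// exprn_ge0.
  have b5 : (1 + H) ^+ 2 * (D * (2 * total eta + a)) <= 2 * ((1 + H) ^+ 2 * D) * V eta + C2.
    have := ler_wpM2l (_ : 0 <= (1 + H) ^+ 2 * D) SV.
    rewrite mulr_ge0 ?exprn_ge0 ?(ltW H1)// => /(_ isT); rewrite /C2; lra.
  have b6 : 2 * c * (V eta * V eta) <= e * total eta * V eta.
    rewrite -cE mulrA; apply: ler_wpM2r => //.
    by rewrite -[leRHS]mulrA ler_wpM2l// mulr_ge0// ltW.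
  have b7 : C3 * V eta <= c * (V eta * V eta) + C3 ^+ 2 / (4 * c).
    rewrite -subr_ge0.
    have -> : c * (V eta * V eta) + C3 ^+ 2 / (4 * c) - C3 * V eta =
      c * (V eta - C3 / (2 * c)) ^+ 2 by field; rewrite gt_eqF.
    by rewrite mulr_ge0 ?sqr_ge0// ltW.
  have C3E : C3 * V eta = 2 * C0 * V eta + H ^+ 2 * O * a * V eta + 2 * ((1 + H) ^+ 2 * D) * V eta.
    by rewrite /C3; ring.
  move: b1 b2 b3 b4 b5 b6 b7; rewrite C3E.
  move: (L V eta) (\sum_x _) (\sum_b _) (C3 ^+ 2 / (4 * c)) => l g1 g2 k.
  lra.
Qed.

(** * Reachability of a common configuration *)

Lemma total_move j eta : move_rate j eta != 0 ->
  total (move_target j eta) = total eta + \sum_z increment j z.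
Proof.
have [->|NE _] := move_incrementP j eta; first by rewrite eqxx.
by rewrite /total -big_split/=; apply: eq_bigr => z _.
Qed.

Lemma N_move j eta z : move_rate j eta != 0 ->
  N (move_target j eta) z = N eta z + increment j z.
Proof. by have [->|NE _] := move_incrementP j eta; first by rewrite eqxx. Qed.

Lemma sum_site u : \sum_z (z == u)%:R = 1 :> R.
Proof. by rewrite -[RHS](sum_delta (fun=> 1) u); apply: eq_bigr => z _; rewrite mulr1 eq_sym. Qed.

Lemma total_hop x y eta : hop_rate x y eta != 0 -> total (hop x y eta) = total eta.
Proof.
by move=> /(total_move (j := inl (x, y)))/= ->; rewrite sumrB !sum_site subrr addr0.
Qed.

Lemma config_eq (eta zeta : X) : (forall x, N eta x = N zeta x) -> eta = zeta.
Proof.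
move=> E; apply/val_inj/ffunP => x; apply/eqP.
by have /eqP := E x; rewrite eqr_nat.
Qed.

Section CommonTarget.
Context (acc : X -> X -> Prop) (acc_refl : forall eta, acc eta eta).
Context (acc_trans : forall eta xi zeta, acc eta xi -> acc xi zeta -> acc eta zeta).
Context (acc_move : forall j eta, 0 < move_rate j eta -> acc eta (move_target j eta)).
Context (b : bool) (b_gt0 : 0 < bk b).

(** Along a path to the reservoir a particle hops to the next site if that site is empty, where
    exclusion cannot block it; if it is occupied, the particle found there takes over. The hops keep
    the number of particles until one leaves. *)
Let remove_one x eta : 0 < 1 + sg * bt b -> N eta x != 0 ->
  exists2 eta', acc eta eta' & total eta' = total eta - 1.
Proof.
move=> f0; have /connectP[p pxp pz] := omega_conn x (bs b).
elim: p x eta pxp pz => [|y p IH] x eta /=.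
  move=> _ <- Nx; have r0 : 0 < out_rate b eta.
    by rewrite !mulr_gt0// lt_neqAle eq_sym Nx N_ge0.
  exists (remove_particle (bs b) eta); first exact: (acc_move (j := inr (b, true))).
  rewrite (total_move (j := inr (b, true))) ?gt_eqF//=.
  by rewrite sumrN sum_site.
move=> /andP[xy yp] pz Nx.
have [Ny|Ny] := eqVneq (N eta y) 0; last exact: IH pz Ny.
have r0 : 0 < hop_rate x y eta.
  rewrite /hop_rate Ny mulr0 addr0 !mulr_gt0 ?ltr0n//.
    by rewrite lt_neqAle eq_sym omega_ge0 andbT; exact: xy.
  by rewrite lt0n -(eqr_nat R).
have rN : hop_rate x y eta != 0 by rewrite gt_eqF.
have xNy : y != x by apply: contraNneq Nx => <-; rewrite Ny.
have [|eta' a1 t1] := IH y (hop x y eta) yp pz.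
  by rewrite (N_move (j := inl (x, y)))//= Ny add0r eqxx (negbTE xNy) subr0 oner_eq0.
exists eta'; last by rewrite t1 total_hop.
by apply: acc_trans a1; exact: (acc_move (j := inl (x, y))).
Qed.

(** The mirror image of [remove_one], for holes: a vacancy moves to a full neighbour, or a vacancy
    already there takes over, until the reservoir fills one. *)
Let add_one x eta : sg = -1 -> bt b = 1 -> N eta x != al x ->
  exists2 eta', acc eta eta' & total eta' = total eta + 1.
Proof.
move=> s1 t1; have /connectP[p pxp pz] := omega_conn x (bs b).
have vac z xi : N xi z != al z -> 0 < al z + sg * N xi z.
  move=> Nz; rewrite lt_neqAle vacancy_ge0 andbT eq_sym s1 mulN1r subr_eq0 eq_sym//.
elim: p x eta pxp pz => [|y p IH] x eta /=.
  move=> _ <- Nx; have r0 : 0 < in_rate b eta.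
    by rewrite /in_rate t1 mulr1 mulr_gt0// vac.
  exists (add_particle (bs b) eta); first exact: (acc_move (j := inr (b, false))).
  by rewrite (total_move (j := inr (b, false))) ?gt_eqF//= sum_site.
move=> /andP[xy yp] pz Nx.
have [Ny|Ny] := eqVneq (N eta y) (al y); last exact: IH pz Ny.
have r0 : 0 < hop_rate y x eta.
  rewrite /hop_rate Ny !mulr_gt0 ?ltr0n ?vac//.
  by rewrite omega_sym lt_neqAle eq_sym omega_ge0 andbT; exact: xy.
have rN : hop_rate y x eta != 0 by rewrite gt_eqF.
have xNy : y != x by apply: contraNneq Nx => <-; rewrite Ny.
have [|eta' a1 t2] := IH y (hop y x eta) yp pz.
  rewrite (N_move (j := inl (y, x)))//= Ny eqxx (negbTE xNy) sub0r.
  by rewrite -subr_eq0 addrAC subrr add0r oppr_eq0 oner_eq0.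
exists eta'; last by rewrite t2 total_hop.
by apply: acc_trans a1; exact: (acc_move (j := inl (y, x))).
Qed.

(* The target is the empty configuration, unless the reservoir only injects particles
   ([sigma = -1] and density [1]), when it is the full one. *)
Lemma common_target : exists o, forall eta, acc eta o.
Proof.
have [f0|f0] := ltP 0 (1 + sg * bt b).
  pose o : X := Config (admissible0 sigma alpha); exists o => eta.
  have [k] : exists k : nat, total eta <= k%:R.
    by exists (Num.truncn (total eta)).+1; rewrite ltW// truncnS_gt.
  elim: k eta => [|k IH] eta tk.
    rewrite (_ : eta = o)//; apply: config_eq => x.
    rewrite [RHS](_ : _ = 0); last by rewrite /N /= ffunE.
    by apply/eqP; rewrite eq_le N_ge0 (le_trans (N_le_total eta x))//.
  have [[x Nx]|N0] := pselect (exists x, N eta x != 0).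
    have [eta' a1 t1] := remove_one f0 Nx; apply: acc_trans a1 _.
    by apply: IH; rewrite t1 lerBlDr natr1.
  apply: IH; rewrite /total big1 ?ler0n// => x _; apply/eqP/negP => Nx.
  by apply: N0; exists x; apply/negP.
have [s1 [sN1 b1]] : sigma = -1 /\ sg = -1 /\ bt b = 1.
  have [t0 t1] := theta_in b.
  move: f0; case: sigma_cases => [[s1 ->]|->|->]; [|by lra|by lra].
  by rewrite mulN1r => f0; split => //; split => //; have := t1 s1; lra.
have full : admissible sigma alpha [ffun x => alpha x].
  by apply/implyP => _; apply/forallP => x; rewrite ffunE.
pose o : X := Config full; exists o => eta.
have No x : N o x = al x by rewrite /N /= ffunE.
have Nal xi x : N xi x <= al x by rewrite /N ler_nat exclusion.
have [k] : exists k : nat, total o - total eta <= k%:R.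
  by exists (Num.truncn (total o - total eta)).+1; rewrite ltW// truncnS_gt.
elim: k eta => [|k IH] eta tk.
  rewrite (_ : eta = o)//; apply: config_eq => x; rewrite No.
  apply/eqP; rewrite eq_le Nal/=.
  have : \sum_(y | y != x) N eta y <= \sum_(y | y != x) N o y.
    by apply: ler_sum => y _; rewrite No.
  move: tk; rewrite /total (bigD1 x)//= [X in _ - X](bigD1 x)//= No; lra.
have [[x Nx]|N0] := pselect (exists x, N eta x != al x).
  have [eta' a1 t1] := add_one sN1 b1 Nx; apply: acc_trans a1 _.
  by apply: IH; rewrite t1; move: tk; rewrite -natr1; lra.
apply: IH; rewrite (_ : total eta = total o) ?subrr ?ler0n//.
apply: eq_bigr => x _; rewrite No; apply/eqP/negP => Nx.
by apply: N0; exists x; apply/negP.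
Qed.

End CommonTarget.

(** * Existence of the stationary measure *)

Context (P : R -> R.-pker X ~> X)
  (P_process : markov_process_with_generator P
     (generator omega omegaL omegaR alphaL alphaR thetaL thetaR)).

Lemma config_discrete (A : set X) : measurable A.
Proof. by []. Qed.

Lemma jump_process : markov_process_with_generator P L.
Proof. by rewrite -generatorE. Qed.

Lemma stationary_exists : exists mu : probability X R, [/\ is_unique_stationary P mu,
  forall f s, bounded_function f -> 0 <= s ->
    Rintegral mu setT (semigroup P s f) = Rintegral mu setT f,
  mu.-integrable setT (EFin \o (fun eta => total eta ^+ 2)) &
  forall f B, bounded_function f -> (forall eta, `|L f eta| <= B) ->
    Rintegral mu setT (L f) = 0].
Proof.
have [W [C [c [C0 c0 WS LW]]]] := lyapunov_exists.
have W0 eta : 0 <= W eta by rewrite (le_trans _ (WS eta))// sqr_ge0.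
have Wfin B : finite_set [set eta | W eta <= B].
  by apply: sub_finite_set (total_sq_finite B) => eta /=; apply: le_trans.
have [b b0] := bk_gt0.
have r0 := move_rate_ge0.
have HP := jump_process.
have [tgt acc_tgt] : exists tgt, forall eta, accessible P eta tgt.
  apply: common_target b0.
  - exact: (accessible_refl config_discrete r0 HP W0 C0 c0 Wfin LW).
  - by move=> eta xi zeta; exact: (accessible_trans config_discrete HP).
  - exact: (accessible_jump config_discrete r0 HP W0 C0 c0 Wfin LW).
have [mu [_ inv iW st]] := ergodic_limit config_discrete r0 HP W0 C0 c0 Wfin LW
  (fun eta => acc_tgt eta 1 ltr01).
exists mu; split => //.
  apply: (dominated_integrable_real config_discrete iW) => eta.
  by rewrite ger0_norm ?sqr_ge0.
by move=> f B; exact: (mean_generator0 config_discrete r0 HP W0 C0 c0 Wfin LW inv).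
Qed.

(** * Functions of quadratic growth *)

Section Moments.
Context (mu : probability X R).
Context (mu_sq : mu.-integrable setT (EFin \o (fun eta => total eta ^+ 2))).
Context (mu_gen : forall f B, bounded_function f -> (forall eta, `|L f eta| <= B) ->
  Rintegral mu setT (L f) = 0).
Local Notation E f := (Rintegral mu setT f).

Definition growth (k : nat) f : Prop :=
  exists C : R, forall eta, `|f eta| <= C * (1 + total eta) ^+ k.

Lemma total1_gt0 eta : 0 < 1 + total eta.
Proof. by rewrite ltr_wpDr// total_ge0. Qed.

Lemma growth_ge0 k f : growth k f ->
  exists2 C : R, 0 <= C & forall eta, `|f eta| <= C * (1 + total eta) ^+ k.
Proof.
move=> [C fC]; exists `|C| => // eta; apply: le_trans (fC eta) _.
by rewrite ler_wpM2r ?ler_norm// exprn_ge0// ltW// total1_gt0.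
Qed.

Lemma growthD k f g : growth k f -> growth k g -> growth k (fun eta => f eta + g eta).
Proof.
move=> [C fC] [D gD]; exists (C + D) => eta.
by rewrite mulrDl (le_trans (ler_normD _ _))// lerD.
Qed.

Lemma growthM j k f g : growth j f -> growth k g -> growth (j + k) (fun eta => f eta * g eta).
Proof.
move=> [C fC] [D gD]; exists (C * D) => eta.
by rewrite normrM exprD mulrACA ler_pM.
Qed.

Lemma growth_cst k (a : R) : growth k (fun=> a).
Proof.
exists `|a| => eta; rewrite ler_peMr// exprn_ege1// lerDl; exact: total_ge0.
Qed.

Lemma growthZ k (a : R) f : growth k f -> growth k (fun eta => a * f eta).
Proof. by move=> gf; exact: (growthM (growth_cst 0 a) gf). Qed.

Lemma growthN k f : growth k f -> growth k (fun eta => - f eta).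
Proof. by move=> [C fC]; exists C => eta; rewrite normrN. Qed.

Lemma growth_sum k (K : finType) (F : K -> X -> R) :
  (forall i, growth k (F i)) -> growth k (fun eta => \sum_i F i eta).
Proof.
move=> gF; have /choice[C CP] : forall i, exists C, forall eta,
    `|F i eta| <= C * (1 + total eta) ^+ k.
  by move=> i; have [C CP] := gF i; exists C.
exists (\sum_i C i) => eta; rewrite mulr_suml.
by rewrite (le_trans (ler_norm_sum _ _ _))// ler_sum.
Qed.

Lemma growth_weaken j k f : (j <= k)%N -> growth j f -> growth k f.
Proof.
move=> jk /growth_ge0[C C0 fC]; exists C => eta; apply: le_trans (fC eta) _.
rewrite ler_wpM2l//; apply: ler_weXn2l => //.
by rewrite lerDl total_ge0.
Qed.

Lemma growth_N u : growth 1 (N ^~ u).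
Proof.
exists 1 => eta; rewrite mul1r expr1 ger0_norm ?N_ge0//.
by rewrite (le_trans (N_le_total eta u))// lerDr.
Qed.

Lemma growth_NN u v : growth 2 (fun eta => N eta u * N eta v).
Proof. exact: (growthM (growth_N u) (growth_N v)). Qed.

Lemma growth_integrable f : growth 2 f -> mu.-integrable setT (EFin \o f).
Proof.
move=> /growth_ge0[C C0 fC].
have mu1 : mu setT = 1%E := probability_setT mu.
have i1 : mu.-integrable setT (EFin \o (fun=> 2 * C) : X -> \bar R).
  by apply: bounded_integrable => //; exact: bounded_cst.
have i3 := integrable_add i1 (integrable_scale (2 * C) mu_sq).
apply: (dominated_integrable_real config_discrete i3) => eta.
apply: le_trans (fC eta) _.
have := mulr_ge0 C0 (sqr_ge0 (1 - total eta)).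
by rewrite !expr2; lra.
Qed.

Lemma expectationD f g : growth 2 f -> growth 2 g ->
  E (fun eta => f eta + g eta) = E f + E g.
Proof. by move=> gf gg; apply: RintegralD => //; exact: growth_integrable. Qed.

Lemma expectationZ a f : growth 2 f -> E (fun eta => a * f eta) = a * E f.
Proof. by move=> gf; apply: RintegralZl => //; exact: growth_integrable. Qed.

Lemma expectation_cst (a : R) : E (fun=> a) = a.
Proof. by apply: mean_cst => //; exact: (probability_setT mu). Qed.

Lemma expectation_sum (K : finType) (F : K -> X -> R) : (forall i, growth 2 (F i)) ->
  E (fun eta => \sum_i F i eta) = \sum_i E (F i).
Proof.
by move=> gF; case: (Rintegral_sum config_discrete (m := mu) (fun i => growth_integrable (gF i))).
Qed.

Definition cutoff (k : nat) eta : R := Num.max 0 (1 - total eta / k.+1%:R).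

Lemma cutoff_dist (k : nat) eta zeta :
  `|cutoff k eta - cutoff k zeta| <= `|total eta - total zeta| / k.+1%:R.
Proof.
have k0 : 0 < k.+1%:R :> R by rewrite ltr0n.
rewrite /cutoff.
have -> : `|total eta - total zeta| / k.+1%:R = `|total eta / k.+1%:R - total zeta / k.+1%:R|.
  by rewrite -mulrBl normrM (ger0_norm (x := k.+1%:R^-1))// invr_ge0 ltW.
move: (total eta / _) (total zeta / _) => a c.
have := ler_norm (a - c); have := ler_norm (- (a - c)); rewrite normrN => h1 h2.
rewrite ler_norml; case: (lerP 0 (1 - a)) => ha; case: (lerP 0 (1 - c)) => hc;
  apply/andP; split; lra.
Qed.

Lemma cutoff_ge0_le1 k eta : 0 <= cutoff k eta <= 1.
Proof.
by rewrite /cutoff le_max lexx/= ge_max ler01/= gerBl divr_ge0// total_ge0.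
Qed.

Lemma cutoff_eq0 (k : nat) eta : k.+1%:R <= total eta -> cutoff k eta = 0.
Proof.
by move=> kt; apply/max_idPl; rewrite subr_le0 ler_pdivlMr ?mul1r.
Qed.

Lemma cutoff_cvg eta : cutoff k eta @[k --> \oo] --> (1 : R).
Proof.
apply/cvgrPdist_le => e e0.
have [k0 _ kP] : \forall k \near \oo, total eta <= e * k%:R.
  exists (Num.truncn (total eta / e)).+1 => // k /= tk.
  rewrite mulrC -ler_pdivrMr// ltW// (lt_le_trans (truncnS_gt _))//.
  by rewrite ler_nat.
exists k0 => // k /= kk.
have k1 : 0 < k.+1%:R :> R by rewrite ltr0n.
have q1 : total eta / k.+1%:R <= e.
  rewrite ler_pdivrMr//; apply: le_trans (kP k kk) _.
  by rewrite ler_pM2l// ler_nat.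
have q0 : 0 <= total eta / k.+1%:R by rewrite divr_ge0// total_ge0.
rewrite /cutoff ler_norml; move: (total eta / k.+1%:R) q0 q1 => q q0 q1.
by case: (lerP 0 (1 - q)) => h; apply/andP; split; lra.
Qed.

Lemma total_increment_res b c : `|\sum_z increment (inr (b, c)) z| = 1.
Proof. by case: c => /=; rewrite ?sumrN sum_site ?normrN normr1. Qed.

(* Hops preserve the number of particles and hence the cutoff; at a reservoir the
   cutoff moves by at most [1 / k.+1] while the rate is linear in [total eta]. *)
Lemma generator_cutoff f : growth 2 f -> exists2 C : R, 0 <= C & forall k eta,
  `|L (fun e => cutoff k e * f e) eta - cutoff k eta * L f eta| <=
    C * (1 + total eta) ^+ 2 /\
  (k.+2%:R < total eta -> L (fun e => cutoff k e * f e) eta = 0).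
Proof.
move=> /growth_ge0[C C0 fC].
have rate_growth b c : growth 1 (move_rate (inr (b, c))).
  have gN := growth_N (bs b).
  case: c => /=; first exact: growthZ.
  by apply: growthZ; apply: growthD; [exact: growth_cst|exact: growthZ].
have [D D0 rD] : exists2 D : R, 0 <= D & forall j eta, (exists b c, j = inr (b, c)) ->
    move_rate j eta <= D * (1 + total eta).
  have /choice[D DP] : forall bc : bool * bool, exists D : R, 0 <= D /\
      forall eta, move_rate (inr bc) eta <= D * (1 + total eta).
    move=> [b c]; have /growth_ge0[D D0 DP] := rate_growth b c.
    exists D; split => // eta; have := DP eta; rewrite expr1; apply: le_trans; exact: ler_norm.
  exists (\sum_bc D bc); first by rewrite sumr_ge0// => bc _; case: (DP bc).
  move=> j eta [b [c ->]]; case: (DP (b, c)) => _ /(_ eta) /le_trans; apply.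
  rewrite ler_wpM2r ?(ltW (total1_gt0 _))// (bigD1 (b, c))//= lerDl sumr_ge0// => bc _.
  by case: (DP bc).
(* 12 is 4 times 3: the growth bound at the target is at most 4 times that at [eta], and
   [1 + total eta <= 3 * k.+1] whenever [total eta <= k.+2]. *)
pose M := 12 * (D * C).
have M0 : 0 <= M by rewrite !mulr_ge0.
have term k j eta : `|move_rate j eta * (f (move_target j eta) *
      (cutoff k (move_target j eta) - cutoff k eta))| <= M * (1 + total eta) ^+ 2 /\
    (k.+2%:R < total eta -> move_rate j eta * (f (move_target j eta) *
      (cutoff k (move_target j eta) - cutoff k eta)) = 0).
  have S1 := total1_gt0 eta.
  have rhs0 : 0 <= M * (1 + total eta) ^+ 2 by rewrite mulr_ge0// exprn_ge0// ltW.
  have [r0|r0] := eqVneq (move_rate j eta) 0; first by rewrite r0 !mul0r normr0.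
  case: j r0 => [[x y]|[b c]] r0.
    rewrite /cutoff /= total_hop ?subrr ?mulr0 ?normr0//.
  set zeta := move_target _ eta.
  have tz : `|total zeta - total eta| = 1.
    by rewrite total_move// addrAC subrr add0r total_increment_res.
  have [tz1 tz2] : total eta - 1 <= total zeta /\ total zeta <= total eta + 1.
    by move: tz => /eqP; rewrite eqr_norml ler01 andbT => /orP[]/eqP; split; lra.
  have k0 : 0 < k.+1%:R :> R by rewrite ltr0n.
  have kk : k.+2%:R = k.+1%:R + 1 :> R by rewrite -natr1.
  (* A reservoir move changes [total] by one, so beyond [k.+2] the cutoff vanishes both before and
     after it. *)
  have [kt|kt] := ltP k.+2%:R (total eta).
    by rewrite !cutoff_eq0 ?subrr ?mulr0 ?normr0//; lra.
  split; last by [].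
  have cd : `|cutoff k zeta - cutoff k eta| <= k.+1%:R^-1.
    by apply: le_trans (cutoff_dist _ _ _) _; rewrite tz mul1r.
  have rr := rD (inr (b, c)) eta (ex_intro _ b (ex_intro _ c erefl)).
  have r_ge0 := move_rate_ge0 (inr (b, c)) eta.
  have fz : `|f zeta| <= C * (4 * (1 + total eta) ^+ 2).
    apply: le_trans (fC zeta) _; rewrite ler_wpM2l//.
    have -> : 4 * (1 + total eta) ^+ 2 = (2 * (1 + total eta)) ^+ 2 by ring.
    rewrite ler_sqr ?nnegrE ?(ltW (total1_gt0 _)) ?mulr_ge0 ?(ltW S1)//.
    by have := total_ge0 eta; lra.
  rewrite !normrM (ger0_norm r_ge0).
  apply: (@le_trans _ _ (D * (1 + total eta) * (C * (4 * (1 + total eta) ^+ 2) * k.+1%:R^-1))).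
    by apply: ler_pM => //; rewrite ?mulr_ge0//; apply: ler_pM.
  have -> : M * (1 + total eta) ^+ 2 = (D * C * 4 * (1 + total eta) ^+ 2) * 3 by rewrite /M; ring.
  have -> : D * (1 + total eta) * (C * (4 * (1 + total eta) ^+ 2) * k.+1%:R^-1) =
    (D * C * 4 * (1 + total eta) ^+ 2) * ((1 + total eta) / k.+1%:R) by ring.
  rewrite ler_wpM2l ?mulr_ge0 ?exprn_ge0 ?(ltW S1)// ler_pdivrMr//.
  have : 1 <= k.+1%:R :> R by rewrite ler1n.
  lra.
have LE k eta : L (fun e => cutoff k e * f e) eta = cutoff k eta * L f eta +
    \sum_j move_rate j eta * (f (move_target j eta) *
      (cutoff k (move_target j eta) - cutoff k eta)).
  by rewrite mulr_sumr -big_split/=; apply: eq_bigr => j _; ring.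
exists (\sum_(j : move) M); first by rewrite sumr_ge0.
move=> k eta; rewrite LE; split.
  rewrite addrAC subrr add0r mulr_suml (le_trans (ler_norm_sum _ _ _))// ler_sum// => j _.
  by case: (term k j eta).
move=> kt; have c0 : cutoff k eta * L f eta = 0.
  by rewrite cutoff_eq0 ?mul0r// (le_trans _ (ltW kt))// ler_nat.
by rewrite c0 add0r big1// => j _; case: (term k j eta) => _; apply.
Qed.

(** The cut-off functions and their images under [L] have finite support, so their means under [L]
    are 0; [generator_cutoff] dominates these images by one quadratic function as the cutoff tends
    to 1. *)
Lemma generator_expectation0 f : growth 2 f -> growth 2 (L f) -> E (L f) = 0.
Proof.
move=> gf gL; have [C C0 CP] := generator_cutoff gf.
have [D D0 LD] := growth_ge0 gL.
have tfin (K : R) : finite_set [set eta : X | total eta <= K].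
  apply: sub_finite_set (total_sq_finite (`|K| ^+ 2)) => eta /= etaK.
  by rewrite ler_sqr ?nnegrE ?total_ge0 ?normr_ge0// (le_trans etaK)// ler_norm.
have E0 k : E (L (fun e => cutoff k e * f e)) = 0.
  have b1 : bounded_function (fun e => cutoff k e * f e).
    apply: (finite_support_bounded (tfin k.+1%:R)) => eta /negP; rewrite -ltNge => kt.
    by rewrite cutoff_eq0 ?mul0r// ltW.
  have [B BP] : bounded_function (L (fun e => cutoff k e * f e)).
    apply: (finite_support_bounded (tfin k.+2%:R)) => eta /negP; rewrite -ltNge => kt.
    by have [_ h] := CP k eta; exact: h.
  exact: mu_gen b1 BP.
have gd : growth 2 (fun eta => (C + D) * (1 + total eta) ^+ 2).
  by exists (C + D) => eta; rewrite ger0_norm// mulr_ge0 ?addr_ge0// exprn_ge0// ltW// total1_gt0.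
have cv : E (L (fun e => cutoff k e * f e)) @[k --> \oo] --> E (L f).
  apply: (mean_dominated_cvg config_discrete (growth_integrable gd)) => [k eta|eta].
    have [h _] := CP k eta.
    have /andP[c0 c1] := cutoff_ge0_le1 k eta.
    have h2 : `|cutoff k eta * L f eta| <= D * (1 + total eta) ^+ 2.
      by rewrite normrM (ger0_norm c0) (le_trans _ (LD eta))// ler_piMl.
    rewrite mulrDl; apply: le_trans (lerD h h2).
    by rewrite -[X in `|X| <= _](subrK (cutoff k eta * L f eta)) ler_normD.
  rewrite /jump_generator; apply: cvg_big => [|j _]; first exact: add_continuous.
  apply: cvgMr; rewrite -[X in _ --> X - _]mul1r -[X in _ --> _ - X]mul1r.
  by apply: cvgB; apply: cvgMl; exact: cutoff_cvg.
by rewrite -(cvg_lim (@Rhausdorff R) cv) (_ : (fun k => _) = fun=> 0) ?lim_cst//; apply/funext.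
Qed.

(** * Two-point correlations *)

Lemma growth_N2 u : growth 2 (N ^~ u).
Proof. exact: growth_weaken (growth_N u). Qed.

Ltac growth_tac := intros; repeat first
  [ exact: growth_NN | exact: growth_N2 | exact: growth_cst
  | apply: growthD | apply: growthN | apply: growthZ | apply: growth_sum; intro ].

Local Notation T := (profile mu).

Lemma expectation_N u : E (N ^~ u) = al u * T u.
Proof.
have a0 : al u != 0 by rewrite pnatr_eq0 -lt0n.
rewrite -expectationZ; last first.
  rewrite (_ : (fun eta => _) = fun eta => (al u)^-1 * N eta u); first by growth_tac.
  by apply/funext => eta; rewrite mulrC.
by congr (Rintegral _ _ _); apply/funext => eta; rewrite mulrC divfK.
Qed.

Lemma expectation_drift_term v (g : X -> R) : growth 2 g ->
  (forall x, growth 2 (fun eta => g eta * N eta x)) ->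
  E (fun eta => g eta * drift v eta) =
  \sum_x omega x v *
    (al v * E (fun eta => g eta * N eta x) - al x * E (fun eta => g eta * N eta v)) +
  \sum_b (v == bs b)%:R * (bk b * (bt b * al v * E g - E (fun eta => g eta * N eta v))).
Proof.
move=> gg gN.
rewrite (_ : (fun eta => _) = fun eta =>
  \sum_x ((omega x v * al v) * (g eta * N eta x) + (- (omega x v * al x)) * (g eta * N eta v)) +
  \sum_b (((v == bs b)%:R * bk b * bt b * al v) * g eta +
    (- ((v == bs b)%:R * bk b)) * (g eta * N eta v))).
  rewrite expectationD; first last.
  - by apply: growth_sum => b; apply: growthD; apply: growthZ.
  - by apply: growth_sum => x; apply: growthD; apply: growthZ.
  rewrite !expectation_sum; first last.
  - by move=> x; apply: growthD; apply: growthZ.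
  - by move=> x; apply: growthD; apply: growthZ.
  congr (_ + _); apply: eq_bigr => x _; rewrite expectationD; try exact: growthZ.
    by rewrite !expectationZ//; ring.
  by rewrite !expectationZ//; ring.
apply/funext => eta; rewrite /drift mulrDr !mulr_sumr; congr (_ + _).
  by apply: eq_bigr => x _; ring.
by apply: eq_bigr => b _; ring.
Qed.

Lemma growth_N_drift k v (g : X -> R) : growth k g ->
  growth (k + 1) (fun eta => g eta * drift v eta).
Proof.
move=> gg; apply: growthM => //; apply: growthD; apply: growth_sum => x; apply: growthZ.
  by apply: growthD; [|apply: growthN]; apply: growthZ; exact: growth_N.
apply: growthZ; apply: growthD; first exact: growth_cst.
by apply: growthN; exact: growth_N.
Qed.

Lemma growth_interaction u v : growth 2 (interaction u v).
Proof.
apply: growthZ; apply: growthD.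
  by apply: growthD; apply: growthZ; exact: growth_N2.
rewrite (_ : (fun eta => _) = fun eta => 2 * sg * (N eta u * N eta v)).
  by apply: growthZ; exact: growth_NN.
by apply/funext => eta; ring.
Qed.

Lemma growth_res b : growth 2 (fun eta => out_rate b eta + in_rate b eta).
Proof.
apply: growthD; first by apply: growthZ; exact: growth_N2.
apply: growthZ; apply: growthD; first exact: growth_cst.
by apply: growthZ; exact: growth_N2.
Qed.

(** Stationarity of [N ^~ u], divided by [al u]: the equation of the absorption probabilities of the
    one-particle walk, with boundary values [bt b]. *)
Lemma harmonic u : \sum_x omega u x * al x * (T x - T u) +
  \sum_b (u == bs b)%:R * (bk b * (bt b - T u)) = 0.
Proof.
have a0 : al u != 0 by rewrite pnatr_eq0 -lt0n.
have g1 : growth 2 (fun=> 1) by exact: growth_cst.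
have E1 f : (fun eta => 1 * f eta) = f by apply/funext => eta; rewrite mul1r.
have LN : L (N ^~ u) = drift u by apply/funext => eta; exact: generator_particles.
have gd : growth 2 (L (N ^~ u)).
  by rewrite LN -(E1 (drift u)); apply: growth_weaken (growth_N_drift u (growth_cst 0 1)).
have := generator_expectation0 (growth_N2 u) gd.
rewrite LN -(E1 (drift u)) expectation_drift_term//; last first.
  by move=> x; rewrite E1; exact: growth_N2.
under eq_bigr do rewrite !E1 !expectation_N.
under [X in _ + X]eq_bigr do rewrite !E1 expectation_N expectation_cst.
move=> h; apply: (mulfI a0); rewrite mulr0 -[RHS]h mulrDr !mulr_sumr; congr (_ + _).
  by apply: eq_bigr => x _; rewrite (omega_sym x u); ring.
by apply: eq_bigr => b _; have [->|_] := eqVneq u (bs b); rewrite /= ?mulr0n ?mulr1n; ring.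
Qed.

Definition second u v : R := E (fun eta => N eta u * N eta v).

(** [drift] being linear, [L] maps the product of two occupation numbers to a function of quadratic
    growth, to which stationarity extends. *)
Lemma second_balance u v :
  E (fun eta => N eta u * drift v eta) + E (fun eta => N eta v * drift u eta) +
  E (gamma u v) = 0.
Proof.
have gg : growth 2 (gamma u v).
  apply: growthD; first apply: growthD; [|apply: growthN|].
  - by apply: growthZ; apply: growth_sum => x; exact: growth_interaction.
  - exact: growth_interaction.
  - apply: growth_sum => b.
    by apply: growthZ; exact: growth_res.
have g1 := growth_N_drift v (growth_N u); have g2 := growth_N_drift u (growth_N v).
have LE : L (fun e => N e u * N e v) = fun eta =>
    (N eta u * drift v eta + N eta v * drift u eta) + gamma u v eta.
  by apply/funext => eta; exact: generator_particles2.
rewrite -!expectationD//; last exact: growthD.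
rewrite -LE; apply: generator_expectation0; first exact: growth_NN.
by rewrite LE; apply: growthD => //; exact: growthD.
Qed.

Lemma expectation_interaction u v :
  E (interaction u v) =
  omega u v * (al v * (al u * T u) + al u * (al v * T v) + 2 * sg * second u v).
Proof.
rewrite /interaction (_ : (fun eta => _) = fun eta =>
  omega u v * (al v * N eta u + al u * N eta v + 2 * sg * (N eta u * N eta v))); last first.
  by apply/funext => eta; ring.
rewrite expectationZ; last by growth_tac.
rewrite expectationD; [|by growth_tac..].
rewrite expectationD; [|by growth_tac..].
by rewrite !expectationZ ?expectation_N//; growth_tac.
Qed.

Lemma expectation_gamma u v :
  E (gamma u v) = (u == v)%:R * \sum_x E (interaction x u) - E (interaction u v) +
  \sum_b (u == bs b)%:R * (v == bs b)%:R *
    (bk b * (al u * T u * (1 + 2 * sg * bt b) + bt b * al u)).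
Proof.
have gs : growth 2 (fun eta => \sum_x interaction x u eta).
  by apply: growth_sum => x; exact: growth_interaction.
have gi := growth_interaction u v.
have gr b : growth 2 (fun eta =>
    (u == bs b)%:R * (v == bs b)%:R * (out_rate b eta + in_rate b eta)).
  by apply: growthZ; exact: growth_res.
rewrite /gamma (_ : (fun eta => _) = fun eta =>
  ((u == v)%:R * (\sum_x interaction x u eta) + (-1) * interaction u v eta) +
  \sum_b (u == bs b)%:R * (v == bs b)%:R * (out_rate b eta + in_rate b eta)); last first.
  by apply/funext => eta; rewrite mulN1r.
rewrite expectationD; [|by apply: growthD; apply: growthZ|exact: growth_sum].
rewrite expectationD; [|exact: growthZ..].
rewrite (expectationZ (u == v)%:R)// (expectationZ (-1))// expectation_sum; last first.
  by move=> x; exact: growth_interaction.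
rewrite mulN1r; congr (_ + _); rewrite expectation_sum//; apply: eq_bigr => b _.
rewrite expectationZ; last exact: growth_res.
have [ub|_] := eqVneq u (bs b); last by rewrite !mul0r.
congr (_ * _); rewrite (_ : (fun eta => _) = fun eta =>
  (bk b * (1 + 2 * sg * bt b)) * N eta u + bk b * bt b * al u); last first.
  by apply/funext => eta; rewrite /out_rate /in_rate -ub; ring.
rewrite expectationD; [|by growth_tac..].
by rewrite expectationZ ?expectation_N ?expectation_cst; [ring|growth_tac].
Qed.

Lemma covariance2E x y : covariance2 mu x y = (al x * al y)^-1 * second x y - T x * T y.
Proof.
have a0 z : al z != 0 by rewrite pnatr_eq0 -lt0n.
have -> : covariance2 mu x y = E (fun eta => (al x * al y)^-1 * (N eta x * N eta y) +
   ((- (T y / al x)) * N eta x + ((- (T x / al y)) * N eta y + T x * T y))).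
  congr (Rintegral _ _ _); apply/funext => eta; rewrite /N; field.
  by rewrite !a0.
rewrite !expectationD; [|by growth_tac..].
rewrite !expectationZ; [|by growth_tac..].
rewrite expectation_cst !expectation_N /second; field.
by rewrite !a0.
Qed.

(** * Vanishing covariances force equilibrium *)

Section Uncorrelated.
Context (n_gt0 : (1 < n.+1)%N) (cov0 : forall x y, x <> y -> covariance2 mu x y = 0).

Definition var u : R := second u u - (al u * T u) ^+ 2.

(* With vanishing covariances only the diagonal of the second moments is unknown. *)
Lemma secondE u v : second u v = al u * al v * T u * T v + (u == v)%:R * var u.
Proof.
have a0 z : al z != 0 by rewrite pnatr_eq0 -lt0n.
have [->|uv] := eqVneq u v; first by rewrite mul1r /var; ring.
rewrite mul0r addr0; have := cov0 (elimN eqP uv); rewrite covariance2E => /eqP.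
rewrite subr_eq0 => /eqP h.
have -> : second u v = al u * al v * ((al u * al v)^-1 * second u v).
  by field; rewrite !a0.
by rewrite h; ring.
Qed.

(** The factorised part of the second moments multiplies the harmonic equation at [v] and drops out;
    only the variance of [N ^~ u] is left. *)
Lemma expectation_N_drift u v : E (fun eta => N eta u * drift v eta) =
  omega u v * al v * var u -
  (u == v)%:R * (var u * (\sum_x omega x v * al x + killing v)).
Proof.
rewrite (expectation_drift_term v (growth_N2 u) (growth_NN u)).
have h := harmonic v.
transitivity (al u * T u * al v * (\sum_x omega v x * al x * (T x - T v) +
   \sum_b (v == bs b)%:R * (bk b * (bt b - T v))) +
   (\sum_x (u == x)%:R * (omega x v * al v * var u) -
  (u == v)%:R * (var u * (\sum_x omega x v * al x + killing v)))); last first.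
  by rewrite h mulr0 add0r sum_delta.
rewrite mulrDr !mulr_sumr /killing mulrDr mulrDr !mulr_sumr opprD.
rewrite [RHS](_ : _ = (\sum_x al u * T u * al v * (omega v x * al x * (T x - T v)) +
   (\sum_x (u == x)%:R * (omega x v * al v * var u) -
    \sum_x (u == v)%:R * (var u * (omega x v * al x)))) +
   (\sum_b al u * T u * al v * ((v == bs b)%:R * (bk b * (bt b - T v))) -
    \sum_b (u == v)%:R * (var u * ((v == bs b)%:R * bk b)))); last by ring.
congr (_ + _).
  rewrite -sumrB -big_split/=; apply: eq_bigr => x _.
  rewrite -!/(second _ _) !secondE (omega_sym v x).
  by have [->|_] := eqVneq u v; ring.
rewrite -sumrB; apply: eq_bigr => b _; rewrite expectation_N -!/(second _ _) !secondE.
by ring.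
Qed.

Lemma var_eq u v : u != v -> omega u v * (al v * var u + al u * var v -
  al u * al v * (T u + T v + 2 * sg * T u * T v)) = 0.
Proof.
move=> uv; have := second_balance u v.
rewrite !expectation_N_drift expectation_gamma expectation_interaction secondE.
rewrite (eq_sym v u) (negbTE uv) !mul0r sub0r !subr0 addr0 big1; last first.
  move=> b _; have [ub|_] := eqVneq u (bs b); last by rewrite !mul0r.
  by have [vb|_] := eqVneq v (bs b); [move: uv; rewrite ub vb eqxx|rewrite mulr0 mul0r].
by move=> <-; rewrite (omega_sym v u); ring.
Qed.

Lemma var_diag u : var u = al u * T u * (1 + sg * T u).
Proof.
(* The exit rate of the one-particle walk from [u], positive because a connected graph with at least
   two sites has a bond at [u]. *)
pose c := \sum_x omega x u * al x + killing u.
have c_gt0 : 0 < c.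
  have [w uw] : exists w, u != w.
    have [u0|u0] := eqVneq u ord0; last by exists ord0.
    by exists ord_max; rewrite u0 -val_eqE/=; case: n n_gt0.
  have /connectP[[|y p] /= pxp pw] := omega_conn u w.
    by move: uw; rewrite pw eqxx.
  move: pxp => /andP[uy _]; rewrite ltr_wpDr ?killing_ge0//.
  rewrite (bigD1 y)//= ltr_wpDr//.
    by rewrite sumr_ge0// => x _; rewrite mulr_ge0// ler0n.
  by rewrite mulr_gt0 ?ltr0n// omega_sym lt_neqAle eq_sym omega_ge0 andbT; exact: uy.
have h := harmonic u.
have := second_balance u u.
rewrite !expectation_N_drift expectation_gamma eqxx !mul1r.
rewrite expectation_interaction omega_diag !mul0r subr0 sub0r.
rewrite -/c => bal.
have : c * (var u - al u * T u * (1 + sg * T u)) = 0; last first.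
  by move/eqP; rewrite mulf_eq0 (gt_eqF c_gt0)/= subr_eq0 => /eqP.
(* The mean noise at [u] is a multiple of the harmonic equation plus [2 * c] times the claimed
   variance, while the two drift terms contribute [- 2 * c * var u]. *)
have E1 : \sum_x E (interaction x u) + \sum_b (u == bs b)%:R * (u == bs b)%:R *
     (bk b * (al u * T u * (1 + 2 * sg * bt b) + bt b * al u)) =
    al u * (1 + 2 * sg * T u) * (\sum_x omega u x * al x * (T x - T u) +
     \sum_b (u == bs b)%:R * (bk b * (bt b - T u))) + c * (2 * (al u * T u * (1 + sg * T u))).
  have cE X : c * X = \sum_x omega x u * al x * X + \sum_b (u == bs b)%:R * bk b * X.
    by rewrite /c /killing mulrDl !mulr_suml.
  rewrite cE mulrDr !mulr_sumr addrACA -!big_split/=.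
  congr (_ + _); apply: eq_bigr.
    move=> x _; rewrite expectation_interaction secondE.
    have [->|_] := eqVneq x u; first by rewrite omega_diag !mul0r mulr0 add0r.
    by rewrite (omega_sym u x) mul0r addr0; ring.
  by move=> b _; have [ub|_] := eqVneq u (bs b); rewrite /= ?mulr0n ?mulr1n; ring.
by move: bal; rewrite E1 h mulr0 add0r => bal; lra.
Qed.

Lemma profile_adj u v : sg ^+ 2 = 1 -> adj omega u v -> T u = T v.
Proof.
move=> s1 uv.
have uNv : u != v by apply: contraNneq uv => ->; rewrite omega_diag.
have a0 z : al z != 0 by rewrite pnatr_eq0 -lt0n.
have /eqP := var_eq uNv; rewrite mulf_eq0 (negbTE uv)/= !var_diag => /eqP h.
have : al u * al v * (sg * (T u - T v) ^+ 2) = 0 by rewrite -[RHS]h; ring.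
move/eqP; rewrite !mulf_eq0 !(negbTE (a0 _))/= orbb subr_eq0 => /orP[/eqP s0|/eqP//].
by move/eqP: s1; rewrite s0 expr0n/= eq_sym oner_eq0.
Qed.

Lemma uncorrelated_equilibrium : sg ^+ 2 = 1 -> 0 < omegaL -> 0 < omegaR -> thetaL = thetaR.
Proof.
move=> s1 oL oR.
have Tc : forall x, T x == T ord0.
  apply: (adj_closed_all (a := fun x => T x == T ord0) (x := ord0)) => // y z yz /eqP <-.
  by rewrite (profile_adj s1 yz).
have Tbt b : T ord0 = bt b.
  have k0 : 0 < bk b by case: b; rewrite /res_rate mulr_gt0.
  (* With at least two sites the reservoirs act at different sites, so for a constant profile the
     harmonic equation at [bs b] involves only [bt b]. *)
  have bsN : bs b != bs (~~ b) by case: b {k0}; rewrite -val_eqE/=; case: n n_gt0.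
  have := harmonic (bs b); rewrite big1 ?add0r => [|x _]; last first.
    by rewrite (eqP (Tc x)) (eqP (Tc (bs b))) subrr mulr0.
  rewrite (bigD1 b)//= eqxx mul1r big1 ?addr0 => [|c cb]; last first.
    have -> : c = ~~ b by case: b c cb {k0 bsN} => [] [].
    by rewrite (negbTE bsN) mul0r.
  move/eqP; rewrite mulf_eq0 (gt_eqF k0)/= subr_eq0 => /eqP ->.
  by rewrite (eqP (Tc _)).
by have := Tbt true; rewrite (Tbt false).
Qed.

End Uncorrelated.

(** * Product form implies vanishing covariances *)

Lemma growth_indic k (A : set X) : growth k (\1_A : X -> R).
Proof.
exists 1 => eta; rewrite mul1r; have /andP[i0 i1] := indic_ge0_le1 (R := R) A eta.
by rewrite ger0_norm// (le_trans i1)// exprn_ege1// lerDl total_ge0.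
Qed.

(** The layer-cake form of [minn k (eta u)]: a sum of indicators of one-site events, to which
    product form applies directly. *)
Definition trunc_N (k : nat) u eta : R := \sum_(i < k) \1_[set eta : X | (i < eta u)%N] eta.

Lemma trunc_NE k u eta : trunc_N k u eta = (minn k (eta u))%:R.
Proof.
rewrite /trunc_N; elim: k => [|k IH]; first by rewrite big_ord0 min0n.
rewrite big_ord_recr/= IH indicE mem_setE/= -natrD; congr (_%:R).
by case: (ltnP k (eta u)) => ku; rewrite /= ?addn1 ?addn0 /minn; do ?case: ifP; lia.
Qed.

Lemma trunc_N_cvg u eta : trunc_N k u eta @[k --> \oo] --> N eta u.
Proof.
apply: cvg_near_cst; exists (eta u) => // k /= uk.
by rewrite trunc_NE (minn_idPr uk).
Qed.

Lemma trunc_N_le k u eta : 0 <= trunc_N k u eta <= N eta u.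
Proof. by rewrite trunc_NE ler0n ler_nat geq_minr. Qed.

(** Independence of the tail events at [u] and [v], summed over the levels, settles the truncated
    occupation numbers; square integrability removes the truncation. *)
Lemma product_expectation (m : I -> probability nat R) u v : is_product_of mu m -> u != v ->
  second u v = E (N ^~ u) * E (N ^~ v).
Proof.
move=> mP uv.
pose A i u := [set eta : X | (i < eta u)%N].
have muA (B : I -> set nat) (w : I) : (forall x, x != w -> B x = setT) ->
    mu [set eta : X | forall x, B x (eta x)] = m w (B w).
  move=> BT; rewrite mP (bigD1 w)//= big1 ?mule1// => x xw.
  by rewrite BT// probability_setT.
have A1 i w : mu (A i w) = m w [set k | (i < k)%N].
  pose B x := if x == w then [set k | (i < k)%N] else setT.
  have -> : A i w = [set eta : X | forall x, B x (eta x)].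
    apply/seteqP; split => eta /=; last by move=> /(_ w); rewrite /B eqxx.
    by move=> iw x; rewrite /B; case: eqP => // ->.
  rewrite (muA B w) /B ?eqxx// => x; exact: ifN.
have A2 i j : mu (A i u `&` A j v) = (mu (A i u) * mu (A j v))%E.
  rewrite !A1.
  pose B x := if x == u then [set k | (i < k)%N] else if x == v then [set k | (j < k)%N] else setT.
  have -> : A i u `&` A j v = [set eta : X | forall x, B x (eta x)].
    apply/seteqP; split => eta /=.
      by move=> [iu jv] x; rewrite /B; case: eqP => [->//|_]; case: eqP => [->|].
    move=> h; split; first by have := h u; rewrite /B eqxx.
    by have := h v; rewrite /B eq_sym (negbTE uv) eqxx.
  rewrite mP (bigD1 u)//= (bigD1 v)/=; last by rewrite eq_sym.
  rewrite /B eqxx (eq_sym v) (negbTE uv) eqxx big1 ?mule1// => x /andP[xu xv].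
  by rewrite (negbTE xu) (negbTE xv) probability_setT.
have Etr k w : E (trunc_N k w) = \sum_(i < k) fine (mu (A i w)).
  rewrite expectation_sum; last by move=> i; exact: growth_indic.
  by apply: eq_bigr => i _; rewrite mean_indic.
have Etr2 k : E (fun eta => trunc_N k u eta * trunc_N k v eta) = E (trunc_N k u) * E (trunc_N k v).
  rewrite !Etr mulr_suml.
  rewrite (_ : (fun eta => _) = fun eta =>
    \sum_(i < k) \sum_(j < k) \1_(A i u `&` A j v) eta); last first.
    apply/funext => eta; rewrite mulr_suml; apply: eq_bigr => i _; rewrite mulr_sumr.
    by apply: eq_bigr => j _; rewrite indicI.
  rewrite expectation_sum; last by move=> i; apply: growth_sum => j; exact: growth_indic.
  apply: eq_bigr => i _; rewrite expectation_sum; last by move=> j; exact: growth_indic.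
  rewrite mulr_sumr; apply: eq_bigr => j _; rewrite mean_indic//.
  by apply: (etrans (congr1 fine (A2 i j))); rewrite fineM//; exact: fin_num_measure.
have cv w : E (trunc_N k w) @[k --> \oo] --> E (N ^~ w).
  apply: (mean_dominated_cvg config_discrete (growth_integrable (growth_N2 w))).
    by move=> k eta; have /andP[t0 t1] := trunc_N_le k w eta; rewrite ger0_norm.
  by move=> eta; exact: trunc_N_cvg.
have cv2 : E (fun eta => trunc_N k u eta * trunc_N k v eta) @[k --> \oo] --> second u v.
  apply: (mean_dominated_cvg config_discrete (growth_integrable (growth_NN u v))).
    move=> k eta; have /andP[t0 t1] := trunc_N_le k u eta; have /andP[t2 t3] := trunc_N_le k v eta.
    by rewrite ger0_norm ?mulr_ge0// ler_pM.
  by move=> eta; apply: cvgM; exact: trunc_N_cvg.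
move: cv2; rewrite (_ : (fun k => E _) = fun k => E (trunc_N k u) * E (trunc_N k v)).
  by move=> cv2; apply: (cvg_unique (@Rhausdorff R) cv2); apply: cvgM; exact: cv.
by apply/funext => k; exact: Etr2.
Qed.

Lemma product_uncorrelated x y : product_form mu -> x <> y -> covariance2 mu x y = 0.
Proof.
move=> [m mP] /eqP xy; have a0 z : al z != 0 by rewrite pnatr_eq0 -lt0n.
rewrite covariance2E (product_expectation mP xy) !expectation_N; field.
by rewrite !a0.
Qed.

End Moments.

(** * Independent particles *)

Section IndependentParticles.
Context (s0 : sigma = 0) (T : I -> R) (T_ge0 : forall x, 0 <= T x).
Context (T_harmonic : forall u, \sum_x omega u x * al x * (T x - T u) +
  \sum_b (u == bs b)%:R * (bk b * (bt b - T u)) = 0).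
Context (pi : probability X R) (piP : is_product_of pi (fun x => nu_poisson (alpha x) (T x))).
Local Notation E f := (Rintegral pi setT f).
Local Notation int f := (pi.-integrable setT (EFin \o f)).

Let sg0 : sg = 0. Proof. by rewrite s0 mulr0z. Qed.

Let sN1 : sigma <> -1. Proof. by rewrite s0. Qed.

Let N_add x eta z : N (add_particle x eta) z = N eta z + (z == x)%:R.
Proof. by apply: addP => /sN1. Qed.

Let N_remove x eta z : N eta x != 0 -> N (remove_particle x eta) z = N eta z - (z == x)%:R.
Proof. by move=> Nx; apply: removeP; move: Nx; rewrite /N pnatr_eq0 lt0n. Qed.

Let add_remove x eta : N eta x != 0 -> add_particle x (remove_particle x eta) = eta.
Proof. by move=> Nx; apply: config_eq => z; rewrite N_add N_remove// subrK. Qed.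

Let remove_add x eta : remove_particle x (add_particle x eta) = eta.
Proof.
apply: config_eq => z; rewrite N_remove N_add ?addrK// eqxx.
by rewrite gt_eqF// ltr_wpDl ?N_ge0.
Qed.

Lemma poisson_recurrence (rate : R) k j : 0 <= rate ->
  (k.+1%:R * fine (poisson_prob rate j [set k.+1]) : R) = rate * fine (poisson_prob rate j [set k]).
Proof.
rewrite le_eqVlt => /orP[/eqP <-|r0].
  (* At rate 0 the law is the Dirac mass at 0, which does not charge [k.+1]. *)
  by rewrite /poisson_prob ltxx mul0r diracE memNset//= mulr0.
rewrite /poisson_prob r0 !esum_set1 ?lee_fin ?poisson_pmf_ge0//=.
rewrite /poisson_pmf r0 factS natrM exprS; field.
by rewrite nat1r !pnatr_eq0 -!lt0n fact_gt0.
Qed.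

Lemma product_singleton (m : I -> probability nat R) (zeta : X) : is_product_of pi m ->
  fine (pi [set zeta]) = \prod_x fine (m x [set zeta x]).
Proof.
move=> mP; have -> : [set zeta] = [set eta : X | forall x, [set zeta x] (eta x)].
  apply/seteqP; split => eta /=; first by move=> ->.
  by move=> h; apply/val_inj/ffunP => x; exact: h.
apply: (etrans (congr1 fine (mP (fun x => [set zeta x])))).
suff -> : (\prod_x m x [set zeta x] = (\prod_x fine (m x [set zeta x]))%:E)%E by [].
rewrite -prodEFin; apply: eq_bigr => x _.
by rewrite fineK// fin_num_measure.
Qed.

(** Only the factor at [x] changes, by the Poisson recurrence. This is Mecke's formula for a single
    configuration. *)
Lemma pi_add x zeta :
  (N zeta x + 1) * fine (pi [set add_particle x zeta]) = al x * T x * fine (pi [set zeta]).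
Proof.
have E1 := product_singleton (add_particle x zeta) piP.
have E2 := product_singleton zeta piP.
rewrite E1 E2 (bigD1 x)//= [in RHS](bigD1 x)//=.
have -> : \prod_(y < n.+1 | y != x) fine (nu_poisson (alpha y) (T y) [set add_particle x zeta y]) =
    \prod_(y < n.+1 | y != x) fine (nu_poisson (alpha y) (T y) [set zeta y]).
  apply: eq_bigr => y yx; suff -> : add_particle x zeta y = zeta y by [].
  apply/eqP; rewrite -(eqr_nat R); apply/eqP.
  by have := N_add x zeta y; rewrite (negbTE yx) addr0.
have -> : add_particle x zeta x = (zeta x).+1.
  apply/eqP; rewrite -(eqr_nat R) -natr1; apply/eqP.
  by have := N_add x zeta x; rewrite eqxx.
have := @poisson_recurrence (al x * T x) (zeta x) 0%N (mulr_ge0 (ler0n _ _) (T_ge0 x)).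
rewrite -natr1 => rec; rewrite !mulrA; congr (_ * _); exact: rec.
Qed.

Let lam x : R := al x * T x.
Let lam_ge0 x : 0 <= lam x. Proof. by rewrite mulr_ge0. Qed.
Let pi1 : pi setT = 1%E := probability_setT pi.

Lemma remove_indic x zeta : (fun eta => N eta x * \1_[set zeta] (remove_particle x eta)) =
  (fun eta => (N zeta x + 1) * \1_[set add_particle x zeta] eta) :> (X -> R).
Proof.
apply/funext => eta; have [->|ne] := pselect (eta = add_particle x zeta).
  by rewrite remove_add !indic_set1 N_add eqxx.
rewrite (indic_set1_neq ne) mulr0.
have [->|Nx] := eqVneq (N eta x) 0; first by rewrite mul0r.
rewrite indic_set1_neq ?mulr0// => rz; apply: ne.
by rewrite -rz add_remove.
Qed.

(** Linearity reduces this to indicators of single configurations, where it is [pi_add]. Boundedness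
    is carried along because integrability of [N ^~ x] is only derived from this lemma. *)
Lemma mecke_finite x (F : X -> R) A : finite_set A -> (forall eta, ~ A eta -> F eta = 0) ->
  bounded_function (fun eta => N eta x * F (remove_particle x eta)) /\
  E (fun eta => N eta x * F (remove_particle x eta)) = lam x * E F.
Proof.
move=> finA FA.
suff: bounded_function F /\ (bounded_function (fun eta => N eta x * F (remove_particle x eta)) /\
    E (fun eta => N eta x * F (remove_particle x eta)) = lam x * E F) by case.
apply: (finite_support_ind (Q := fun F => bounded_function F /\
  (bounded_function (fun eta => N eta x * F (remove_particle x eta)) /\
    E (fun eta => N eta x * F (remove_particle x eta)) = lam x * E F)) _ _ finA FA).
  have -> : (fun eta => N eta x * 0) = (fun=> 0) :> (X -> R) by apply/funext => eta; rewrite mulr0.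
  by rewrite mean_cst ?mulr0//; do ?split; exact: bounded_cst.
move=> F0 a zeta [bF [bNF EF]].
have b1 : bounded_function (\1_[set zeta] : X -> R) := bounded_indic _.
have b2 : bounded_function (\1_[set add_particle x zeta] : X -> R) := bounded_indic _.
have b3 (c : R) : bounded_function (fun eta => c * \1_[set add_particle x zeta] eta).
  by apply: boundedM => //; exact: bounded_cst.
have b4 : bounded_function (fun eta => a * \1_[set zeta] eta).
  by apply: boundedM => //; exact: bounded_cst.
have -> : (fun eta => N eta x *
      (F0 (remove_particle x eta) + a * \1_[set zeta] (remove_particle x eta))) =
    (fun eta => N eta x * F0 (remove_particle x eta) +
      (a * (N zeta x + 1)) * \1_[set add_particle x zeta] eta).
  apply/funext => eta; rewrite mulrDr mulrCA.
  by rewrite (congr1 (fun h => h eta) (remove_indic x zeta)) mulrA.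
split; first exact: boundedD.
split; first exact: boundedD.
rewrite (meanD config_discrete pi1 bNF (b3 _)) (meanZ config_discrete pi1 _ b2) EF.
rewrite (meanD config_discrete pi1 bF b4) (meanZ config_discrete pi1 _ b1) [RHS]mulrDr.
congr (_ + _).
by rewrite !mean_indic// -mulrA pi_add /lam; ring.
Qed.

(** Mecke's formula for indicators of growing finite sets bounds the means of functions increasing
    to [N ^~ x] by [lam x]. *)
Lemma N_integrable x : int (N ^~ x).
Proof.
pose A (k : nat) := [set eta : X | total eta <= k%:R].
have finA k : finite_set (A k).
  apply: sub_finite_set (total_sq_finite (k%:R ^+ 2)) => eta /= etaK.
  by rewrite ler_sqr ?nnegrE ?total_ge0.
have mk k := @mecke_finite x \1_(A k) (A k) (finA k).
have offA k eta : ~ A k eta -> \1_(A k) eta = 0 :> R by move=> nA; rewrite indicE memNset.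
apply: (monotone_limit_integrable config_discrete
  (g := fun k eta => N eta x * \1_(A k) (remove_particle x eta)) (B := lam x)).
- by move=> k eta; rewrite mulr_ge0 ?N_ge0.
- move=> eta i j ij; rewrite ler_wpM2l ?N_ge0//.
  have [Ai|nAi] := pselect (A i (remove_particle x eta)); last first.
    by rewrite offA//; case/andP: (indic_ge0_le1 (R := R) (A j) (remove_particle x eta)).
  by rewrite !indicE !mem_set// /A /= (le_trans Ai)// ler_nat.
- move=> eta; exists (Num.truncn (total (remove_particle x eta))).+1 => // k /= tk.
  rewrite indicE mem_set ?mulr1// /A /= ltW// (lt_le_trans (truncnS_gt _))//.
  by rewrite ler_nat.
- by move=> k; case: (mk k (offA k)).
- move=> k; have [_ ->] := mk k (offA k).
  by rewrite ler_piMr// mean_bounded_le//; exact: bounded_indic.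
Qed.

Lemma N_mul_integrable x (F : X -> R) : bounded_function F -> int (fun eta => N eta x * F eta).
Proof.
move=> [M FM]; apply: (dominated_integrable_real config_discrete
  (integrable_scale M (N_integrable x))) => eta.
by rewrite normrM ger0_norm ?N_ge0// mulrC ler_wpM2r ?N_ge0.
Qed.

Lemma mecke x (F : X -> R) : bounded_function F ->
  E (fun eta => N eta x * F (remove_particle x eta)) = lam x * E F.
Proof.
move=> bF; have [M M0 FM] := bounded_gt0 bF.
pose A (k : nat) := [set eta : X | total eta <= k%:R].
have finA k : finite_set (A k).
  apply: sub_finite_set (total_sq_finite (k%:R ^+ 2)) => eta /= etaK.
  by rewrite ler_sqr ?nnegrE ?total_ge0.
pose G k eta : R := \1_(A k) eta * F eta.
have GM k eta : `|G k eta| <= M.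
  have /andP[i0 i1] := indic_ge0_le1 (R := R) (A k) eta.
  by rewrite /G normrM ger0_norm// (le_trans _ (FM eta))// ler_piMl.
have GE eta : \forall k \near \oo, G k eta = F eta.
  exists (Num.truncn (total eta)).+1 => // k /= tk.
  rewrite /G indicE mem_set ?mul1r// /A /= ltW// (lt_le_trans (truncnS_gt _))//.
  by rewrite ler_nat.
have c1 : E (fun eta => N eta x * G k (remove_particle x eta)) @[k --> \oo] -->
    E (fun eta => N eta x * F (remove_particle x eta)).
  apply: (mean_dominated_cvg config_discrete (integrable_scale M (N_integrable x))) => [k eta|eta].
    by rewrite normrM ger0_norm ?N_ge0// mulrC ler_wpM2r ?N_ge0.
  apply: cvg_near_cst; apply: filterS (GE (remove_particle x eta)) => k.
  by move=> /= ->.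
have c2 : lam x * E (G k) @[k --> \oo] --> lam x * E F.
  apply: cvgMr; apply: (mean_dominated_cvg config_discrete (g := fun=> M)).
  - by apply: bounded_integrable => //; exact: bounded_cst.
  - by move=> k eta; exact: GM.
  - by move=> eta; apply: cvg_near_cst; exact: GE.
have EG k : E (fun eta => N eta x * G k (remove_particle x eta)) = lam x * E (G k).
  have offG eta : ~ A k eta -> G k eta = 0 by move=> nA; rewrite /G indicE memNset// mul0r.
  by case: (@mecke_finite x (G k) (A k) (finA k) offG).
apply: (cvg_unique (@Rhausdorff R) c1).
by rewrite (_ : (fun k => E _) = fun k => lam x * E (G k))//; apply/funext => k; exact: EG.
Qed.

Lemma bounded_comp (F : X -> R) (h : X -> X) : bounded_function F -> bounded_function (F \o h).
Proof. by move=> [M FM]; exists M => eta; exact: FM. Qed.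

(** Mecke's formula turns every rate [N eta x] into the constant [lam x] and every move into
    differences of the [G x], the mean effect on [g] of one more particle at [x]. After summation by
    parts, [al u * G u] is multiplied by the harmonic equation at [u]. *)
Lemma product_generator0 (g : X -> R) : bounded_function g -> E (L g) = 0.
Proof.
move=> bg; pose G x := E (fun eta => g (add_particle x eta)) - E g.
have ba x : bounded_function (fun eta => g (add_particle x eta)).
  exact: (bounded_comp (add_particle x) bg).
have Nmove x y : int (fun eta => N eta x * g (add_particle y (remove_particle x eta))) /\
    E (fun eta => N eta x * g (add_particle y (remove_particle x eta))) = lam x * (G y + E g).
  split.
    apply: (N_mul_integrable x (F := fun eta => g (add_particle y (remove_particle x eta)))).
    exact: (bounded_comp (fun eta => add_particle y (remove_particle x eta)) bg).
  by rewrite (mecke x (ba y)) /G subrK.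
have Nrem x : int (fun eta => N eta x * g (remove_particle x eta)) /\
    E (fun eta => N eta x * g (remove_particle x eta)) = lam x * E g.
  split; last exact: mecke.
  apply: (N_mul_integrable x (F := fun eta => g (remove_particle x eta))).
  exact: (bounded_comp (remove_particle x) bg).
have Nstay x : int (fun eta => N eta x * g eta) /\
    E (fun eta => N eta x * g eta) = lam x * (G x + E g).
  split; first exact: N_mul_integrable.
  rewrite -(Nmove x x).2; congr (Rintegral _ _ _); apply/funext => eta.
  by have [->|Nx] := eqVneq (N eta x) 0; rewrite ?mul0r// add_remove.
have gi : int g by apply: bounded_integrable.
have gai x : int (fun eta => g (add_particle x eta)) by apply: bounded_integrable.
have Ega x : E (fun eta => g (add_particle x eta)) = G x + E g by rewrite /G subrK.
pose hopT (p : I * I) eta : R := omega p.1 p.2 * al p.2 *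
    (N eta p.1 * g (add_particle p.2 (remove_particle p.1 eta))) +
  (- (omega p.1 p.2 * al p.2)) * (N eta p.1 * g eta).
pose outT b eta : R := bk b * (N eta (bs b) * g (remove_particle (bs b) eta)) +
  (- bk b) * (N eta (bs b) * g eta).
pose inT b eta : R := bk b * bt b * al (bs b) * g (add_particle (bs b) eta) +
  (- (bk b * bt b * al (bs b))) * g eta.
have LE : L g = fun eta => \sum_p hopT p eta + \sum_b (outT b eta + inT b eta).
  apply/funext => eta; rewrite /jump_generator sum_moves; congr (_ + _).
    rewrite pair_bigA/=; apply: eq_bigr => -[x y] _; rewrite /hopT /=.
    rewrite /hop_rate sg0 mul0r addr0.
    have [->|xy] := eqVneq x y; first by rewrite omega_diag !mul0r oppr0 !mul0r addr0.
    have [->|Nx] := eqVneq (N eta x) 0; first by rewrite !(mul0r, mulr0) addr0.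
    have -> : hop x y eta = add_particle y (remove_particle x eta).
      apply: config_eq => z; rewrite N_add N_remove// hopP//.
      by move: Nx; rewrite /N pnatr_eq0 lt0n.
    by ring.
  apply: eq_bigr => b _ /=; rewrite /outT /inT /out_rate /in_rate sg0; ring.
have i1 p : int (hopT p).
  apply: integrable_add; apply: integrable_scale; first exact: (Nmove _ _).1.
  exact: (Nstay _).1.
have i2 b : int (outT b).
  by apply: integrable_add; apply: integrable_scale; [exact: (Nrem _).1|exact: (Nstay _).1].
have i3 b : int (inT b) by apply: integrable_add; apply: integrable_scale.
have i4 b := integrable_add (i2 b) (i3 b).
have [i5 E5] := Rintegral_sum config_discrete i1.
have [i6 E6] := Rintegral_sum config_discrete i4.
rewrite LE RintegralD// E5 E6.
have -> : \sum_p E (hopT p) = \sum_x \sum_y omega x y * al y * al x * T x * (G y - G x).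
  rewrite pair_bigA/=; apply: eq_bigr => -[x y] _; rewrite /hopT /= RintegralD//.
  - rewrite !RintegralZl//; [|exact: (Nstay _).1|exact: (Nmove _ _).1].
    by rewrite (Nmove x y).2 (Nstay x).2 /lam; ring.
  - by apply: integrable_scale; exact: (Nmove _ _).1.
  - by apply: integrable_scale; exact: (Nstay _).1.
have Eb b : E (fun eta => outT b eta + inT b eta) =
    al (bs b) * G (bs b) * (bk b * (bt b - T (bs b))).
  rewrite RintegralD// /outT /inT RintegralD//.
  - rewrite RintegralD//; try exact: integrable_scale.
    rewrite !RintegralZl//; [|exact: (Nstay _).1|exact: (Nrem _).1].
    by rewrite (Nrem _).2 (Nstay _).2 Ega /lam; ring.
  - by apply: integrable_scale; exact: (Nrem _).1.
  - by apply: integrable_scale; exact: (Nstay _).1.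
rewrite (eq_bigr _ (fun b _ => Eb b)).
have -> : \sum_x \sum_y omega x y * al y * al x * T x * (G y - G x) =
    \sum_u al u * G u * \sum_x omega u x * al x * (T x - T u).
  transitivity (\sum_x \sum_y omega x y * al y * al x * T x * G y -
    \sum_x \sum_y omega x y * al y * al x * T x * G x).
    by rewrite -sumrB; apply: eq_bigr => x _; rewrite -sumrB; apply: eq_bigr => y _; ring.
  rewrite [X in X - _]exchange_big/= -sumrB; apply: eq_bigr => u _.
  by rewrite mulr_sumr -sumrB; apply: eq_bigr => x _; rewrite (omega_sym x u); ring.
have -> : \sum_b al (bs b) * G (bs b) * (bk b * (bt b - T (bs b))) =
    \sum_u al u * G u * \sum_b (u == bs b)%:R * (bk b * (bt b - T u)).
  transitivity (\sum_b \sum_u (bs b == u)%:R * (al u * G u * (bk b * (bt b - T u)))).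
    by apply: eq_bigr => b _; rewrite sum_delta.
  rewrite exchange_big/=; apply: eq_bigr => u _; rewrite mulr_sumr.
  by apply: eq_bigr => b _; rewrite (eq_sym u); ring.
by rewrite -big_split/= big1// => u _; rewrite -mulrDr T_harmonic mulr0.
Qed.

(** For [sigma = 0] all rates are affine in the occupation numbers. This is the domination required
    by [invariant_of_generator]. *)
Lemma exit_rate_integrable : int (exit_rate move_rate).
Proof.
apply: (proj1 (Rintegral_sum config_discrete (F := move_rate) _)) => -[[x y]|[b []]].
- have -> : move_rate (inl (x, y)) = fun eta => (omega x y * al y) * N eta x.
    by apply/funext => eta /=; rewrite /hop_rate sg0; ring.
  by apply: integrable_scale; exact: N_integrable.
- by apply: (integrable_scale (bk b * (1 + sg * bt b))); exact: N_integrable.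
- have -> : move_rate (inr (b, false)) = fun=> bk b * bt b * al (bs b).
    by apply/funext => eta /=; rewrite /in_rate sg0; ring.
  by apply: bounded_integrable => //; exact: bounded_cst.
Qed.

Lemma stationary_product (mu : probability X R) : is_unique_stationary P mu ->
  is_product_of mu (fun x => nu_poisson (alpha x) (T x)).
Proof.
move=> ust A; rewrite -piP.
have [W [C [c [C0 c0 WS LW]]]] := lyapunov_exists.
have W0 eta : 0 <= W eta by rewrite (le_trans _ (WS eta))// sqr_ge0.
have Wfin B : finite_set [set eta | W eta <= B].
  by apply: sub_finite_set (total_sq_finite B) => eta /=; apply: le_trans.
have bA : bounded_function (\1_[set eta : X | forall x, A x (eta x)] : X -> R) := bounded_indic _.
have := unique_stationary_invariant config_discrete ust
  (fun t => invariant_of_generator config_discrete move_rate_ge0 jump_process W0 C0 c0 Wfin LW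
    exit_rate_integrable product_generator0 bA) bA.
rewrite !mean_indic// => h.
have f1 := fin_num_measure mu _ (config_discrete [set eta : X | forall x, A x (eta x)]).
have f2 := fin_num_measure pi _ (config_discrete [set eta : X | forall x, A x (eta x)]).
by rewrite -(fineK f1) -(fineK f2); congr (_%:E).
Qed.

End IndependentParticles.

Lemma stationary_measure : exists mu : probability X R,
  [/\ is_unique_stationary P mu,
      sigma = 0 -> is_product_of mu (fun x => nu_poisson (alpha x) (profile mu x))
    & (1 < n.+1)%N -> sigma = -1 \/ sigma = 1 ->
      0 < omegaL -> 0 < omegaR -> thetaL <> thetaR ->
        (exists x y : I, x <> y /\ covariance2 mu x y <> 0) /\ ~ product_form mu].
Proof.
have [mu [ust inv mu_sq mu_gen]] := stationary_exists.
exists mu; split => // [s0|n1 s1 oL oR tLR].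
  have adm (eta : {ffun I -> nat}) : admissible sigma alpha eta by rewrite /admissible s0.
  have [pi piP] := product_law adm (fun x => nu_poisson (alpha x) (profile mu x)).
  apply: (stationary_product s0 _ (harmonic mu_sq mu_gen) piP ust) => x.
  by apply: Rintegral_ge0 => eta _; rewrite divr_ge0// ler0n.
have sg1 : sg ^+ 2 = 1 by case: s1 => ->; rewrite ?mulrN1z ?sqrrN expr1n.
have cov : exists x y : I, x <> y /\ covariance2 mu x y <> 0.
  apply: contrapT => ncov; apply: tLR.
  apply: (uncorrelated_equilibrium mu_sq mu_gen n1 _ sg1 oL oR) => x y xy.
  by apply: contrapT => cxy; apply: ncov; exists x, y.
split => // mu_prod; have [x [y [xy]]] := cov; apply.
by apply: product_uncorrelated.
Qed.

End BoundaryDriven.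

Theorem theorem3p3 (R : realType) (n : nat) (sigma : int)
  (alpha : 'I_n.+1 -> nat) (omega : 'I_n.+1 -> 'I_n.+1 -> R)
  (omegaL omegaR alphaL alphaR : R)
  (sigmaE : [\/ sigma = -1, sigma = 0 | sigma = 1])
  (alpha_gt0 : forall x, (0 < alpha x)%N)
  (omega_ge0 : forall x y, 0 <= omega x y)
  (omega_sym : forall x y, omega x y = omega y x)
  (omega_diag : forall x, omega x x = 0)
  (omega_conn : connected_graph omega)
  (omegaL_ge0 : 0 <= omegaL) (omegaR_ge0 : 0 <= omegaR)
  (alphaL_gt0 : 0 < alphaL) (alphaR_gt0 : 0 < alphaR)
  (omegaLR_gt0 : 0 < Num.max omegaL omegaR)
  (thetaL thetaR : R)
  (thetaL_in : in_Theta sigma thetaL) (thetaR_in : in_Theta sigma thetaR)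
  (P : R -> R.-pker (config sigma alpha) ~> (config sigma alpha))
  (P_process : markov_process_with_generator P
     (generator omega omegaL omegaR alphaL alphaR thetaL thetaR)) :
  exists mu : probability (config sigma alpha) R,
    [/\ is_unique_stationary P mu,
        sigma = 0 ->
          is_product_of mu (fun x => nu_poisson (alpha x) (profile mu x))
      & (1 < n.+1)%N -> sigma = -1 \/ sigma = 1 ->
        0 < omegaL -> 0 < omegaR -> thetaL <> thetaR ->
          (exists x y : 'I_n.+1, x <> y /\ covariance2 mu x y <> 0) /\
          ~ product_form mu].
Proof.
exact: (stationary_measure sigmaE alpha_gt0 omega_ge0 omega_sym omega_diag omega_conn
  omegaL_ge0 omegaR_ge0 alphaL_gt0 alphaR_gt0 omegaLR_gt0 thetaL_in thetaR_in P_process).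
Qed.
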